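(* Let $\alpha>-1$. There exists an integer $p\geq 1$, not depending on the symbol $g$, with the following property. For every $g\in\mathcal{B}_0$ there are constants $c,C>0$, independent of $n$, such that the singular values of the operator $I_g$ acting on $\mathcal{A}^2_\alpha$ satisfy $$c\,\sqrt{a_{pn}(m_g)}\;\leq\; s_n(I_g)\quad\text{for all } n\geq 1,$$ $$s_n(I_g)\;\leq\; C\,\sqrt{a_{[n/p]}(m_g)}\quad\text{for all } n\geq 1 \text{ with } [n/p]\geq 1,$$ where $[n/p]$ is the integer part of $n/p$.
   Context: $\mathbb{D}$ is the open unit disc, $\mathbb{T}$ the unit circle, and $m$ is normalized Lebesgue (area) measure on $\mathbb{D}$. For $\alpha>-1$, the weighted Bergman space $\mathcal{A}^2_\alpha$ is the space of analytic functions $f$ on $\mathbb{D}$ with $\|f\|_\alpha^2=(\alpha+1)\int_{\mathbb{D}}|f(z)|^2(1-|z|^2)^\alpha\,dm(z)<\infty$. For $g$ analytic on $\mathbb{D}$, the integration operator is $I_gf(z)=\int_0^z f(\zeta)g'(\zeta)\,d\zeta$. The little Bloch space $\mathcal{B}_0$ is the set of analytic $g$ on $\mathbb{D}$ with $\lim_{|z|\to1}(1-|z|^2)|g'(z)|=0$; for such $g$ the operator $I_g$ is compact on $\mathcal{A}^2_\alpha$. The singular values of a compact operator $T$ are $s_n(T)=\inf\{\|T-R\|:\operatorname{rank}R<n\}$, $n\geq1$. For an arc $I\subset\mathbb{T}$ of length $|I|$, $R(I)=\{z\in\mathbb{D}:|I|/4\pi<1-|z|\leq|I|/2\pi,\ z/|z|\in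 I\}$. The dyadic arcs are $I_{n,k}=\{e^{i\theta}:2\pi k/2^n\leq\theta<2\pi(k+1)/2^n\}$, $n\geq1$, $1\leq k\leq2^n$. For $g$ analytic on $\mathbb{D}$ let $dm_g(z)=|g'(z)|^2(1-|z|^2)^2dm(z)$. For $g\in\mathcal{B}_0$ one has $\sup_{1\leq k\leq 2^n}m_g(R(I_{n,k}))/m(R(I_{n,k}))\to0$ as $n\to\infty$, and $(a_n(m_g))_{n\geq1}$ denotes the nonincreasing rearrangement of the family $\left(m_g(R(I_{n,k}))/m(R(I_{n,k}))\right)_{n,k}$, i.e. $a_n(m_g)=m_g(R(I_n))/m(R(I_n))$ where $(I_n)_{n\geq1}$ is an enumeration of the dyadic arcs making this sequence nonincreasing. *)

(* Defs.v *)
From mathcomp Require Import all_boot all_order all_algebra.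
From mathcomp Require Import all_classical all_reals all_analysis.
From mathcomp Require Import complex.

Set Implicit Arguments.
Unset Strict Implicit.
Unset Printing Implicit Defensive.

Import Order.TTheory GRing.Theory Num.Theory numFieldNormedType.Exports.

Local Open Scope classical_set_scope.
Local Open Scope ring_scope.
Local Open Scope complex_scope.

(* [`|z|] lives in [R[i]] for [z : R[i]]; this is the same number in [R]. *)
Definition modulus (R : realType) (z : R[i]) : R := Normc.normc z.

Definition unit_disc (R : realType) : set R[i] := [set z | modulus z < 1].

Definition expi (R : realType) (t : R) : R[i] := cos t +i* sin t.

(* Functions on the disc are represented by total functions on [R[i]]; no
   notion below depends on their values outside the disc. [R[i]^o] is the
   field of complex numbers as a normed space over itself, so that [derivable]
   and [derive1] are about complex difference quotients. *)
Definition analytic_on_disc (R : realType) (f : R[i] -> R[i]) : Prop :=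
  forall z, unit_disc z -> derivable (f : R[i]^o -> R[i]^o) z 1.

Definition complex_derive (R : realType) (f : R[i] -> R[i]) (z : R[i]) : R[i] :=
  derive1 (f : R[i]^o -> R[i]^o) z.

Lemma invr_pi_ge0 (R : realType) : 0 <= (pi : R)^-1.
Proof. by rewrite invr_ge0 pi_ge0. Qed.

(* The factor [pi^-1] gives the unit disc mass one. *)
Definition plane_area (R : realType) :
    {measure set (measurableTypeR R * measurableTypeR R) -> \bar R} :=
  mscale (NngNum (invr_pi_ge0 R)) (lebesgue_measure \x lebesgue_measure)%E.

Definition complex_of_pair (R : realType) (w : R * R) : R[i] := w.1 +i* w.2.

Definition area (R : realType) (E : set R[i]) : \bar R :=
  plane_area R (@complex_of_pair R @^-1` E).

Definition area_integral (R : realType) (E : set R[i]) (F : R[i] -> R) : \bar R :=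
  (\int[plane_area R]_(w in @complex_of_pair R @^-1` E)
     (F (complex_of_pair w))%:E)%E.

(* Takes the value [+oo] when the defining integral diverges. *)
Definition bergman_norm (R : realType) (alpha : R) (f : R[i] -> R[i]) : \bar R :=
  sqrte ((alpha + 1)%:E *
    area_integral (@unit_disc R)
      (fun z => modulus (f z) ^+ 2 * (1 - modulus z ^+ 2) `^ alpha)%R)%E.

Definition bergman_space (R : realType) (alpha : R) : set (R[i] -> R[i]) :=
  [set f | analytic_on_disc f /\ (bergman_norm alpha f < +oo)%E].

(* The line integral of [f] along the segment from [0] to [z]. *)
Definition segment_integral (R : realType) (f : R[i] -> R[i]) (z : R[i]) : R[i] :=
  (\int[lebesgue_measure]_(t in `[0%R, 1%R]) complex.Re (f (t%:C * z) * z))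
  +i* (\int[lebesgue_measure]_(t in `[0%R, 1%R]) complex.Im (f (t%:C * z) * z)).

Definition integration_operator (R : realType) (g f : R[i] -> R[i]) :
    R[i] -> R[i] :=
  segment_integral (fun z => f z * complex_derive g z).

Definition little_bloch (R : realType) : set (R[i] -> R[i]) :=
  [set g | analytic_on_disc g /\
    forall e : R, 0 < e -> exists2 r : R, r < 1 &
      forall z, r < modulus z < 1 ->
        (1 - modulus z ^+ 2) * modulus (complex_derive g z) < e].

Definition operator_norm (R : realType) (alpha : R)
    (T : (R[i] -> R[i]) -> R[i] -> R[i]) : \bar R :=
  ereal_sup [set bergman_norm alpha (T f) | f in
    [set f | bergman_space alpha f /\ (bergman_norm alpha f <= 1)%E]].

(* Linearity is required on the disc only. Together with the finiteness of the
   norm it makes [T f] on the disc independent of [f] outside the disc, so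
   these are exactly the bounded linear operators on the Bergman space. *)
Definition bounded_operator (R : realType) (alpha : R)
    (T : (R[i] -> R[i]) -> R[i] -> R[i]) : Prop :=
  [/\ forall f, bergman_space alpha f -> bergman_space alpha (T f),
      forall (b : R[i]) f h, bergman_space alpha f -> bergman_space alpha h ->
        forall z, unit_disc z ->
          T (fun w => b * f w + h w) z = b * T f z + T h z
    & (operator_norm alpha T < +oo)%E].

(* On the Bergman space, [T] has rank less than [n]. *)
Definition rank_lt (R : realType) (alpha : R)
    (T : (R[i] -> R[i]) -> R[i] -> R[i]) (n : nat) : Prop :=
  exists2 k, (k < n)%N &
    exists2 u : 'I_k -> R[i] -> R[i], (forall i, bergman_space alpha (u i)) &
      forall f, bergman_space alpha f -> exists b : 'I_k -> R[i],
        forall z, unit_disc z -> T f z = \sum_(i < k) b i * u i z.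

Definition singular_value (R : realType) (alpha : R)
    (T : (R[i] -> R[i]) -> R[i] -> R[i]) (n : nat) : \bar R :=
  ereal_inf [set operator_norm alpha (fun f z => T f z - S f z) | S in
    [set S | bounded_operator alpha S /\ rank_lt alpha S n]].

Definition arc_length (R : realType) (I : set R[i]) : R :=
  fine (lebesgue_measure [set t : R | 0 <= t < 2 * pi /\ I (expi t)]).

Definition arc_region (R : realType) (I : set R[i]) : set R[i] :=
  [set z | [/\ unit_disc z,
    arc_length I / (4 * pi) < 1 - modulus z <= arc_length I / (2 * pi) &
    I (z / `|z|)]].

Definition dyadic_arc (R : realType) (nk : nat * nat) : set R[i] :=
  @expi R @` [set t : R | 2 * pi * nk.2%:R / 2 ^+ nk.1 <= t
                        < 2 * pi * nk.2.+1%:R / 2 ^+ nk.1].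

Definition dyadic_index : set (nat * nat) :=
  [set nk | (1 <= nk.1)%N /\ (1 <= nk.2 <= 2 ^ nk.1)%N].

Definition symbol_measure (R : realType) (g : R[i] -> R[i]) (E : set R[i]) :
    \bar R :=
  area_integral E
    (fun z => modulus (complex_derive g z) ^+ 2 * (1 - modulus z ^+ 2) ^+ 2).

Definition symbol_mean (R : realType) (g : R[i] -> R[i]) (I : set R[i]) : R :=
  fine (symbol_measure g (arc_region I)) / fine (area (arc_region I)).

(* [a n] is meaningful for [n >= 1] only. *)
Definition decreasing_rearrangement (R : realType) (g : R[i] -> R[i])
    (a : nat -> R) : Prop :=
  exists e : nat -> nat * nat,
    [/\ set_bij [set n | (1 <= n)%N] dyadic_index e,
        forall n, (1 <= n)%N -> a n = symbol_mean g (dyadic_arc (e n))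
      & forall m n, (1 <= m <= n)%N -> a n <= a m].

(* Main.v *)
(** The disc is cut into dyadic Whitney boxes [box n k] of side comparable to
    [2^-n]; for [n >= 1] they are the regions of the dyadic arcs. Since [I_g f] has
    derivative [f g'], a Hardy inequality bounds [|| I_g f ||^2] by the integral of
    [|f g'|^2 (1 - |z|^2)^(alpha + 2)], and Cauchy estimates give the converse bound
    locally. On a box, subharmonicity of [|f|^2] compares that integral with the
    mean of [m_g] times the norm of [f] on a neighbourhood of the box, and these
    neighbourhoods have bounded overlap.

    Upper bound: if [h] vanishes on a fine mesh, of fixed size, in each of the first
    [m] boxes, then [h g'] is small there compared with itself nearby; these boxes
    are absorbed, and the others contribute at most [a_m || h ||^2]. Subtracting from
    [f] a finite rank interpolant of almost minimal norm makes it vanish on the mesh.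

    Lower bound: among the first [p n] boxes there are [n] whose normalised kernels
    [r^(gamma - sigma) / (1 - conj z_j z)^gamma], [sigma = (alpha + 2) / 2], interact
    so little that, by the Schur test, [|| I_g F ||^2] is at least a multiple of
    [a_(p n) sum |c_j|^2] for each combination [F] with coefficients [c_j]. An
    operator of rank less than [n] kills such a combination. *)
From HB Require Import structures.
Require Import Defs.
From mathcomp Require Import all_boot all_order all_algebra.
From mathcomp Require Import all_classical all_reals all_analysis.
From mathcomp Require Import complex measurable_realfun ring lra zify.

Set Implicit Arguments.
Unset Strict Implicit.
Unset Printing Implicit Defensive.

Import Order.TTheory GRing.Theory Num.Theory numFieldNormedType.Exports.

Local Open Scope classical_set_scope.
Local Open Scope ring_scope.
Local Open Scope complex_scope.

(** * Complex derivatives *)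

Arguments modulus R z : simpl never.

(** [analytic_on_disc] only provides pointwise complex derivatives, so the function theory starts
    from Goursat's bisection. Squares replace circles: their sides give one-dimensional integrals,
    which Fubini turns into area integrals, and [2 pi i] becomes [sqW s], used through
    [4 <= |sqW s|]. The difficulty is uniformity: [p] may depend on [alpha] only. For the upper
    bound, the number [K] of mesh points per box is fixed before [g], and interpolation must not
    cost a factor growing with the number of points. The interpolant is built point by point from
    functions of almost minimal norm; each point loses a factor [t], and [t] is so close to 1 that
    the total loss is at most 2. For the lower bound, passing to boxes that are pairwise far apart
    costs the fixed factor [P + 1], and their distance appears as a factor [d ^ e] in front of a
    kernel matrix with both exponents lowered by [e]. The room for this is [sigma > 1/2], that is
    [alpha > -1], which is also what makes the recursion behind Hardy's inequality contract. *)

Section modulus_theory.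
Variable R : realType.
Implicit Types (z w : R[i]) (x y : R).

Lemma normE z : `|z| = (modulus z)%:C.
Proof. by rewrite normc_def; case: z. Qed.

Lemma modulus_ge0 z : 0 <= modulus z.
Proof. by case: z => a b; exact: sqrtr_ge0. Qed.

Lemma modulus0 : modulus (0 : R[i]) = 0. Proof. exact: Normc.normc0. Qed.

Lemma modulus1 : modulus (1 : R[i]) = 1. Proof. exact: Normc.normc1. Qed.

Lemma modulusM z w : modulus (z * w) = modulus z * modulus w.
Proof. exact: Normc.normcM. Qed.

Lemma modulusV z : modulus z^-1 = (modulus z)^-1.
Proof. exact: Normc.normcV. Qed.

Lemma modulusX z n : modulus (z ^+ n) = modulus z ^+ n.
Proof. by elim: n => [|n IH]; rewrite ?expr0 ?modulus1// !exprS modulusM IH. Qed.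

Lemma modulusN z : modulus (- z) = modulus z.
Proof. by case: z => a b; rewrite /modulus/= !sqrrN. Qed.

Lemma modulusB z w : modulus (z - w) = modulus (w - z).
Proof. by rewrite -modulusN opprB. Qed.

Lemma modulus_eq0 z : modulus z = 0 -> z = 0.
Proof. exact: Normc.eq0_normc. Qed.

Lemma modulus_gt0 z : (0 < modulus z) = (z != 0).
Proof.
rewrite lt_neqAle modulus_ge0 andbT eq_sym; congr (~~ _).
by apply/eqP/eqP => [/modulus_eq0//|->]; rewrite modulus0.
Qed.

Lemma ler_modulusD z w : modulus (z + w) <= modulus z + modulus w.
Proof. by have := ler_normD z w; rewrite !normE -rmorphD lecR. Qed.

Lemma ler_modulusB z w : modulus (z - w) <= modulus z + modulus w.
Proof. by rewrite -(modulusN w) ler_modulusD. Qed.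

Lemma ler_modulus_sub z w : modulus z - modulus w <= modulus (z - w).
Proof. by rewrite lerBlDr -{1}(subrK w z) ler_modulusD. Qed.

Lemma ler_modulus_sum (I : Type) (s : seq I) (P : pred I) (F : I -> R[i]) :
  modulus (\sum_(i <- s | P i) F i) <= \sum_(i <- s | P i) modulus (F i).
Proof.
elim/big_ind2 : _ => [|a b c d h1 h2|//]; first by rewrite modulus0.
by rewrite (le_trans (ler_modulusD _ _))// lerD.
Qed.

Lemma modulus_real x : modulus x%:C = `|x|.
Proof. by rewrite /modulus/= expr0n addr0 sqrtr_sqr. Qed.

Lemma modulusi : modulus ('i : R[i]) = 1.
Proof. by rewrite /modulus/= expr0n add0r expr1n sqrtr1. Qed.

Lemma sqr_modulus z : modulus z ^+ 2 = complex.Re z ^+ 2 + complex.Im z ^+ 2.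
Proof. by case: z => a b; rewrite /modulus/= sqr_sqrtr ?addr_ge0 ?sqr_ge0. Qed.

Lemma normr_Re_le z : `|complex.Re z| <= modulus z.
Proof.
rewrite -(ler_pXn2r (ltn0Sn 1)) ?nnegrE ?modulus_ge0//.
by rewrite sqr_modulus real_normK ?num_real// lerDl sqr_ge0.
Qed.

Lemma normr_Im_le z : `|complex.Im z| <= modulus z.
Proof.
rewrite -(ler_pXn2r (ltn0Sn 1)) ?nnegrE ?modulus_ge0//.
by rewrite sqr_modulus real_normK ?num_real// lerDr sqr_ge0.
Qed.

Lemma modulus_le_ReIm z : modulus z <= `|complex.Re z| + `|complex.Im z|.
Proof.
rewrite -(ler_pXn2r (ltn0Sn 1)) ?nnegrE ?modulus_ge0 ?addr_ge0//.
rewrite sqr_modulus sqrrD !real_normK ?num_real//.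
by rewrite -addrA lerD2l lerDr mulrn_wge0// mulr_ge0.
Qed.

Lemma creD z w : complex.Re (z + w) = complex.Re z + complex.Re w.
Proof. by case: z; case: w. Qed.
Lemma cimD z w : complex.Im (z + w) = complex.Im z + complex.Im w.
Proof. by case: z; case: w. Qed.
Lemma creN z : complex.Re (- z) = - complex.Re z.
Proof. by case: z. Qed.
Lemma cimN z : complex.Im (- z) = - complex.Im z.
Proof. by case: z. Qed.
Lemma creM z w : complex.Re (z * w) =
  complex.Re z * complex.Re w - complex.Im z * complex.Im w.
Proof. by case: z; case: w. Qed.
Lemma cimM z w : complex.Im (z * w) =
  complex.Re z * complex.Im w + complex.Im z * complex.Re w.
Proof. by case: z; case: w. Qed.

Lemma complexE z : z = complex.Re z +i* complex.Im z. Proof. by case: z. Qed.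

Lemma complex_ext z w : complex.Re z = complex.Re w ->
  complex.Im z = complex.Im w -> z = w.
Proof. by case: z w => a b [c d] /= -> ->. Qed.

Lemma addiE x y : x +i* y = x%:C + 'i * y%:C.
Proof. by apply: complex_ext; rewrite ?creD ?creM ?cimD ?cimM/=; ring. Qed.

Lemma ltc0_real (e : R[i]) : 0 < e -> 0 < complex.Re e /\ e = (complex.Re e)%:C.
Proof. by case: e => a b; rewrite ltcE/= => /andP[/eqP -> ->]. Qed.

End modulus_theory.

Section complex_derivative.
Variable R : realType.
Implicit Types (f g : R[i] -> R[i]) (z w d : R[i]).

(** The derivative in the division-free form [f (z + h) = f z + d h + o(h)]: the increment [h = 0]
    is no exception, and the differentiation rules become real inequalities on [modulus]. *)
Definition cderiv f z d := forall e : R, 0 < e -> exists2 del : R, 0 < del &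
  forall h, modulus h < del -> modulus (f (z + h) - f z - d * h) <= e * modulus h.

Lemma cderiv_cvg f z d : cderiv f z d <->
  (fun h : R[i]^o => h^-1 *: ((f : R[i]^o -> R[i]^o) (h + z) - f z))
    @ (0 : R[i]^o)^' --> (d : R[i]^o).
Proof.
split=> [H|H].
  apply/cvgrPdist_le => e /ltc0_real[e0 ee].
  have [del d0 hd] := H _ e0.
  apply/nbhs_ballP; exists del%:C; first by rewrite /= ltcR.
  move=> h; rewrite /ball/= sub0r normrN normE ltcR => hdel h0.
  have hh : 0 < modulus h by rewrite modulus_gt0.
  rewrite ee normE lecR.
  rewrite -(ler_pM2r hh) -modulusM mulrBl -[_ *: _]/(_ * _) mulrAC mulVf// mul1r.
  by rewrite modulusB (addrC h z); exact: hd.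
move=> e e0.
have /cvgrPdist_le/(_ e%:C) := H; rewrite ltcR => /(_ e0).
move=> /nbhs_ballP[del /= /ltc0_real[del0 ->] hd].
exists (complex.Re del) => // h hdel.
have [->|h0] := eqVneq h 0; first by rewrite !(addr0,mulr0,subrr,modulus0).
have hh : 0 < modulus h by rewrite modulus_gt0.
have := hd h; rewrite /ball/= sub0r normrN normE ltcR => /(_ hdel h0).
rewrite normE lecR -(ler_pM2r hh) -modulusM mulrBl -[_ *: _]/(_ * _).
by rewrite mulrAC mulVf// mul1r modulusB (addrC h z).
Qed.

Lemma cderiv_derive f z d : cderiv f z d -> complex_derive f z = d.
Proof. by move=> /cderiv_cvg H; apply: (cvg_lim _ H); exact: norm_hausdorff. Qed.

Lemma cderiv_derivable f z d : cderiv f z d -> derivable (f : R[i]^o -> R[i]^o) z 1.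
Proof.
move=> /cderiv_cvg H; apply/cvg_ex; exists d.
by under eq_fun do rewrite /= [_ *: 1]mulr1.
Qed.

Lemma analytic_cderiv f z : analytic_on_disc f -> unit_disc z ->
  cderiv f z (complex_derive f z).
Proof.
move=> H /H /cvg_ex[d hd]; suff h : cderiv f z d by rewrite (cderiv_derive h).
apply/cderiv_cvg; move: hd; under eq_fun do rewrite /= [_ *: 1]mulr1.
by [].
Qed.

Lemma cderiv_analytic f df : (forall z, unit_disc z -> cderiv f z (df z)) ->
  analytic_on_disc f.
Proof. by move=> H z /H /cderiv_derivable. Qed.

Lemma eq_cderiv f g z d del : 0 < del ->
  (forall h, modulus h < del -> f (z + h) = g (z + h)) -> cderiv f z d -> cderiv g z d.
Proof.
move=> d0 fg H e /H[d1 d10 hd]; exists (Num.min del d1).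
  by rewrite lt_min d0.
move=> h; rewrite lt_min => /andP[h1 h2].
have := fg 0; rewrite modulus0 addr0 => <-//.
by rewrite -fg// hd.
Qed.

Lemma cderiv_cst c z : cderiv (fun=> c) z 0.
Proof.
move=> e e0; exists 1 => // h _.
by rewrite subrr mul0r subr0 modulus0 mulr_ge0 ?modulus_ge0// ltW.
Qed.

Lemma cderiv_id z : cderiv id z 1.
Proof.
move=> e e0; exists 1 => // h _.
rewrite (_ : _ - _ = 0) ?modulus0 ?mulr_ge0 ?modulus_ge0// ?ltW//=; ring.
Qed.

Lemma cderivD f g z d1 d2 : cderiv f z d1 -> cderiv g z d2 ->
  cderiv (fun w => f w + g w) z (d1 + d2).
Proof.
move=> F G e e0; have e2 : 0 < e / 2 by rewrite divr_gt0.
have [a a0 ha] := F _ e2; have [b b0 hb] := G _ e2.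
exists (Num.min a b); first by rewrite lt_min a0.
move=> h; rewrite lt_min => /andP[h1 h2].
have -> : f (z + h) + g (z + h) - (f z + g z) - (d1 + d2) * h =
  (f (z + h) - f z - d1 * h) + (g (z + h) - g z - d2 * h) by ring.
rewrite (le_trans (ler_modulusD _ _))//.
by rewrite [e]splitr mulrDl lerD ?ha ?hb.
Qed.

Definition ccont f z := forall e : R, 0 < e -> exists2 del : R, 0 < del &
  forall h, modulus h < del -> modulus (f (z + h) - f z) < e.

Lemma cderiv_continuous f z d e : cderiv f z d -> 0 < e -> exists2 del : R, 0 < del &
  forall h, modulus h < del -> modulus (f (z + h) - f z) < e.
Proof.
move=> F e0; have [a a0 ha] := F _ ltr01.
have K0 : 0 < modulus d + 2 by rewrite ltr_wpDl ?modulus_ge0.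
exists (Num.min a (e / (modulus d + 2))); first by rewrite lt_min a0 divr_gt0.
move=> h; rewrite lt_min => /andP[h1 h2].
rewrite -[f (z + h) - f z](subrK (d * h)).
rewrite (le_lt_trans (ler_modulusD _ _))//.
rewrite (le_lt_trans (lerD (ha _ h1) (lexx _)))// modulusM -mulrDl.
move: h2; rewrite ltr_pdivlMr// mulrC; apply: le_lt_trans.
by rewrite ler_wpM2r ?modulus_ge0//; lra.
Qed.

Lemma cderiv_ccont f z : (exists d, cderiv f z d) -> ccont f z.
Proof. by move=> [d hd] e e0; exact: cderiv_continuous hd e0. Qed.

Lemma cderivM f g z d1 d2 : cderiv f z d1 -> cderiv g z d2 ->
  cderiv (fun w => f w * g w) z (d1 * g z + f z * d2).
Proof.
move=> F G e e0.
pose K := modulus (f z) + modulus (g z) + modulus d1 + 2.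
have Kf := modulus_ge0 (f z); have Kg := modulus_ge0 (g z).
have Kd := modulus_ge0 d1.
have K0 : 0 < K by rewrite /K; lra.
have eK : 0 < e / (3 * K) by rewrite divr_gt0// mulr_gt0.
have [a a0 ha] := F _ eK; have [b b0 hb] := G _ eK.
have [c c0 hc] := cderiv_continuous G eK.
have [c' c'0 hc'] := cderiv_continuous G ltr01.
exists (Num.min (Num.min a b) (Num.min c c')); first by rewrite !lt_min a0 b0 c0.
move=> h; rewrite !lt_min => /andP[/andP[h1 h2]/andP[h3 h4]].
have -> : f (z + h) * g (z + h) - f z * g z - (d1 * g z + f z * d2) * h =
  (f (z + h) - f z - d1 * h) * g (z + h) + d1 * h * (g (z + h) - g z) +
  f z * (g (z + h) - g z - d2 * h) by ring.
have gb : modulus (g (z + h)) <= modulus (g z) + 1.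
  rewrite -lerBlDl (le_trans (ler_modulus_sub _ _))//.
  by rewrite ltW// hc'.
rewrite (le_trans (ler_modulusD _ _))// (le_trans (lerD (ler_modulusD _ _) (lexx _)))//.
rewrite !modulusM.
have := ha _ h1; have := hb _ h2; have := ltW (hc _ h3).
move: (modulus _) (modulus (f _ - _ - _)) (modulus (g _ - _ - _)) (modulus_ge0 (g (z + h) - g z)) gb (modulus_ge0 (f (z + h) - f z - d1 * h)) (modulus_ge0 (g (z + h) - g z - d2 * h)) => u v w u0 gb v0 w0 hu hw hv.
set m := modulus h in hw hv *; have m0 : 0 <= m by exact: modulus_ge0.
set q := e / (3 * K) in hu hw hv.
have qE : 3 * (q * K) = e by rewrite /q; field; rewrite gt_eqF.
have -> : e * m = q * m * K + K * m * q + K * (q * m) by rewrite -qE; ring.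
rewrite lerD ?lerD// ler_pM ?mulr_ge0 ?modulus_ge0//.
- by rewrite /K; lra.
- by rewrite ler_wpM2r// /K; lra.
- by rewrite /K; lra.
Qed.

Lemma cderivN f z d : cderiv f z d -> cderiv (fun w => - f w) z (- d).
Proof.
move=> F; have := cderivM (cderiv_cst (-1) z) F; rewrite mul0r add0r mulN1r.
by apply: (eq_cderiv ltr01) => h _; rewrite mulN1r.
Qed.

Lemma cderivB f g z d1 d2 : cderiv f z d1 -> cderiv g z d2 ->
  cderiv (fun w => f w - g w) z (d1 - d2).
Proof. by move=> F /cderivN; exact: cderivD. Qed.

Lemma cderivX f z d n : cderiv f z d ->
  cderiv (fun w => f w ^+ n) z (n%:R * f z ^+ n.-1 * d).
Proof.
move=> F; elim: n => [|n IH].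
  rewrite !mul0r; apply: (eq_cderiv ltr01) (cderiv_cst 1 z) => h _.
  by rewrite expr0.
have := cderivM F IH.
rewrite (_ : _ + _ = n.+1%:R * f z ^+ n * d); last first.
  by case: n {IH} => [|n]; rewrite ?expr0 /= ?exprS -?[n.+2%:R]natr1; ring.
by apply: (eq_cderiv ltr01) => h _; rewrite exprS.
Qed.

Lemma cderivV f z d : f z != 0 -> cderiv f z d ->
  cderiv (fun w => (f w)^-1) z (- d / f z ^+ 2).
Proof.
move=> fz F e e0.
have a0 : 0 < modulus (f z) by rewrite modulus_gt0.
set a := modulus (f z) in a0.
have Kd := modulus_ge0 d.
(* Chosen so that [(a + |d|) q = e a^3 / 4], which is below [e] times the lower bound [a^3 / 2] of
   the denominator [|f (z + h) f z ^ 2|]. *)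
pose q := e * a ^+ 3 / (4 * (a + modulus d)).
have q0 : 0 < q by rewrite divr_gt0 ?mulr_gt0 ?exprn_gt0//; lra.
have [b b0 hb] := F _ q0.
have [c c0 hc] := cderiv_continuous F q0.
have a2 : 0 < a / 2 by lra.
have [c' c'0 hc'] := cderiv_continuous F a2.
exists (Num.min b (Num.min c c')); first by rewrite !lt_min b0 c0.
move=> h; rewrite !lt_min => /andP[h1 /andP[h3 h4]].
have fb : a / 2 <= modulus (f (z + h)).
  have := hc' _ h4; have := ler_modulus_sub (f z) (f (z + h)).
  by rewrite modulusB -/a; lra.
have fn0 : f (z + h) != 0 by rewrite -modulus_gt0; lra.
have -> : (f (z + h))^-1 - (f z)^-1 - - d / f z ^+ 2 * h =
  (- (f z * (f (z + h) - f z - d * h)) + d * h * (f (z + h) - f z))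
   / (f (z + h) * f z ^+ 2).
  by field; rewrite fz fn0.
rewrite modulusM modulusV [in X in _ / X]modulusM modulusX -/a.
rewrite ler_pdivrMr; last by rewrite mulr_gt0 ?exprn_gt0 //; lra.
rewrite (le_trans (ler_modulusD _ _))// modulusN !modulusM -/a.
have := hb _ h1; have := ltW (hc _ h3).
set m := modulus h; have m0 : 0 <= m by exact: modulus_ge0.
move=> u1 u2; apply: (@le_trans _ _ (a * (q * m) + modulus d * m * q)).
  by rewrite lerD// ler_wpM2l ?mulr_ge0// ltW.
have -> : a * (q * m) + modulus d * m * q = e * m * (a / 4 * a ^+ 2).
  by rewrite /q; field; rewrite gt_eqF//; lra.
rewrite ler_wpM2l ?mulr_ge0 ?(ltW e0)// ler_wpM2r ?exprn_ge0 ?(ltW a0)//; lra.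
Qed.

Lemma cderiv_shift f w z d : cderiv f (w + z) d -> cderiv (fun u => f (w + u)) z d.
Proof. by move=> F e /F[a a0 ha]; exists a => // h /ha; rewrite addrA. Qed.

End complex_derivative.

(** * Contour integrals *)

Section complex_integral.
Variable R : realType.
Implicit Types (f g : R -> R[i]) (a b c t : R).
Local Notation mu := (@lebesgue_measure R).

(** Continuity relative to [[a, b]], so that paths need no extension past their endpoints. *)
Definition cts_on a b f := forall t, a <= t <= b -> forall e : R, 0 < e ->
  exists2 del : R, 0 < del &
    forall s, a <= s <= b -> `|s - t| < del -> modulus (f s - f t) < e.

Definition cint a b f : R[i] :=
  (\int[mu]_(t in `[a, b]) complex.Re (f t)) +i*
  (\int[mu]_(t in `[a, b]) complex.Im (f t)).

Lemma segment_integralE (f : R[i] -> R[i]) (z : R[i]) :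
  segment_integral f z = cint 0 1 (fun t => f (t%:C * z) * z).
Proof. by []. Qed.

Lemma cts_on_within a b f (p : R[i] -> R) :
  (forall z w, `|p z - p w| <= modulus (z - w)) ->
  cts_on a b f -> {within `[a, b], continuous (p \o f)}.
Proof.
move=> hp F; apply/subspace_continuousP => t; rewrite /= in_itv/= => tab.
apply/cvgrPdist_lt => e e0; have [del del0 H] := F t tab e e0.
rewrite near_withinE; apply/nbhs_ballP; exists del => // s /= st.
rewrite in_itv/= => sab; rewrite distrC (le_lt_trans (hp _ _))// H//.
by rewrite distrC.
Qed.

Lemma Re_lip (z w : R[i]) : `|complex.Re z - complex.Re w| <= modulus (z - w).
Proof. by rewrite -creN -creD normr_Re_le. Qed.

Lemma Im_lip (z w : R[i]) : `|complex.Im z - complex.Im w| <= modulus (z - w).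
Proof. by rewrite -cimN -cimD normr_Im_le. Qed.

Lemma modulus_lip (z w : R[i]) : `|modulus z - modulus w| <= modulus (z - w).
Proof.
by rewrite ler_norml ler_modulus_sub andbT lerNl opprB modulusB ler_modulus_sub.
Qed.

Lemma cts_on_integrable a b f (p : R[i] -> R) :
  (forall z w, `|p z - p w| <= modulus (z - w)) ->
  cts_on a b f -> mu.-integrable `[a, b] (EFin \o (p \o f)).
Proof.
move=> hp F; apply: continuous_compact_integrable; first exact: segment_compact.
exact: cts_on_within.
Qed.

Definition cts_integrable_Re a b f := @cts_on_integrable a b f _ (@Re_lip).
Definition cts_integrable_Im a b f := @cts_on_integrable a b f _ (@Im_lip).
Definition cts_integrable_modulus a b f := @cts_on_integrable a b f _ modulus_lip.

Lemma cts_cst a b (w : R[i]) : cts_on a b (fun=> w).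
Proof. by move=> t _ e e0; exists 1 => // s _ _; rewrite subrr modulus0. Qed.

Lemma cts_onD a b f g : cts_on a b f -> cts_on a b g ->
  cts_on a b (fun t => f t + g t).
Proof.
move=> F G t tab e e0; have e2 : 0 < e / 2 by rewrite divr_gt0.
have [d d0 hd] := F t tab _ e2; have [d' d'0 hd'] := G t tab _ e2.
exists (Num.min d d'); first by rewrite lt_min d0.
move=> s sab; rewrite lt_min => /andP[h1 h2].
rewrite opprD addrACA (le_lt_trans (ler_modulusD _ _))//.
by rewrite [e]splitr ltrD ?hd ?hd'.
Qed.

Lemma cts_onZ a b w f : cts_on a b f -> cts_on a b (fun t => w * f t).
Proof.
move=> F t tab e e0.
have K0 : 0 < modulus w + 1 by rewrite ltr_wpDl ?modulus_ge0.
have [d d0 hd] := F t tab (e / (modulus w + 1)) (divr_gt0 e0 K0).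
exists d => // s sab /(hd _ sab); rewrite ltr_pdivlMr// mulrC => h.
rewrite -mulrBr modulusM (le_lt_trans _ h)// ler_wpM2r ?modulus_ge0//.
by rewrite lerDl.
Qed.

Lemma cts_onB a b f g : cts_on a b f -> cts_on a b g ->
  cts_on a b (fun t => f t - g t).
Proof.
move=> F /(cts_onZ (-1)) G; have := cts_onD F G.
by under eq_fun do rewrite mulN1r.
Qed.

Lemma cts_sub a b c d f : a <= c -> d <= b -> cts_on a b f -> cts_on c d f.
Proof.
move=> ac db F t /andP[ct td] e e0.
have [|del del0 H] := F t _ e e0; first by rewrite (le_trans ac)// (le_trans td).
exists del => // s /andP[cs sd] st; apply: H => //.
by rewrite (le_trans ac)// (le_trans sd).
Qed.

Lemma eq_cint a b f g : (forall t, a <= t <= b -> f t = g t) ->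
  cint a b f = cint a b g.
Proof.
move=> fg; congr (_ +i* _); apply: eq_Rintegral => t; rewrite inE/= in_itv/=.
  by move=> /fg ->.
by move=> /fg ->.
Qed.

Lemma cintD a b f g : cts_on a b f -> cts_on a b g ->
  cint a b (fun t => f t + g t) = cint a b f + cint a b g.
Proof.
move=> F G; apply: complex_ext; rewrite ?creD ?cimD /cint/=.
  under eq_Rintegral do rewrite creD.
  by rewrite RintegralD//; exact: cts_integrable_Re.
under eq_Rintegral do rewrite cimD.
by rewrite RintegralD//; exact: cts_integrable_Im.
Qed.

Lemma cintZ a b w f : cts_on a b f ->
  cint a b (fun t => w * f t) = w * cint a b f.
Proof.
move=> F; have FR := cts_integrable_Re F; have FI := cts_integrable_Im F.
have H (u v : R) : mu.-integrable `[a, b]%classic (EFin \o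
    (fun t => u * complex.Re (f t))) /\
    mu.-integrable `[a, b]%classic (EFin \o (fun t => v * complex.Im (f t))).
  split.
    by have := @integrableZl _ _ _ mu _ (measurable_itv _) u _ FR.
  by have := @integrableZl _ _ _ mu _ (measurable_itv _) v _ FI.
apply: complex_ext; rewrite ?creM ?cimM /cint/=.
  under eq_Rintegral do rewrite creM.
  by rewrite RintegralB ?RintegralZl//; [apply: (H _ 0).1|apply: (H 0 _).2].
under eq_Rintegral do rewrite cimM.
by rewrite RintegralD ?RintegralZl//; [apply: (H 0 _).2|apply: (H _ 0).1].
Qed.

Lemma cintB a b f g : cts_on a b f -> cts_on a b g ->
  cint a b (fun t => f t - g t) = cint a b f - cint a b g.
Proof.
move=> F G; rewrite -[- cint _ _ g]mulN1r -cintZ// -cintD//; last exact: cts_onZ.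
by apply: eq_cint => t _; rewrite mulN1r.
Qed.

Lemma Rintegral_itv_cst a b (B : R) : a <= b ->
  \int[mu]_(t in `[a, b]) B = B * (b - a).
Proof.
move=> ab; rewrite Rintegral_cst//; congr (_ * _).
transitivity (fine (b - a)%:E) => //; congr fine.
rewrite [LHS]lebesgue_measure_itv/= lte_fin.
case: ltP => // h; have -> : a = b by apply/eqP; rewrite eq_le ab.
by rewrite subrr.
Qed.

Lemma cint_cst a b w : a <= b -> cint a b (fun=> w) = (b - a)%:C * w.
Proof.
move=> ab; rewrite /cint !Rintegral_itv_cst//.
by case: w => u v; apply: complex_ext; rewrite ?creM ?cimM/=; ring.
Qed.

Lemma Rintegral_split a b c (f : R -> R) : a <= c <= b ->
  mu.-integrable `[a, b] (EFin \o f) ->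
  \int[mu]_(t in `[a, b]) f t = \int[mu]_(t in `[a, c]) f t + \int[mu]_(t in `[c, b]) f t.
Proof.
move=> /andP[ac cb] F.
have := @Rintegral_itvB R f (BLeft a) (BRight b) c F.
rewrite !bnd_simp => /(_ ac cb) /eqP; rewrite subr_eq => /eqP ->.
rewrite addrC; congr (_ + _); rewrite Rintegral_itv_obnd_cbnd//.
by apply: integrableS F => //; apply: subset_itv; rewrite bnd_simp.
Qed.

Lemma cint_split a b c f : a <= c <= b -> cts_on a b f ->
  cint a b f = cint a c f + cint c b f.
Proof.
move=> acb F; apply: complex_ext; rewrite ?creD ?cimD /cint/=.
  by rewrite -Rintegral_split//; exact: cts_integrable_Re.
by rewrite -Rintegral_split//; exact: cts_integrable_Im.
Qed.

(** The real and imaginary parts are estimated separately, whence the factor 2, which only affects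
    constants. *)
Lemma modulus_cint_le a b f : cts_on a b f ->
  modulus (cint a b f) <= 2 * \int[mu]_(t in `[a, b]) modulus (f t).
Proof.
move=> F; rewrite (le_trans (modulus_le_ReIm _))// mulr2n mulrDl mul1r lerD//=.
  rewrite (le_trans (le_normr_Rintegral _ (cts_integrable_Re F)))//.
  apply: le_Rintegral => //; last by move=> t _; exact: normr_Re_le.
    by apply: (@integrable_abse _ _ _ mu) (cts_integrable_Re F).
  exact: cts_integrable_modulus.
rewrite (le_trans (le_normr_Rintegral _ (cts_integrable_Im F)))//.
apply: le_Rintegral => //; last by move=> t _; exact: normr_Im_le.
  by apply: (@integrable_abse _ _ _ mu) (cts_integrable_Im F).
exact: cts_integrable_modulus.
Qed.

Lemma modulus_cint_bound a b f B : a <= b -> cts_on a b f ->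
  (forall t, a <= t <= b -> modulus (f t) <= B) ->
  modulus (cint a b f) <= 2 * B * (b - a).
Proof.
move=> ab F FB; rewrite (le_trans (modulus_cint_le F))// -mulrA ler_pM2l//.
apply: (@le_trans _ _ (\int[mu]_(t in `[a, b]) B)).
  apply: le_Rintegral => //; first exact: cts_integrable_modulus.
    exact: (cts_integrable_Re (@cts_cst a b B%:C)).
by rewrite Rintegral_itv_cst.
Qed.

Lemma cts_on_comp a b (f : R[i] -> R[i]) (z w : R[i]) :
  (forall t, a <= t <= b -> ccont f (z + t%:C * w)) ->
  cts_on a b (fun t => f (z + t%:C * w)).
Proof.
move=> F t /F hd e e0; have [del del0 H] := hd e e0.
have K0 : 0 < modulus w + 1 by rewrite ltr_wpDl ?modulus_ge0.
exists (del / (modulus w + 1)); first exact: divr_gt0.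
move=> s _; rewrite ltr_pdivlMr// => h.
rewrite (_ : z + s%:C * w = z + t%:C * w + (s - t)%:C * w); last first.
  by rewrite rmorphB/=; ring.
apply: H; rewrite modulusM modulus_real (le_lt_trans _ h)//.
by rewrite ler_wpM2l// lerDl.
Qed.

End complex_integral.

(** * Goursat's theorem for rectangles *)

Section goursat.
Variable R : realType.
Implicit Types (f g : R[i] -> R[i]) (x y w h e : R) (z d : R[i]).

Definition hseg f y a b := cint a b (fun t => f (t +i* y)).
Definition vseg f x a b := cint a b (fun t => f (x +i* t)).

(** The counterclockwise contour integral: bottom minus top, plus [i] times right minus left, since
    [dz = i dt] on vertical sides. *)
Definition bdint f x0 x1 y0 y1 : R[i] :=
  hseg f y0 x0 x1 - hseg f y1 x0 x1 + 'i * (vseg f x1 y0 y1 - vseg f x0 y0 y1).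

Definition side_cts f x0 x1 y0 y1 :=
  [/\ cts_on x0 x1 (fun t => f (t +i* y0)), cts_on x0 x1 (fun t => f (t +i* y1)),
      cts_on y0 y1 (fun t => f (x0 +i* t)) & cts_on y0 y1 (fun t => f (x1 +i* t))].

Lemma cts_hseg f y a b :
  (forall t, a <= t <= b -> ccont f (t +i* y)) ->
  cts_on a b (fun t => f (t +i* y)).
Proof.
move=> F; have E t : t +i* y = 0 +i* y + t%:C * 1.
  by apply: complex_ext; rewrite ?(creD,cimD)/=; ring.
under eq_fun do rewrite E.
by apply: cts_on_comp => t /F; rewrite E.
Qed.

Lemma cts_vseg f x a b :
  (forall t, a <= t <= b -> ccont f (x +i* t)) ->
  cts_on a b (fun t => f (x +i* t)).
Proof.
move=> F; have E t : x +i* t = x%:C + t%:C * 'i.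
  by apply: complex_ext; rewrite ?(creD,cimD)/=; ring.
under eq_fun do rewrite E.
by apply: cts_on_comp => t /F; rewrite E.
Qed.

Lemma ccont_side_cts f x0 x1 y0 y1 : x0 <= x1 -> y0 <= y1 ->
  (forall x y, x0 <= x <= x1 -> y0 <= y <= y1 ->
    [|| x == x0, x == x1, y == y0 | y == y1] -> ccont f (x +i* y)) ->
  side_cts f x0 x1 y0 y1.
Proof.
move=> x01 y01 F; split.
- by apply: cts_hseg => t tt; apply: F; rewrite ?eqxx ?orbT// lexx.
- by apply: cts_hseg => t tt; apply: F; rewrite ?eqxx ?orbT// lexx andbT.
- by apply: cts_vseg => t tt; apply: F; rewrite ?eqxx ?orbT// lexx.
- by apply: cts_vseg => t tt; apply: F; rewrite ?eqxx ?orbT// lexx andbT.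
Qed.

Lemma hol_side_cts f x0 x1 y0 y1 : x0 <= x1 -> y0 <= y1 ->
  (forall x y, x0 <= x <= x1 -> y0 <= y <= y1 -> exists d, cderiv f (x +i* y) d) ->
  side_cts f x0 x1 y0 y1.
Proof.
by move=> x01 y01 F; apply: ccont_side_cts => // x y hx hy _; exact/cderiv_ccont/F.
Qed.

Lemma bdint_splitx f x0 c x1 y0 y1 : x0 <= c <= x1 ->
  cts_on x0 x1 (fun t => f (t +i* y0)) -> cts_on x0 x1 (fun t => f (t +i* y1)) ->
  bdint f x0 x1 y0 y1 = bdint f x0 c y0 y1 + bdint f c x1 y0 y1.
Proof.
move=> xc F0 F1; rewrite /bdint /hseg (cint_split xc F0) (cint_split xc F1).
by ring.
Qed.

Lemma bdint_splity f x0 x1 y0 c y1 : y0 <= c <= y1 ->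
  cts_on y0 y1 (fun t => f (x0 +i* t)) -> cts_on y0 y1 (fun t => f (x1 +i* t)) ->
  bdint f x0 x1 y0 y1 = bdint f x0 x1 y0 c + bdint f x0 x1 c y1.
Proof.
move=> yc F0 F1; rewrite /bdint /vseg (cint_split yc F0) (cint_split yc F1).
by ring.
Qed.

Lemma bdint_bound f x0 x1 y0 y1 B : x0 <= x1 -> y0 <= y1 ->
  side_cts f x0 x1 y0 y1 ->
  (forall t, x0 <= t <= x1 -> modulus (f (t +i* y0)) <= B /\ modulus (f (t +i* y1)) <= B) ->
  (forall t, y0 <= t <= y1 -> modulus (f (x0 +i* t)) <= B /\ modulus (f (x1 +i* t)) <= B) ->
  modulus (bdint f x0 x1 y0 y1) <= 4 * B * ((x1 - x0) + (y1 - y0)).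
Proof.
move=> x01 y01 [c1 c2 c3 c4] hB vB.
rewrite (le_trans (ler_modulusD _ _))// modulusM modulusi mul1r.
rewrite (le_trans (lerD (ler_modulusB _ _) (ler_modulusB _ _)))//.
have h1 := modulus_cint_bound x01 c1 (fun t ht => (hB t ht).1).
have h2 := modulus_cint_bound x01 c2 (fun t ht => (hB t ht).2).
have h3 := modulus_cint_bound y01 c3 (fun t ht => (vB t ht).1).
have h4 := modulus_cint_bound y01 c4 (fun t ht => (vB t ht).2).
rewrite /hseg /vseg; lra.
Qed.

Lemma bdintB f g x0 x1 y0 y1 : side_cts f x0 x1 y0 y1 -> side_cts g x0 x1 y0 y1 ->
  bdint (fun z => f z - g z) x0 x1 y0 y1 = bdint f x0 x1 y0 y1 - bdint g x0 x1 y0 y1.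
Proof.
move=> [a1 a2 a3 a4] [b1 b2 b3 b4].
by rewrite /bdint /hseg /vseg !cintB//; ring.
Qed.

Lemma bdintZ f z x0 x1 y0 y1 : side_cts f x0 x1 y0 y1 ->
  bdint (fun u => z * f u) x0 x1 y0 y1 = z * bdint f x0 x1 y0 y1.
Proof.
move=> [a1 a2 a3 a4].
by rewrite /bdint /hseg /vseg !cintZ//; ring.
Qed.

Lemma bdint_affine a d x0 x1 y0 y1 : x0 <= x1 -> y0 <= y1 ->
  bdint (fun z => a + d * z) x0 x1 y0 y1 = 0.
Proof.
move=> x01 y01.
have C z : cderiv (fun z => a + d * z) z (0 + (0 * z + d * 1)).
  by apply: cderivD; [exact: cderiv_cst|apply: cderivM (cderiv_cst _ _) (cderiv_id _)].
have [c1 c2 c3 c4] : side_cts (fun z => a + d * z) x0 x1 y0 y1.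
  by apply: hol_side_cts => // x y _ _; eexists; exact: C.
rewrite /bdint /hseg /vseg -!cintB//.
rewrite (@eq_cint _ x0 x1 _ (fun=> d * 'i * (y0 - y1)%:C)); last first.
  by move=> t _; apply: complex_ext; case: (a) (d) => [? ?] [? ?]; rewrite ?(creM,creD,creN,cimD,cimN,cimM)/=; ring.
rewrite (@eq_cint _ y0 y1 _ (fun=> d * (x1 - x0)%:C)); last first.
  by move=> t _; apply: complex_ext; case: (a) (d) => [? ?] [? ?]; rewrite ?(creM,creD,creN,cimD,cimN,cimM)/=; ring.
rewrite !cint_cst// !rmorphB/=; ring.
Qed.

(** [u n] is the left end of the [n]-th of a sequence of nested intervals of length [w / 2 ^ n]; the
    supremum of the left ends lies in all of them. *)
Lemma nested_intervals (u : nat -> R) w : 0 <= w ->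
  (forall n, u n <= u n.+1 <= u n + w / 2 ^+ n.+1) ->
  exists p, forall n, u n <= p <= u n + w / 2 ^+ n.
Proof.
move=> w0 hu.
have mono m n : (m <= n)%N -> u m <= u n.
  by move=> mn; apply: (homo_leq (@lexx _ _) (@le_trans _ _)) mn => k; case/andP: (hu k).
have H m k : u (m + k)%N + w / 2 ^+ (m + k) <= u m + w / 2 ^+ m.
  elim: k => [|k IH]; first by rewrite addn0.
  apply: le_trans IH; rewrite addnS; case/andP: (hu (m + k)%N) => _ h.
  rewrite [in leRHS](_ : w / 2 ^+ (m + k) = w / 2 ^+ (m + k).+1 + w / 2 ^+ (m + k).+1) ?addrA ?lerD2r//.
  by rewrite exprS; field; rewrite expf_neq0.
have pos n : 0 <= w / 2 ^+ n by rewrite divr_ge0// exprn_ge0.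
have H' m n : u n <= u m + w / 2 ^+ m.
  case: (leqP m n) => mn.
    by rewrite -(subnKC mn); have := H m (n - m)%N; have := pos (m + (n - m))%N; lra.
  by have := mono _ _ (ltnW mn); have := pos m; lra.
exists (sup (range u)) => n; apply/andP; split.
  apply: ub_le_sup; last by exists n.
  by exists (u 0%N + w / 2 ^+ 0) => _ [k _ <-]; exact: H'.
by apply: ge_sup; [exists (u 0%N); exists 0%N|move=> _ [k _ <-]; exact: H'].
Qed.

(** If the integral exceeds [e (w + h)^2], then one of the four quarters violates the same
    inequality at half scale, because the right side is exactly four times its value for a quarter.
    The bad rectangles shrink to a point, where differentiability gives the opposite inequality. *)
Lemma goursat f x y w h : 0 <= w -> 0 <= h ->
  (forall s t, x <= s <= x + w -> y <= t <= y + h -> exists d, cderiv f (s +i* t) d) ->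
  bdint f x (x + w) y (y + h) = 0.
Proof.
move=> w0 h0 F.
suff H e : 0 < e -> modulus (bdint f x (x + w) y (y + h)) <= e * (w + h) ^+ 2.
  apply: modulus_eq0; apply/eqP; rewrite eq_le modulus_ge0 andbT.
  apply/ler_addgt0Pl => e e0; rewrite addr0.
  have k0 : 0 < (w + h) ^+ 2 + 1 by rewrite ltr_wpDl ?sqr_ge0.
  rewrite (le_trans (H (e / ((w + h) ^+ 2 + 1)) _)) ?divr_gt0//.
  by rewrite mulrAC ler_pdivrMr// ler_pM2l// lerDl.
move=> e0; rewrite leNgt; apply/negP => H0.
pose W n := w / 2 ^+ n; pose Hh n := h / 2 ^+ n.
pose bad n (p : R * R) := e * (W n + Hh n) ^+ 2 <
  modulus (bdint f p.1 (p.1 + W n) p.2 (p.2 + Hh n)).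
have W0 n : 0 <= W n by rewrite divr_ge0// exprn_ge0.
have Hh0 n : 0 <= Hh n by rewrite divr_ge0// exprn_ge0.
have WS n : W n = W n.+1 + W n.+1 by rewrite /W exprS; field; rewrite expf_neq0.
have HS n : Hh n = Hh n.+1 + Hh n.+1 by rewrite /Hh exprS; field; rewrite expf_neq0.
pose inside n (p : R * R) := [/\ x <= p.1, p.1 + W n <= x + w, y <= p.2 & p.2 + Hh n <= y + h].
have step n p : inside n p -> bad n p -> exists q : R * R,
   [/\ p.1 <= q.1 <= p.1 + W n.+1, p.2 <= q.2 <= p.2 + Hh n.+1, inside n.+1 q & bad n.+1 q].
  move=> [i1 i2 i3 i4] bp; apply: contrapT => N.
  case: p i1 i2 i3 i4 bp N => px py /= i1 i2 i3 i4 bp N.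
  have w1 := W0 n.+1; have h1 := Hh0 n.+1; have wS := WS n; have hS := HS n.
  have G qx qy : px <= qx <= px + W n.+1 -> py <= qy <= py + Hh n.+1 ->
     modulus (bdint f qx (qx + W n.+1) qy (qy + Hh n.+1)) <= e * (W n.+1 + Hh n.+1) ^+ 2.
    move=> hx hy; rewrite leNgt; apply/negP => hb; apply: N.
    exists (qx, qy); split => //=.
    by split => /=; lra.
  have [s1 s2 s3 s4] : side_cts f px (px + W n) py (py + Hh n).
    by apply: hol_side_cts; [lra|lra|move=> ? ? ? ?; apply: F; lra].
  have m1 : cts_on (px) (px + W n) (fun t => f (t +i* (py + Hh n.+1))).
    by apply: cts_hseg => t ht; apply/cderiv_ccont/F; lra.
  have {}bp : e * (W n + Hh n) ^+ 2 < modulus (bdint f px (px + W n) py (py + Hh n)) by [].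
  move: bp; rewrite ltNge => /negP; apply.
  have wS' : px + W n = px + W n.+1 + W n.+1 by lra.
  have hS' : py + Hh n = py + Hh n.+1 + Hh n.+1 by lra.
  have -> : e * (W n + Hh n) ^+ 2 = e * (W n.+1 + Hh n.+1) ^+ 2 + e * (W n.+1 + Hh n.+1) ^+ 2
     + (e * (W n.+1 + Hh n.+1) ^+ 2 + e * (W n.+1 + Hh n.+1) ^+ 2) by rewrite wS hS; ring.
  have g1 := G px py; have g2 := G (px + W n.+1) py.
  have g3 := G px (py + Hh n.+1); have g4 := G (px + W n.+1) (py + Hh n.+1).
  rewrite (@bdint_splity _ _ _ _ (py + Hh n.+1)); [|lra|exact: s3|exact: s4].
  rewrite (@bdint_splitx _ px (px + W n.+1) (px + W n) py); [|lra|exact: s1|exact: m1].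
  rewrite (@bdint_splitx _ px (px + W n.+1) (px + W n) (py + Hh n.+1)); [|lra|exact: m1|exact: s2].
  rewrite wS' hS'.
  apply: le_trans (ler_modulusD _ _) _.
  apply: le_trans (lerD (ler_modulusD _ _) (ler_modulusD _ _)) _.
  by apply: lerD; apply: lerD; [apply: g1|apply: g2|apply: g3|apply: g4]; lra.
pose nP n (p : R * R) := [set q : R * R | [/\ p.1 <= q.1 <= p.1 + W n.+1,
   p.2 <= q.2 <= p.2 + Hh n.+1, inside n.+1 q & bad n.+1 q]].
(* The default [p] of [xget] is never reached: [step] provides a bad quarter of every bad
   rectangle. *)
pose nxt n p := xget p (nP n p).
pose s := fix s n := if n is m.+1 then nxt m (s m) else (x, y).
have W00 : W 0%N = w by rewrite /W expr0 divr1.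
have H00 : Hh 0%N = h by rewrite /Hh expr0 divr1.
have sP n : inside n (s n) /\ bad n (s n).
  elim: n => [|n [IH1 IH2]].
    by split; [split; rewrite /= ?W00 ?H00|rewrite /bad/= W00 H00].
  have [q qP] := step n _ IH1 IH2.
  have : exists q, nP n (s n) q by exists q.
  by move=> /(xgetPex (s n)) [? ? ? ?]; split.
have sS n : (s n).1 <= (s n.+1).1 <= (s n).1 + W n.+1 /\
            (s n).2 <= (s n.+1).2 <= (s n).2 + Hh n.+1.
  have [IH1 IH2] := sP n; have [q qP] := step n _ IH1 IH2.
  have : exists q, nP n (s n) q by exists q.
  by move=> /(xgetPex (s n)) [? ? ? ?]; split.
have [px hpx] := @nested_intervals (fun n => (s n).1) w w0 (fun n => (sS n).1).
have [py hpy] := @nested_intervals (fun n => (s n).2) h h0 (fun n => (sS n).2).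
have [d hd] : exists d, cderiv f (px +i* py) d.
  by apply: F; [have := hpx 0%N|have := hpy 0%N]; rewrite expr0 divr1.
(* The quotient by 4 compensates the factor 4 in [bdint_bound]. *)
have e4 : 0 < e / 4 by lra.
have [del del0 hdel] := hd _ e4.
have [n hn] : exists n, W n + Hh n < del.
  have := @near_infty_natSinv_expn_lt R (PosNum (divr_gt0 del0 (ltr_wpDl (addr_ge0 w0 h0) ltr01))).
  move=> [N _ /(_ N (leqnn _))] /= hN; exists N.
  rewrite /W /Hh -mulrDl; have k0 : 0 < w + h + 1 by lra.
  move: hN; rewrite div1r ltr_pdivlMr// => hN; apply: le_lt_trans hN.
  rewrite mulrC ler_wpM2l ?invr_ge0 ?exprn_ge0//; lra.
have [[i1 i2 i3 i4] bn] := sP n.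
move: (hpx n) (hpy n); rewrite -/(W n) -/(Hh n); case: (s n) i1 i2 i3 i4 bn => a b /= i1 i2 i3 i4 bn hax hby.
have w1 := W0 n; have h1 := Hh0 n.
have sf : side_cts f a (a + W n) b (b + Hh n).
  by apply: hol_side_cts; [lra|lra|move=> ? ? ? ?; apply: F; lra].
pose p := px +i* py.
(* The tangent affine map at the limit point. Its contour integral vanishes, which leaves the
   remainder of order [o(|z - p|)]. *)
pose A z := (f p - d * p) + d * z.
have sA : side_cts A a (a + W n) b (b + Hh n).
  apply: hol_side_cts; [lra|lra|move=> ? ? _ _; eexists].
  apply: cderivD; [exact: cderiv_cst|apply: cderivM (cderiv_cst _ _) (cderiv_id _)].
have sfA : side_cts (fun z => f z - A z) a (a + W n) b (b + Hh n).
  by case: sf sA => ? ? ? ? [? ? ? ?]; split; apply: cts_onB.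
have Bd s' t' : a <= s' <= a + W n -> b <= t' <= b + Hh n ->
   modulus (f (s' +i* t') - A (s' +i* t')) <= e / 4 * (W n + Hh n).
  move=> hs ht; pose k := (s' - px) +i* (t' - py).
  have kE : s' +i* t' = p + k by apply: complex_ext; rewrite ?(creD,cimD)/=; ring.
  have kb : modulus k <= W n + Hh n.
    rewrite (le_trans (modulus_le_ReIm _))//= lerD// ler_norml; lra.
  have -> : f (s' +i* t') - A (s' +i* t') = f (p + k) - f p - d * k.
    by rewrite /A kE; ring.
  by rewrite (le_trans (hdel _ _)) ?ler_wpM2l ?(ltW e4)// (le_lt_trans kb).
have aW : a <= a + W n by lra.
have bH : b <= b + Hh n by lra.
have B1 : modulus (bdint f a (a + W n) b (b + Hh n)) <=
    4 * (e / 4 * (W n + Hh n)) * (a + W n - a + (b + Hh n - b)).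
  have <- : bdint (fun z => f z - A z) a (a + W n) b (b + Hh n) =
      bdint f a (a + W n) b (b + Hh n).
    by rewrite bdintB// bdint_affine// subr0.
  by apply: bdint_bound aW bH sfA _ _ => t ht; split; apply: Bd => //; lra.
have B2 : e * (W n + Hh n) ^+ 2 < modulus (bdint f a (a + W n) b (b + Hh n)) by exact: bn.
have B3 : 4 * (e / 4 * (W n + Hh n)) * (a + W n - a + (b + Hh n - b)) =
  e * (W n + Hh n) ^+ 2 by field.
by rewrite B3 leNgt B2 in B1.
Qed.

Lemma goursat_rect f x0 x1 y0 y1 : x0 <= x1 -> y0 <= y1 ->
  (forall s t, x0 <= s <= x1 -> y0 <= t <= y1 -> exists d, cderiv f (s +i* t) d) ->
  bdint f x0 x1 y0 y1 = 0.
Proof.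
move=> x01 y01 F; rewrite -(subrKC x0 x1) -(subrKC y0 y1).
by apply: goursat; rewrite ?subr_ge0// => s t; rewrite !subrKC; exact: F.
Qed.

(** The frame between the two rectangles is cut into four rectangles, on each of which Goursat's
    theorem applies. Inside the hole [f] may be singular. *)
Lemma bdint_hole f x0 x1 x2 x3 y0 y1 y2 y3 :
  x0 <= x1 -> x1 <= x2 -> x2 <= x3 -> y0 <= y1 -> y1 <= y2 -> y2 <= y3 ->
  (forall s t, x0 <= s <= x3 -> y0 <= t <= y3 ->
    [|| s <= x1, x2 <= s, t <= y1 | y2 <= t] -> exists d, cderiv f (s +i* t) d) ->
  bdint f x0 x3 y0 y3 = bdint f x1 x2 y1 y2.
Proof.
move=> x01 x12 x23 y01 y12 y23 F.
have Fh y : y0 <= y <= y3 -> (y <= y1) || (y2 <= y) ->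
    cts_on x0 x3 (fun t => f (t +i* y)).
  by move=> hy Hy; apply: cts_hseg => t ht; apply/cderiv_ccont/F => //; rewrite Hy !orbT.
have Fv x : x0 <= x <= x3 -> (x <= x1) || (x2 <= x) ->
    cts_on y0 y3 (fun t => f (x +i* t)).
  move=> hx Hx; apply: cts_vseg => t ht; apply/cderiv_ccont/F => //.
  by case/orP: Hx => ->; rewrite ?orbT.
rewrite (@bdint_splitx _ _ x1); [|lra|by apply: Fh; lra|by apply: Fh; lra].
rewrite (@bdint_splitx _ x1 x2); [|lra|by apply: cts_sub (Fh y0 _ _); lra|by apply: cts_sub (Fh y3 _ _); lra].
rewrite (@bdint_splity _ x1 x2 _ y1); [|lra|by apply: Fv; lra|by apply: Fv; lra].
rewrite (@bdint_splity _ x1 x2 y1 y2); [|lra|by apply: cts_sub (Fv x1 _ _); lra|by apply: cts_sub (Fv x2 _ _); lra].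
rewrite (@goursat_rect f x0 x1); [|lra|lra|by move=> s t hs ht; apply: F; lra].
rewrite (@goursat_rect f x2 x3); [|lra|lra|by move=> s t hs ht; apply: F; lra].
rewrite (@goursat_rect f x1 x2 y0 y1); [|lra|lra|by move=> s t hs ht; apply: F; lra].
rewrite (@goursat_rect f x1 x2 y2 y3); [|lra|lra|by move=> s t hs ht; apply: F; lra].
by rewrite !add0r !addr0.
Qed.

End goursat.

(** * Cauchy's formulas on squares *)

Section cauchy.
Variable R : realType.
Implicit Types (f g k : R[i] -> R[i]) (x y s t e rho : R) (z w u d : R[i]).

Definition sqint f s := bdint f (- s) s (- s) s.

(** An annulus containing the boundary of the square [[-s, s]^2]; these two bounds on [|w|] are what
    the estimates on that boundary use. *)
Definition on_square s w := [/\ modulus w <= 2 * s, s <= modulus w & 0 < s].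

Lemma square_sides s (P : R[i] -> Prop) : 0 < s -> (forall w, on_square s w -> P w) ->
  (forall t, - s <= t <= s -> P (t +i* (- s)) /\ P (t +i* s)) /\
  (forall t, - s <= t <= s -> P ((- s) +i* t) /\ P (s +i* t)).
Proof.
move=> s0 H; have s1 : `|- s| = s by rewrite normrN gtr0_norm.
have s2 : `|s| = s by rewrite gtr0_norm.
split=> t; rewrite -ler_norml => ts; split; apply: H; split => //.
- by rewrite (le_trans (modulus_le_ReIm _))//= s1; lra.
- by rewrite (le_trans _ (normr_Im_le _))//= s1.
- by rewrite (le_trans (modulus_le_ReIm _))//= s2; lra.
- by rewrite (le_trans _ (normr_Im_le _))//= s2.
- by rewrite (le_trans (modulus_le_ReIm _))//= s1; lra.
- by rewrite (le_trans _ (normr_Re_le _))//= s1.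
- by rewrite (le_trans (modulus_le_ReIm _))//= s2; lra.
- by rewrite (le_trans _ (normr_Re_le _))//= s2.
Qed.

Lemma sq_side_cts f s : 0 < s -> (forall w, on_square s w -> ccont f w) ->
  side_cts f (- s) s (- s) s.
Proof.
move=> s0 F; have ss : - s <= s by lra.
have [h v] := square_sides s0 F.
apply: ccont_side_cts => // x y hx hy /or4P[] /eqP ->.
- exact: (v y hy).1.
- exact: (v y hy).2.
- exact: (h x hx).1.
- exact: (h x hx).2.
Qed.

Lemma sqint_bound f s B : 0 < s -> (forall w, on_square s w -> ccont f w) ->
  (forall w, on_square s w -> modulus (f w) <= B) ->
  modulus (sqint f s) <= 16 * B * s.
Proof.
move=> s0 F FB; have [h v] := square_sides s0 FB.
have ss : - s <= s by lra.
have := bdint_bound ss ss (sq_side_cts s0 F) h v.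
by rewrite /sqint (_ : 4 * B * _ = 16 * B * s)//; ring.
Qed.

Lemma sqintB f g s : 0 < s -> (forall w, on_square s w -> ccont f w) ->
  (forall w, on_square s w -> ccont g w) ->
  sqint (fun w => f w - g w) s = sqint f s - sqint g s.
Proof. by move=> s0 F G; rewrite /sqint bdintB//; apply: sq_side_cts. Qed.

Lemma sqintZ f u s : 0 < s -> (forall w, on_square s w -> ccont f w) ->
  sqint (fun w => u * f w) s = u * sqint f s.
Proof. by move=> s0 F; rewrite /sqint bdintZ//; apply: sq_side_cts. Qed.

Lemma eq_sqint f g s : 0 < s -> (forall w, on_square s w -> f w = g w) ->
  sqint f s = sqint g s.
Proof.
move=> s0 fg; have [h v] := square_sides s0 fg.
rewrite /sqint /bdint /hseg /vseg.
by congr (_ - _ + 'i * (_ - _)); apply: eq_cint => t ht;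
  [case: (h t ht)|case: (h t ht)|case: (v t ht)|case: (v t ht)].
Qed.

Lemma on_square_neq0 s w : on_square s w -> w != 0.
Proof. by move=> [_ h s0]; rewrite -modulus_gt0; lra. Qed.

Lemma modulus_sqle x y s : `|x| <= s -> `|y| <= s -> modulus (x +i* y) <= 2 * s.
Proof. by move=> hx hy; rewrite (le_trans (modulus_le_ReIm _))//=; lra. Qed.

(** By [bdint_hole] the square may be shrunk without changing the integral, and on a small square of
    half-side [s'] the bound [|k w| |w| <= e / 16] makes the integral at most
    [16 (e / 16 / s') s' = e]. *)
Lemma sqint_removable k s : 0 < s ->
  (forall w, modulus w <= 2 * s -> w != 0 -> exists d, cderiv k w d) ->
  (forall e, 0 < e -> exists2 del : R, 0 < del & forall w, w != 0 -> modulus w < del ->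
     modulus (k w) * modulus w <= e) ->
  sqint k s = 0.
Proof.
move=> s0 K small; apply: modulus_eq0; apply/eqP; rewrite eq_le modulus_ge0 andbT.
apply/ler_addgt0Pl => e e0; rewrite addr0.
have e16 : 0 < e / 16 by lra.
have [del del0 hdel] := small _ e16.
(* A third, so that [2 s' < del] and the whole annulus [on_square s'] lies where [k] is
   controlled. *)
pose s' := Num.min s (del / 3).
have s'0 : 0 < s' by rewrite lt_min s0; lra.
have s's : s' <= s by rewrite ge_min lexx.
have s'd : s' <= del / 3 by rewrite ge_min lexx orbT.
have K' x y : - s <= x <= s -> - s <= y <= s ->
  [|| x <= - s', s' <= x, y <= - s' | s' <= y] -> exists d, cderiv k (x +i* y) d.
  move=> hx hy H; apply: K; first by apply: modulus_sqle; rewrite ler_norml.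
  by rewrite eq_complex/= negb_and; apply/orP; case/or4P: H => h; [left|left|right|right];
    apply/eqP; lra.
have -> : sqint k s = sqint k s' by apply: bdint_hole; (lra || exact: K').
have small' w : on_square s' w -> modulus (k w) <= e / 16 / s'.
  move=> sw; have [a b _] := sw; rewrite ler_pdivlMr//.
  have := hdel w (on_square_neq0 sw); move/(_ ltac:(lra)); apply: le_trans.
  by rewrite ler_wpM2l ?modulus_ge0.
have kc w : on_square s' w -> ccont k w.
  move=> sw; apply/cderiv_ccont/K; last exact: on_square_neq0 sw.
  by case: sw => a _ _; lra.
apply: le_trans (sqint_bound s'0 kc small') _.
by rewrite le_eqVlt; apply/orP; left; apply/eqP; field; rewrite gt_eqF.
Qed.

(** The number [2 pi i], kept as an integral; the Cauchy formulas below are multiplied out by it. *)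
Definition sqW s := sqint (fun w => w^-1) s.

Lemma cderiv_inv w : w != 0 -> exists d, cderiv (fun w => w^-1) w d.
Proof. by move=> w0; eexists; apply: cderivV (cderiv_id _). Qed.

Lemma ccont_inv w : w != 0 -> ccont (fun w => w^-1) w.
Proof. by move=> /cderiv_inv; exact: cderiv_ccont. Qed.

(** The values of [1 / w] on opposite sides differ by [i q(t)] or [q(t)] with
    [q(t) = 2 s / (t^2 + s^2)], so the integral is [2 i] times that of [q]. On [[-s, s]] one has
    [q >= 1 / s], so the integral of [q] is at least 2. *)
Lemma sqW_ge4 s : 0 < s -> 4 <= modulus (sqW s).
Proof.
move=> s0; have ss : - s <= s by lra.
have [c1 c2 c3 c4] : side_cts (fun w : R[i] => w^-1) (- s) s (- s) s.
  by apply: sq_side_cts => // w sw; exact: ccont_inv (on_square_neq0 sw).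
pose q t := 2 * s / (t ^+ 2 + s ^+ 2).
have pos t : t ^+ 2 + s ^+ 2 != 0 by rewrite gt_eqF// ltr_wpDl ?sqr_ge0// exprn_gt0.
have nz1 t : (t +i* s) != 0 by rewrite eq_complex/= negb_and (gt_eqF s0) orbT.
have nz1' t : (t +i* (- s)) != 0 by rewrite eq_complex/= negb_and oppr_eq0 (gt_eqF s0) orbT.
have nz2 t : (s +i* t) != 0 by rewrite eq_complex/= negb_and gt_eqF.
have nz2' t : ((- s) +i* t) != 0 by rewrite eq_complex/= negb_and oppr_eq0 gt_eqF.
have i2 : 'i * 'i = -1 :> R[i] by apply: complex_ext; rewrite ?creM ?cimM/=; ring.
have qc t : (q t)%:C = (2 * s)%:C / (t%:C ^+ 2 + s%:C ^+ 2).
  by rewrite /q rmorphM/= fmorphV rmorphD !rmorphXn.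
have posc t : (t%:C ^+ 2 + s%:C ^+ 2 : R[i]) != 0.
  by rewrite -!rmorphXn -rmorphD/= -[0]/(0%:C) (inj_eq (@complexI R)).
have E1 t : (t +i* (- s))^-1 - (t +i* s)^-1 = 'i * (q t)%:C.
  rewrite qc !addiE rmorphN/= rmorphM/=.
  move: (nz1 t) (nz1' t) (posc t); rewrite !addiE rmorphN/= => a b c.
  have -> : t%:C ^+ 2 + s%:C ^+ 2 = (t%:C + 'i * - s%:C) * (t%:C + 'i * s%:C).
    by transitivity (t%:C ^+ 2 - 'i * 'i * s%:C ^+ 2); [rewrite i2; ring|ring].
  by field; rewrite a b.
have E2 t : (s +i* t)^-1 - ((- s) +i* t)^-1 = (q t)%:C.
  rewrite qc !addiE rmorphN/= rmorphM/=.
  move: (nz2 t) (nz2' t) (posc t); rewrite !addiE rmorphN/= => a b c.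
  have -> : t%:C ^+ 2 + s%:C ^+ 2 = - ((s%:C + 'i * t%:C) * (- s%:C + 'i * t%:C)).
    by transitivity (s%:C ^+ 2 - 'i * 'i * t%:C ^+ 2); [rewrite i2; ring|ring].
  by field; rewrite a b.
have cq : cts_on (- s) s (fun t => (q t)%:C).
  by have := cts_onB c4 c3; under eq_fun do rewrite E2.
have WE : sqW s = 'i * (cint (- s) s (fun t => (q t)%:C) + cint (- s) s (fun t => (q t)%:C)).
  rewrite /sqW /sqint /bdint /hseg /vseg -!cintB//.
  under eq_fun do rewrite E1.
  by rewrite (_ : (fun t => _ - _) = fun t => (q t)%:C) ?cintZ ?mulrDr//; apply/funext.
rewrite WE modulusM modulusi mul1r.
apply: le_trans (le_trans (ler_norm _) (normr_Re_le _)); rewrite creD/=.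
suff : 2 <= \int[lebesgue_measure]_(t in `[(- s), s]) q t by move=> /=; lra.
have -> : 2 = \int[lebesgue_measure]_(t in `[(- s), s]) (s^-1) :> R.
  by rewrite Rintegral_itv_cst//; field; rewrite gt_eqF.
apply: le_Rintegral => //.
- exact: (cts_integrable_Re (@cts_cst R _ _ (s^-1)%:C)).
- exact: (cts_integrable_Re cq).
move=> t; rewrite /= in_itv/= -ler_norml => ts.
have t2 : t ^+ 2 <= s ^+ 2 by rewrite -real_normK ?num_real// lerXn2r ?nnegrE// ltW.
rewrite /q ler_pdivlMr; last by rewrite lt_neqAle eq_sym pos addr_ge0 ?sqr_ge0.
rewrite mulrC ler_pdivrMr// expr2 in t2 *; nra.
Qed.

Lemma sqW_neq0 s : 0 < s -> sqW s != 0.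
Proof. by move=> s0; rewrite -modulus_gt0; have := sqW_ge4 s0; lra. Qed.

Lemma in_disc_sq z w s : modulus z + 2 * s < 1 -> modulus w <= 2 * s -> unit_disc (z + w).
Proof. by move=> h1 h2; rewrite /unit_disc/= (le_lt_trans (ler_modulusD _ _))//; lra. Qed.

Lemma analytic_cderiv_shift f z w s : analytic_on_disc f -> modulus z + 2 * s < 1 ->
  modulus w <= 2 * s -> cderiv (fun u => f (z + u)) w (complex_derive f (z + w)).
Proof.
by move=> Af h1 h2; apply/cderiv_shift/analytic_cderiv => //; exact: in_disc_sq h2.
Qed.

(** The difference of the two sides is the integral of [(f (z + w) - f z) / w], which is removable
    at 0 by continuity of [f]. *)
Lemma cauchy_formula f z s : analytic_on_disc f -> 0 < s -> modulus z + 2 * s < 1 ->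
  f z * sqW s = sqint (fun w => f (z + w) * w^-1) s.
Proof.
move=> Af s0 zs.
have F w : modulus w <= 2 * s -> cderiv (fun u => f (z + u)) w (complex_derive f (z + w)).
  by move=> h; exact: (analytic_cderiv_shift Af zs h).
have c1 w : on_square s w -> exists d, cderiv (fun w => f (z + w) * w^-1) w d.
  move=> sw; have [d hd] := cderiv_inv (on_square_neq0 sw).
  by eexists; apply: cderivM hd; apply: F; case: sw.
have c2 w : w != 0 -> exists d, cderiv (fun w => f z * w^-1) w d.
  move=> w0; have [d hd] := cderiv_inv w0.
  by eexists; apply: cderivM hd; exact: cderiv_cst.
apply/eqP; rewrite eq_sym -subr_eq0 /sqW -sqintZ//; last first.
  by move=> w sw; exact: ccont_inv (on_square_neq0 sw).
rewrite -sqintB//; [|by move=> w sw; exact/cderiv_ccont/c1|].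
  2: by move=> w sw; exact: cderiv_ccont (c2 _ (on_square_neq0 sw)).
apply/eqP; apply: sqint_removable => //.
  move=> w ws w0; have [d1 h1] := cderiv_inv w0; have [d2 h2] := c2 w w0.
  by eexists; apply: cderivB h2; apply: cderivM h1; exact: F.
move=> e e0; have z0 : unit_disc z by rewrite /unit_disc/=; lra.
have [del del0 hd] := cderiv_continuous (analytic_cderiv Af z0) e0.
exists del => // w w0 /hd /ltW.
by rewrite -mulrBl modulusM modulusV mulfVK// gt_eqF ?modulus_gt0.
Qed.

(** With [f z] subtracted in the numerator, [(f (z + w) - f z) / w^2 - f'(z) / w] is [o(1) / w] by
    the definition of the derivative, hence removable, and no integral of [w^-2] has to be
    computed. *)
Lemma cauchy_formula_deriv f z s : analytic_on_disc f -> 0 < s -> modulus z + 2 * s < 1 ->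
  complex_derive f z * sqW s = sqint (fun w => (f (z + w) - f z) * w ^- 2) s.
Proof.
move=> Af s0 zs.
have F w : modulus w <= 2 * s -> cderiv (fun u => f (z + u)) w (complex_derive f (z + w)).
  by move=> h; exact: (analytic_cderiv_shift Af zs h).
set d := complex_derive f z.
have c1 w : modulus w <= 2 * s -> w != 0 ->
    exists d, cderiv (fun w => (f (z + w) - f z) * w ^- 2) w d.
  move=> sw w0; eexists; apply: cderivM; first by apply: cderivB; [exact: F|exact: cderiv_cst].
  apply: cderivV; first by rewrite expf_neq0.
  exact: (cderivX 2 (cderiv_id _)).
have c2 w : w != 0 -> exists d', cderiv (fun w => d * w^-1) w d'.
  move=> w0; have [d' hd] := cderiv_inv w0.
  by eexists; apply: cderivM hd; exact: cderiv_cst.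
apply/eqP; rewrite eq_sym -subr_eq0 /sqW -sqintZ//; last first.
  by move=> w sw; exact: ccont_inv (on_square_neq0 sw).
rewrite -sqintB//; last 2 first.
- by move=> w sw; apply/cderiv_ccont/c1; [case: sw|exact: on_square_neq0 sw].
- by move=> w sw; exact: cderiv_ccont (c2 _ (on_square_neq0 sw)).
apply/eqP; apply: sqint_removable => //.
  move=> w ws w0; have [d1 h1] := c1 w ws w0; have [d2 h2] := c2 w w0.
  by exists (d1 - d2); exact: cderivB h1 h2.
move=> e e0; have z0 : unit_disc z by rewrite /unit_disc/=; lra.
have [del del0 hd] := analytic_cderiv Af z0 e0.
exists del => // w w0 /hd.
have m0 : 0 < modulus w by rewrite modulus_gt0.
rewrite -/d (_ : (f (z + w) - f z) * w ^- 2 - d * w^-1 = (f (z + w) - f z - d * w) / w ^+ 2); last first.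
  by field.
by rewrite modulusM modulusV modulusX expr2 invfM mulrA mulfVK ?gt_eqF// ler_pdivrMr.
Qed.

(** Cauchy's estimate: the integrand is at most [B / s^2], the contour contributes [16 s], and
    [|sqW s| >= 4] is divided out. *)
Lemma deriv_bound_by_osc f z s B : analytic_on_disc f -> 0 < s -> modulus z + 2 * s < 1 ->
  (forall w, modulus w <= 2 * s -> modulus (f (z + w) - f z) <= B) ->
  modulus (complex_derive f z) <= 4 * B / s.
Proof.
move=> Af s0 zs HB; have := cauchy_formula_deriv Af s0 zs.
have B0 : 0 <= B by rewrite (le_trans (modulus_ge0 _) (HB 0 _))// modulus0; lra.
have c1 w : on_square s w -> ccont (fun w => (f (z + w) - f z) * w ^- 2) w.
  move=> sw; have [sw1 _ _] := sw; have w0 := on_square_neq0 sw.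
  apply: cderiv_ccont; eexists; apply: cderivM.
    by apply: cderivB; [exact: (analytic_cderiv_shift Af zs sw1)|exact: cderiv_cst].
  apply: cderivV; first by rewrite expf_neq0.
  exact: (cderivX 2 (cderiv_id _)).
have c2 w : on_square s w -> modulus ((f (z + w) - f z) * w ^- 2) <= B / s ^+ 2.
  move=> [h1 h2 _]; rewrite modulusM modulusV modulusX.
  have s2 : 0 < s ^+ 2 by rewrite exprn_gt0.
  rewrite ler_pM ?modulus_ge0 ?HB ?invr_ge0 ?exprn_ge0 ?modulus_ge0//.
  by rewrite lef_pV2 ?posrE ?exprn_gt0 ?(lt_le_trans s0)// lerXn2r// nnegrE ?modulus_ge0// ltW.
have := sqint_bound s0 c1 c2 => H E; move: H; rewrite -E modulusM.
have W4 := sqW_ge4 s0; have m0 := modulus_ge0 (complex_derive f z).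
rewrite (_ : 16 * (B / s ^+ 2) * s = 4 * (4 * B / s)); last by field; rewrite gt_eqF.
move=> H; rewrite -(ler_pM2l (ltr0n _ 4))//; apply: le_trans H.
by rewrite mulrC ler_wpM2l.
Qed.

End cauchy.

Section continuity_calculus.
Variable R : realType.
Implicit Types (f g : R[i] -> R[i]) (z w : R[i]).

Lemma ccont_cst (a : R[i]) z : ccont (fun=> a) z.
Proof. by apply: cderiv_ccont; exists 0; exact: cderiv_cst. Qed.

Lemma ccont_shift f z w : ccont f (z + w) -> ccont (fun u => f (z + u)) w.
Proof. by move=> F e /F[a a0 ha]; exists a => // h /ha; rewrite addrA. Qed.

Lemma ccontD f g z : ccont f z -> ccont g z -> ccont (fun w => f w + g w) z.
Proof.
move=> F G e e0; have e2 : 0 < e / 2 by lra.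
have [a a0 ha] := F _ e2; have [b b0 hb] := G _ e2.
exists (Num.min a b); first by rewrite lt_min a0.
move=> h; rewrite lt_min => /andP[va vb].
rewrite opprD addrACA (le_lt_trans (ler_modulusD _ _))// [e]splitr.
by rewrite ltrD ?ha ?hb.
Qed.

Lemma ccontM f g z : ccont f z -> ccont g z -> ccont (fun w => f w * g w) z.
Proof.
move=> F G e e0.
pose M := modulus (f z) + modulus (g z) + 2.
have Mf := modulus_ge0 (f z); have Mg := modulus_ge0 (g z).
have M0 : 0 < M by rewrite /M; lra.
have eM : 0 < e / (2 * M) by rewrite divr_gt0// mulr_gt0.
have [a a0 ha] := F _ eM; have [b b0 hb] := G _ eM; have [b' b'0 hb'] := G _ ltr01.
exists (Num.min a (Num.min b b')); first by rewrite !lt_min a0 b0.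
move=> v; rewrite !lt_min => /and3P[va vb vb'].
have -> : f (z + v) * g (z + v) - f z * g z =
  (f (z + v) - f z) * g (z + v) + f z * (g (z + v) - g z) by ring.
rewrite (le_lt_trans (ler_modulusD _ _))// !modulusM.
have gv : modulus (g (z + v)) <= M.
  have := ler_modulusD (g z) (g (z + v) - g z); rewrite subrKC.
  by have := hb' _ vb'; rewrite /M; lra.
have h1 : modulus (f (z + v) - f z) * modulus (g (z + v)) <= e / (2 * M) * M.
  by rewrite ler_pM ?modulus_ge0// ltW// ha.
have h2 : modulus (f z) * modulus (g (z + v) - g z) <= (M - 1) * (e / (2 * M)).
  by rewrite ler_pM ?modulus_ge0//; [rewrite /M; lra|rewrite ltW// hb].
apply: le_lt_trans (lerD h1 h2) _.
rewrite (_ : e / (2 * M) * M + (M - 1) * (e / (2 * M)) = e - e / (2 * M)); last first.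
  by field; rewrite gt_eqF.
by rewrite ltrBlDr ltrDl.
Qed.

Lemma ccontB f g z : ccont f z -> ccont g z -> ccont (fun w => f w - g w) z.
Proof.
move=> F G; have := ccontD F (ccontM (ccont_cst (-1) z) G).
by under eq_fun do rewrite mulN1r.
Qed.

End continuity_calculus.

Lemma eqW (R : realType) (x y : R) : x = y -> x <= y.
Proof. by move=> ->. Qed.

(** * The mean value inequality and the fundamental theorem along a segment *)

Section line_calculus.
Variable R : realType.
Implicit Types (f df : R[i] -> R[i]) (s t e : R) (z v w d : R[i]).

(** [p] stands for the real or the imaginary part; this reduces a complex derivative along a line to
    two real ones, to which the real theorems of calculus apply. *)
Lemma is_derive_line f z v t d (p : R[i] -> R) :
  (forall a b, p (a + b) = p a + p b) -> (forall (r : R) a, p (a * r%:C) = p a * r) ->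
  (forall a, `|p a| <= modulus a) ->
  cderiv f (z + t%:C * v) d ->
  is_derive t 1 (fun s : R => p (f (z + s%:C * v))) (p (d * v)).
Proof.
move=> pD pZ pn H.
have pN a : p (- a) = - p a by have := pZ (-1) a; rewrite rmorphN1 !mulrN1.
have H' : (fun h : R => h^-1 *: ((fun s : R => p (f (z + s%:C * v))) (h *: 1 + t) -
    p (f (z + t%:C * v)))) @ 0^' --> p (d * v).
  apply/cvgrPdist_le => e e0.
  have K0 : 0 < modulus v + 1 by rewrite ltr_wpDl ?modulus_ge0.
  have [del del0 hd] := H _ (divr_gt0 e0 K0).
  apply/nbhs_ballP; exists (del / (modulus v + 1)); first by rewrite /= divr_gt0.
  move=> h; rewrite /ball/= sub0r normrN => hdel h0.
  have hh : 0 < `|h| by rewrite normr_gt0.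
  rewrite -(ler_pM2r hh) -normrM mulrBl -[_ *: _ in X in `|X|]/(_ * _) mulrAC mulVf// mul1r.
  rewrite -pZ -pN -pD -pN -pD (le_trans (pn _))// modulusB.
  have hv : modulus (h%:C * v) < del.
    move: hdel; rewrite ltr_pdivlMr//; apply: le_lt_trans.
    by rewrite modulusM modulus_real ler_wpM2l// lerDl.
  have := hd _ hv; rewrite modulusM modulus_real.
  rewrite (_ : _ - _ = f (z + (h *: 1 + t)%:C * v) - f (z + t%:C * v) - d * v * h%:C); last first.
    rewrite (_ : z + t%:C * v + h%:C * v = z + (h *: 1 + t)%:C * v); last first.
      by rewrite -[h *: 1]/(h * 1) mulr1 rmorphD/=; ring.
    by ring.
  move=> /le_trans; apply.
  rewrite (_ : _ * _ = e * `|h| * (modulus v / (modulus v + 1))); last first.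
    by field; rewrite gt_eqF.
  by rewrite ler_piMr ?mulr_ge0 ?(ltW e0)// ler_pdivrMr// mul1r lerDl.
apply: DeriveDef; first by apply/cvg_ex; exists (p (d * v)).
by apply: cvg_lim => //; exact: Rhausdorff.
Qed.

Lemma is_derive_lineRe f z v t d : cderiv f (z + t%:C * v) d ->
  is_derive t 1 (fun s : R => complex.Re (f (z + s%:C * v))) (complex.Re (d * v)).
Proof.
apply: is_derive_line; [exact: creD| |exact: normr_Re_le].
by move=> r a; rewrite creM/=; ring.
Qed.

Lemma is_derive_lineIm f z v t d : cderiv f (z + t%:C * v) d ->
  is_derive t 1 (fun s : R => complex.Im (f (z + s%:C * v))) (complex.Im (d * v)).
Proof.
apply: is_derive_line; [exact: cimD| |exact: normr_Im_le].
by move=> r a; rewrite cimM/=; ring.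
Qed.

(** The real mean value theorem is applied to both parts, at two different intermediate points,
    whence the factor 2. It is available before derivatives are known to be continuous. *)
Lemma mean_value_ineq f df z w B :
  (forall t, 0 <= t <= 1 -> cderiv f (z + t%:C * (w - z)) (df (z + t%:C * (w - z)))) ->
  (forall t, 0 <= t <= 1 -> modulus (df (z + t%:C * (w - z))) <= B) ->
  modulus (f w - f z) <= 2 * B * modulus (w - z).
Proof.
move=> F FB.
have E1 : z + 1%:C * (w - z) = w by rewrite mul1r subrKC.
have E0 : z + 0%:C * (w - z) = z by rewrite mul0r addr0.
have FR t : t \in `]0, 1[%R -> is_derive t 1 (fun s : R => complex.Re (f (z + s%:C * (w - z))))
    (complex.Re (df (z + t%:C * (w - z)) * (w - z))).
  by rewrite in_itv/= => /andP[t0 t1]; apply: is_derive_lineRe; apply: F; rewrite !ltW.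
have FI t : t \in `]0, 1[%R -> is_derive t 1 (fun s : R => complex.Im (f (z + s%:C * (w - z))))
    (complex.Im (df (z + t%:C * (w - z)) * (w - z))).
  by rewrite in_itv/= => /andP[t0 t1]; apply: is_derive_lineIm; apply: F; rewrite !ltW.
have C : cts_on 0 1 (fun s : R => f (z + s%:C * (w - z))).
  by apply: cts_on_comp => t /F h; apply: cderiv_ccont; eexists; exact: h.
have [c c01 Hc] := MVT ltr01 FR (cts_on_within (@Re_lip R) C).
have [c' c'01 Hc'] := MVT ltr01 FI (cts_on_within (@Im_lip R) C).
rewrite (le_trans (modulus_le_ReIm _))// creD cimD creN cimN.
move: Hc Hc'; rewrite E1 E0 subr0 !mulr1 => -> ->.
rewrite in_itv/= in c01; rewrite in_itv/= in c'01.
have h1 : modulus (df (z + c%:C * (w - z)) * (w - z)) <= B * modulus (w - z).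
  rewrite modulusM ler_wpM2r ?modulus_ge0// FB//; lra.
have h2 : modulus (df (z + c'%:C * (w - z)) * (w - z)) <= B * modulus (w - z).
  rewrite modulusM ler_wpM2r ?modulus_ge0// FB//; lra.
have := normr_Re_le (df (z + c%:C * (w - z)) * (w - z)).
have := normr_Im_le (df (z + c'%:C * (w - z)) * (w - z)).
lra.
Qed.

Lemma ftc_line f df z v :
  (forall t, 0 <= t <= 1 -> cderiv f (z + t%:C * v) (df (z + t%:C * v))) ->
  cts_on 0 1 (fun t => df (z + t%:C * v)) ->
  cint 0 1 (fun t => df (z + t%:C * v) * v) = f (z + v) - f z.
Proof.
move=> F C.
have C' : cts_on 0 1 (fun t => df (z + t%:C * v) * v).
  by under eq_fun do rewrite mulrC; exact: cts_onZ.
have E1 : z + 1%:C * v = z + v by rewrite mul1r.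
have E0 : z + 0%:C * v = z by rewrite mul0r addr0.
have cv (p : R[i] -> R) (u : R -> R) t : 
    is_derive t 1 u (p (df (z + t%:C * v) * v)) -> u @ t --> u t.
  by move=> [/derivable1_diffP/differentiable_continuous].
have key (p : R[i] -> R) : (forall z w, `|p z - p w| <= modulus (z - w)) ->
    (forall t, 0 <= t <= 1 -> is_derive t 1 (fun s : R => p (f (z + s%:C * v)))
       (p (df (z + t%:C * v) * v))) ->
    \int[lebesgue_measure]_(t in `[0, 1]) p (df (z + t%:C * v) * v) =
    p (f (z + v)) - p (f z).
  move=> pl D; rewrite /Rintegral.
  have := @continuous_FTC2 R (fun t => p (df (z + t%:C * v) * v))
    (fun s : R => p (f (z + s%:C * v))) 0 1 ltr01 (cts_on_within pl C').
  rewrite E1 E0 => -> //; last first.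
    move=> t; rewrite in_itv/= => t01.
    have /D [] : 0 <= t <= 1 by lra.
    by rewrite derive1E.
  split.
  - move=> t; rewrite in_itv/= => t01.
    by have /D [] : 0 <= t <= 1 by lra.
  - apply: cvg_at_right_filter; apply: (cv p); apply: D; lra.
  - apply: cvg_at_left_filter; apply: (cv p); apply: D; lra.
apply: complex_ext; rewrite ?(creD,cimD,creN,cimN) /cint/=.
  by apply: key => [|t /F]; [exact: Re_lip|exact: is_derive_lineRe].
by apply: key => [|t /F]; [exact: Im_lip|exact: is_derive_lineIm].
Qed.

End line_calculus.

(** * Continuity on the plane and compactness of closed discs *)

Section plane_continuity.
Variable R : realType.
Implicit Types (f : R[i] -> R[i]) (rho : R) (z : R[i]).

Lemma pair_continuous (F : R[i] -> R) (p : R * R) :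
  (forall e : R, 0 < e -> exists2 del : R, 0 < del & forall h, modulus h < del ->
     `|F (complex_of_pair p + h) - F (complex_of_pair p)| < e) ->
  {for p, continuous (F \o @complex_of_pair R)}.
Proof.
move=> H; apply/cvgrPdist_lt => e e0; have [del del0 hd] := H e e0.
exists (ball p.1 (del / 2), ball p.2 (del / 2)) => /=.
  by split; apply: nbhsx_ballx; rewrite divr_gt0.
move=> q [/=]; rewrite /ball/= => q1 q2; rewrite distrC.
pose h := (q.1 - p.1) +i* (q.2 - p.2).
have -> : complex_of_pair q = complex_of_pair p + h.
  by apply: complex_ext; rewrite ?(creD,cimD)/=; ring.
apply: hd; rewrite (le_lt_trans (modulus_le_ReIm _))//= distrC (distrC q.2).
lra.
Qed.

Lemma modulus_pair_continuous : continuous (@modulus R \o @complex_of_pair R).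
Proof.
move=> p; apply: pair_continuous => e e0; exists e => // h he.
by rewrite (le_lt_trans (modulus_lip _ _))// addrC addKr.
Qed.

Lemma compact_disc rho : compact (@complex_of_pair R @^-1` [set z | modulus z <= rho]).
Proof.
apply: (@subclosed_compact _ _ (`[- rho, rho]%classic `*` `[- rho, rho]%classic)).
- have -> : complex_of_pair (R:=R) @^-1` [set z | modulus z <= rho] =
     (@modulus R \o @complex_of_pair R) @^-1` [set x | x <= rho] by [].
  by apply: closed_comp => [p _|]; [exact: modulus_pair_continuous|exact: closed_le].
- by apply: compact_setX; exact: segment_compact.
move=> p /= h; rewrite !in_itv/= -!ler_norml.
by split; apply: le_trans h; [exact: (normr_Re_le (complex_of_pair p))|exact: (normr_Im_le (complex_of_pair p))].
Qed.

Lemma ccont_bounded f rho : (forall z, modulus z <= rho -> ccont f z) ->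
  exists2 B, 0 < B & forall z, modulus z <= rho -> modulus (f z) <= B.
Proof.
move=> F; have [r0|r0] := ltP rho 0.
  exists 1 => // z zr; suff : false by [].
  by have := modulus_ge0 z; lra.
pose K := @complex_of_pair R @^-1` [set z | modulus z <= rho].
have [|||c cK H] := @compact_EVT_max _ R ((fun z => modulus (f z)) \o @complex_of_pair R) K.
- by exists (0, 0); rewrite /K/= modulus0.
- exact: compact_disc.
- apply: continuous_in_subspaceT => p; rewrite inE /K /= => /F C.
  apply: (@pair_continuous (fun z => modulus (f z))) => e /C[del del0 hd]; exists del => // h /hd.
  exact/le_lt_trans/modulus_lip.
exists (modulus (f (complex_of_pair c)) + 1); first by rewrite ltr_wpDl ?modulus_ge0.
move=> z zr; have := H (complex.Re z, complex.Im z).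
rewrite inE /K/= /complex_of_pair/= -complexE => /(_ zr); lra.
Qed.

End plane_continuity.

Opaque modulus complex_derive cint sqint.

(** * Regularity of analytic functions *)

Section analytic.
Variable R : realType.
Implicit Types (f : R[i] -> R[i]) (rho : R) (z w h : R[i]).

Lemma analytic_ccont f z : analytic_on_disc f -> unit_disc z -> ccont f z.
Proof. by move=> Af z1; apply: cderiv_ccont; eexists; exact: analytic_cderiv. Qed.

Lemma analytic_bounded f rho : analytic_on_disc f -> rho < 1 ->
  exists2 B, 0 < B & forall z, modulus z <= rho -> modulus (f z) <= B.
Proof.
move=> Af r1; apply: ccont_bounded => z zr.
by apply: analytic_ccont => //; exact: le_lt_trans r1.
Qed.

(** Cauchy's estimate on a slightly larger disc. It starts a bootstrap: a bounded derivative makes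
    [f] Lipschitz, then [f'] Lipschitz, then gives a second order Taylor bound, then analyticity of
    [f']. *)
Lemma derive_bounded f rho : analytic_on_disc f -> rho < 1 ->
  exists2 B, 0 < B & forall z, modulus z <= rho -> modulus (complex_derive f z) <= B.
Proof.
move=> Af r1; pose s := (1 - rho) / 4.
have s0 : 0 < s by rewrite /s; lra.
have r2 : rho + 2 * s < 1 by rewrite /s; lra.
have [B B0 HB] := analytic_bounded Af r2.
exists (4 * (2 * B) / s); first by rewrite divr_gt0// !mulr_gt0.
move=> z zr; apply: deriv_bound_by_osc => //; first lra.
move=> w ws; rewrite (le_trans (ler_modulusB _ _))//.
have : modulus (f (z + w)) <= B by apply: HB; have := ler_modulusD z w; lra.
have : modulus z <= rho + 2 * s by lra.
move=> /HB; lra.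
Qed.

Lemma modulus_segment z w (t r : R) : 0 <= t <= 1 -> modulus z <= r -> modulus w <= r ->
  modulus (z + t%:C * (w - z)) <= r.
Proof.
move=> t01 zr wr.
have -> : z + t%:C * (w - z) = (1 - t)%:C * z + t%:C * w by rewrite rmorphB rmorph1; ring.
rewrite (le_trans (ler_modulusD _ _))// !modulusM !modulus_real ger0_norm; last lra.
rewrite ger0_norm; last lra.
have : (1 - t) * modulus z <= (1 - t) * r by rewrite ler_wpM2l//; lra.
have : t * modulus w <= t * r by rewrite ler_wpM2l//; lra.
lra.
Qed.

Lemma analytic_mvi f z w (r B : R) : analytic_on_disc f -> r < 1 ->
  modulus z <= r -> modulus w <= r ->
  (forall t, 0 <= t <= 1 -> modulus (complex_derive f (z + t%:C * (w - z))) <= B) ->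
  modulus (f w - f z) <= 2 * B * modulus (w - z).
Proof.
move=> Af r1 zr wr H; apply: mean_value_ineq H => t t01.
apply: analytic_cderiv => //; rewrite /unit_disc/=; apply: le_lt_trans r1.
exact: modulus_segment.
Qed.

Lemma analytic_lipschitz f rho : analytic_on_disc f -> rho < 1 ->
  exists2 L, 0 < L & forall z w, modulus z <= rho -> modulus w <= rho ->
    modulus (f w - f z) <= L * modulus (w - z).
Proof.
move=> Af r1; have [B B0 HB] := derive_bounded Af r1.
exists (2 * B); first by rewrite mulr_gt0.
move=> z w zr wr; apply: (analytic_mvi Af r1 zr wr) => t t01.
by apply: HB; exact: modulus_segment.
Qed.

(** In the difference of the Cauchy formulas for [f'(w)] and [f'(z)] the integrand is of order
    [|w - z|], since [f] itself is Lipschitz. *)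
Lemma derive_lipschitz f rho : analytic_on_disc f -> rho < 1 ->
  exists2 L, 0 < L & forall z w, modulus z <= rho -> modulus w <= rho ->
    modulus (complex_derive f w - complex_derive f z) <= L * modulus (w - z).
Proof.
move=> Af r1; pose s := (1 - rho) / 4.
have s0 : 0 < s by rewrite /s; lra.
have r2 : rho + 2 * s < 1 by rewrite /s; lra.
have [L L0 HL] := analytic_lipschitz Af r2.
have Lip z w u : modulus z <= rho -> modulus w <= rho -> modulus u <= 2 * s ->
    modulus (f (w + u) - f w - (f (z + u) - f z)) <= 2 * L * modulus (w - z).
  move=> zr wr us.
  have -> : f (w + u) - f w - (f (z + u) - f z) = (f (w + u) - f (z + u)) - (f w - f z) by ring.
  rewrite (le_trans (ler_modulusB _ _))//.
  have := HL (z + u) (w + u) (le_trans (ler_modulusD _ _) (lerD zr us)) (le_trans (ler_modulusD _ _) (lerD wr us)).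
  rewrite opprD addrACA subrr addr0.
  have : modulus (f w - f z) <= L * modulus (w - z) by apply: HL; lra.
  lra.
exists (4 * (2 * L) / s); first by rewrite divr_gt0// !mulr_gt0.
move=> z w zr wr.
have zs : modulus z + 2 * s < 1 by lra.
have ws : modulus w + 2 * s < 1 by lra.
have c z' : modulus z' + 2 * s < 1 -> forall u, on_square s u ->
    ccont (fun u => (f (z' + u) - f z') * u ^- 2) u.
  move=> zs' u su; have [su1 _ _] := su; apply: cderiv_ccont; eexists; apply: cderivM.
    by apply: cderivB; [exact: (analytic_cderiv_shift Af zs' su1)|exact: cderiv_cst].
  by apply: cderivV; [rewrite expf_neq0// (on_square_neq0 su)|exact: (cderivX 2 (cderiv_id _))].
have E : (complex_derive f w - complex_derive f z) * sqW s =
    sqint (fun u => (f (w + u) - f w - (f (z + u) - f z)) * u ^- 2) s.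
  transitivity (complex_derive f w * sqW s - complex_derive f z * sqW s); first exact: mulrBl.
  transitivity (sqint (fun u => (f (w + u) - f w) * u ^- 2) s -
      sqint (fun u => (f (z + u) - f z) * u ^- 2) s).
    by congr (_ - _); exact: cauchy_formula_deriv.
  rewrite -(sqintB s0 (c _ ws) (c _ zs)).
  by apply: (eq_sqint s0) => u _; exact/esym/mulrBl.
have C u : on_square s u -> ccont (fun u => (f (w + u) - f w - (f (z + u) - f z)) * u ^- 2) u.
  move=> su; have [su1 _ _] := su; apply: cderiv_ccont; eexists; apply: cderivM.
    by apply: cderivB; apply: cderivB; [exact: (analytic_cderiv_shift Af ws su1)|exact: cderiv_cst|exact: (analytic_cderiv_shift Af zs su1)|exact: cderiv_cst].
  by apply: cderivV; [rewrite expf_neq0// (on_square_neq0 su)|exact: (cderivX 2 (cderiv_id _))].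
have := @sqint_bound R _ s (2 * L * modulus (w - z) / s ^+ 2) s0 C.
rewrite -E modulusM => H.
have {}H : modulus (complex_derive f w - complex_derive f z) * modulus (sqW s) <=
   16 * (2 * L * modulus (w - z) / s ^+ 2) * s.
  apply: H => u [h1 h2 _]; rewrite modulusM modulusV modulusX.
  rewrite ler_pM ?modulus_ge0 ?Lip ?invr_ge0 ?exprn_ge0 ?modulus_ge0//.
  by rewrite lef_pV2 ?posrE ?exprn_gt0 ?(lt_le_trans s0)// lerXn2r// nnegrE ?modulus_ge0// ltW.
have W4 := sqW_ge4 s0; have m0 := modulus_ge0 (complex_derive f w - complex_derive f z).
rewrite -(ler_pM2l (ltr0n _ 4))//.
apply: le_trans (_ : _ <= modulus (complex_derive f w - complex_derive f z) * modulus (sqW s)) _.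
  by rewrite mulrC ler_wpM2l.
apply: le_trans H _; rewrite le_eqVlt; apply/orP; left; apply/eqP.
by field; rewrite gt_eqF.
Qed.

(** The mean value inequality for [w => f w - f'(z) w], whose derivative is small near [z] because
    [f'] is Lipschitz. *)
Lemma taylor2 f rho : analytic_on_disc f -> rho < 1 ->
  exists2 C, 0 < C & forall z h, modulus z <= rho -> modulus (z + h) <= rho ->
    modulus (f (z + h) - f z - complex_derive f z * h) <= C * modulus h ^+ 2.
Proof.
move=> Af r1; have [L L0 HL] := derive_lipschitz Af r1.
exists (2 * L); first by rewrite mulr_gt0.
move=> z h zr hr.
have := @mean_value_ineq R (fun w => f w - complex_derive f z * w)
  (fun w => complex_derive f w - complex_derive f z) z (z + h) (L * modulus h).
rewrite addrAC subrr add0r => H.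
have -> : f (z + h) - f z - complex_derive f z * h =
  f (z + h) - complex_derive f z * (z + h) - (f z - complex_derive f z * z) by ring.
rewrite expr2 !mulrA -(mulrA 2); apply: H => t t01.
  have M : modulus (z + t%:C * h) <= rho.
    by have := modulus_segment t01 zr hr; rewrite addrAC subrr add0r.
  apply: cderivB; first by apply: analytic_cderiv => //; exact: le_lt_trans M r1.
  have := cderivM (cderiv_cst (complex_derive f z) (z + t%:C * h)) (cderiv_id (z + t%:C * h)).
  by rewrite mul0r add0r mulr1.
have M : modulus (z + t%:C * h) <= rho.
  by have := modulus_segment t01 zr hr; rewrite addrAC subrr add0r.
rewrite (le_trans (HL _ _ zr M))// addrAC subrr add0r modulusM modulus_real ler_pM2l//.
by rewrite ler_piMl ?modulus_ge0// ger0_norm; lra.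
Qed.

Lemma derive_ccont f z : analytic_on_disc f -> unit_disc z -> ccont (complex_derive f) z.
Proof.
move=> Af z1 e e0; pose rho := (1 + modulus z) / 2.
have r1 : rho < 1 by rewrite /rho; move: z1; rewrite /unit_disc/=; lra.
have zr : modulus z < rho by rewrite /rho; move: z1; rewrite /unit_disc/=; lra.
have [L L0 HL] := derive_lipschitz Af r1.
exists (Num.min (rho - modulus z) (e / L)); first by rewrite lt_min subr_gt0 zr divr_gt0.
move=> h; rewrite lt_min => /andP[h1]; rewrite ltr_pdivlMr// mulrC.
have zhr : modulus (z + h) <= rho by have := ler_modulusD z h; lra.
have := HL z (z + h) (ltW zr) zhr; have -> : z + h - z = h by ring.
exact: le_lt_trans.
Qed.

(** Cauchy's formula for [f'] at [z + h] and at [z] expresses [f'(z + h) - f'(z) - d h] as a contour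
    integral whose integrand is [O(|h|^2)]. *)
Lemma derive_analytic f : analytic_on_disc f -> analytic_on_disc (complex_derive f).
Proof.
move=> Af z z1; pose s := (1 - modulus z) / 8.
have s0 : 0 < s by rewrite /s; move: z1; rewrite /unit_disc/=; lra.
have zs : modulus z + 8 * s = 1 by rewrite /s; lra.
pose rho := modulus z + 4 * s.
have r1 : rho < 1 by rewrite /rho; lra.
have [C C0 HC] := taylor2 Af r1.
set f' := complex_derive f.
(* The candidate for the second derivative: Cauchy's formula for the derivative, written with [f']
   in place of [f]. *)
pose d := sqint (fun u => (f' (z + u) - f' z) * u ^- 2) s / sqW s.
have dE : d * sqW s = sqint (fun u => (f' (z + u) - f' z) * u ^- 2) s.
  exact: divfK (sqW_neq0 s0) _.
clearbody d.
apply: (@cderiv_derivable R f' z d) => e e0.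
pose K := 4 * (2 * C) / s.
have K0 : 0 < K by rewrite divr_gt0// !mulr_gt0.
exists (Num.min s (e / K)); first by rewrite lt_min s0 divr_gt0.
move=> h; rewrite lt_min => /andP[hs]; rewrite ltr_pdivlMr// => hK.
have inv2 u : on_square s u -> ccont (fun u => u ^- 2) u.
  move=> su; apply: cderiv_ccont; eexists; apply: cderivV; last exact: (cderivX 2 (cderiv_id _)).
  by rewrite expf_neq0// (on_square_neq0 su).
have zle1 : modulus z + 2 * s < 1 by lra.
have hle1 : modulus (z + h) + 2 * s < 1 by have := ler_modulusD z h; lra.
have inD z' u : modulus z' + 2 * s < 1 -> on_square s u -> unit_disc (z' + u).
  by move=> hz [h1 _ _]; exact: in_disc_sq h1.
have c1 z' u : modulus z' + 2 * s < 1 -> on_square s u ->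
    ccont (fun u => (f (z' + u) - f z') * u ^- 2) u.
  move=> hz su; apply: ccontM (inv2 _ su); apply: ccontB (ccont_cst _ _).
  by apply/ccont_shift/analytic_ccont => //; exact: inD.
have c2 u : on_square s u -> ccont (fun u => h * ((f' (z + u) - f' z) * u ^- 2)) u.
  move=> su; apply: ccontM (ccont_cst _ _) _; apply: ccontM (inv2 _ su).
  apply: ccontB (ccont_cst _ _); apply/ccont_shift/derive_ccont => //; exact: inD.
have c2' u : on_square s u -> ccont (fun u => (f' (z + u) - f' z) * u ^- 2) u.
  move=> su; apply: ccontM (inv2 _ su).
  apply: ccontB (ccont_cst _ _); apply/ccont_shift/derive_ccont => //; exact: inD.
pose big u := (f (z + h + u) - f (z + h)) * u ^- 2 - (f (z + u) - f z) * u ^- 2 -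
  h * ((f' (z + u) - f' z) * u ^- 2).
have cbig u : on_square s u -> ccont big u.
  by move=> su; apply: ccontB (c2 _ su); apply: ccontB; exact: c1.
have E : (f' (z + h) - f' z - d * h) * sqW s = sqint big s.
  have c1z u := c1 z u zle1; have c1h u := c1 (z + h) u hle1.
  rewrite (sqintB s0 (fun u su => ccontB (c1h u su) (c1z u su)) c2).
  rewrite (sqintB s0 c1h c1z) (sqintZ _ s0 c2').
  rewrite -dE -(cauchy_formula_deriv Af s0 zle1) -(cauchy_formula_deriv Af s0 hle1).
  by rewrite !mulrBl mulrA (mulrC h).
have bnd u : on_square s u -> modulus (big u) <= 2 * C * modulus h ^+ 2 / s ^+ 2.
  move=> [h1 h2 _].
  (* Regrouped as the Taylor remainder at [z + u] minus the one at [z], both controlled by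
     [taylor2]. *)
  have -> : big u = (f (z + u + h) - f (z + u) - f' (z + u) * h - (f (z + h) - f z - f' z * h)) * u ^- 2.
    rewrite /big (addrAC z h u).
    move: (f (z + u + h)) (f (z + u)) (f (z + h)) (f z) (f' (z + u)) (f' z) (u ^- 2) => a1 a2 a3 a4 a5 a6 a7.
    by ring.
  have t1 : modulus (f (z + u + h) - f (z + u) - f' (z + u) * h) <= C * modulus h ^+ 2.
    by apply: HC; have := ler_modulusD z u; have := ler_modulusD (z + u) h; rewrite /rho; lra.
  have t2 : modulus (f (z + h) - f z - f' z * h) <= C * modulus h ^+ 2.
    by apply: HC; have := ler_modulusD z h; rewrite /rho; lra.
  rewrite modulusM modulusV modulusX ler_pM ?modulus_ge0 ?invr_ge0 ?exprn_ge0 ?modulus_ge0//.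
    apply: le_trans (ler_modulusB _ _) _; apply: le_trans (lerD t1 t2) _.
    by apply/eqW; ring.
  by rewrite lef_pV2 ?posrE ?exprn_gt0 ?(lt_le_trans s0)// lerXn2r// nnegrE ?modulus_ge0// ltW.
have := sqint_bound s0 cbig bnd; rewrite -E modulusM => H.
have W4 := sqW_ge4 s0; have m0 := modulus_ge0 (f' (z + h) - f' z - d * h).
have H2 : modulus (f' (z + h) - f' z - d * h) <= K * modulus h ^+ 2.
  rewrite -(ler_pM2l (ltr0n _ 4))//.
  apply: le_trans (_ : _ <= modulus (f' (z + h) - f' z - d * h) * modulus (sqW s)) _.
    by rewrite mulrC; exact: ler_wpM2l m0 _ _ W4.
  by apply: le_trans H _; apply/eqW; rewrite /K; field; rewrite gt_eqF.
apply: le_trans H2 _; rewrite expr2 mulrA ler_wpM2r ?modulus_ge0// mulrC ltW//.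
Qed.

Lemma analyticD f g : analytic_on_disc f -> analytic_on_disc g ->
  analytic_on_disc (fun z => f z + g z).
Proof. by move=> F G z z1; apply: (cderiv_derivable (cderivD (analytic_cderiv F z1) (analytic_cderiv G z1))). Qed.

Lemma analyticM f g : analytic_on_disc f -> analytic_on_disc g ->
  analytic_on_disc (fun z => f z * g z).
Proof. by move=> F G z z1; apply: (cderiv_derivable (cderivM (analytic_cderiv F z1) (analytic_cderiv G z1))). Qed.

Lemma analytic_cst (a : R[i]) : analytic_on_disc (fun=> a).
Proof. by move=> z z1; exact: (cderiv_derivable (cderiv_cst a z)). Qed.

Lemma analyticX f n : analytic_on_disc f -> analytic_on_disc (fun z => f z ^+ n).
Proof. by move=> F z z1; exact: (cderiv_derivable (cderivX n (analytic_cderiv F z1))). Qed.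

Lemma eq_analytic f g : (forall z, unit_disc z -> f z = g z) ->
  analytic_on_disc f -> analytic_on_disc g.
Proof.
move=> fg F z z1; have H := analytic_cderiv F z1.
have d0 : 0 < 1 - modulus z by rewrite subr_gt0.
apply: cderiv_derivable; apply: (eq_cderiv d0 _ H) => h hz; apply: fg.
by rewrite /unit_disc/= (le_lt_trans (ler_modulusD _ _))// addrC -ltrBrDr.
Qed.

(* Differentiation under the integral: the derivative of [w => F (t w) w] in [w]
   is the derivative of [t F (t w)] in [t]. *)
Lemma segment_integral_cderiv f z : analytic_on_disc f -> unit_disc z ->
  cderiv (segment_integral f) z (f z).
Proof.
move=> Af z1; pose rho := (1 + modulus z) / 2.
have r1 : rho < 1 by rewrite /rho; move: z1; rewrite /unit_disc/=; lra.
have zr : modulus z < rho by rewrite /rho; move: z1; rewrite /unit_disc/=; lra.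
have [C C0 HC] := taylor2 Af r1.
have [B B0 HB] := derive_bounded Af r1.
set f' := complex_derive f.
have scale (t : R) w : 0 <= t <= 1 -> modulus w <= rho -> modulus (t%:C * w) <= rho.
  move=> t01 wr; rewrite modulusM modulus_real ger0_norm; last lra.
  by apply: le_trans wr; rewrite ler_piMl ?modulus_ge0//; lra.
have cts w : modulus w <= rho -> cts_on 0 1 (fun t => f (t%:C * w) * w).
  move=> wr; under eq_fun do rewrite mulrC; apply: cts_onZ.
  have E t : t%:C * w = 0 + t%:C * w by rewrite add0r.
  under eq_fun do rewrite E; apply: cts_on_comp => t t01.
  apply: analytic_ccont => //; rewrite add0r /unit_disc/=.
  exact: le_lt_trans (scale _ _ t01 wr) r1.
pose dk u := f (u * z) + u * (f' (u * z) * z).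
have dkE u : unit_disc (u * z) -> cderiv (fun u => u * f (u * z)) u (dk u).
  move=> uz; have := cderivM (cderiv_id u) (_ : cderiv (fun u => f (u * z)) u (f' (u * z) * z)).
  rewrite mul1r; apply.
  move=> e e0; have K0 : 0 < modulus z + 1 by rewrite ltr_wpDl ?modulus_ge0.
  have [del del0 hd] := analytic_cderiv Af uz (divr_gt0 e0 K0).
  exists (del / (modulus z + 1)); first by rewrite divr_gt0.
  move=> h; rewrite ltr_pdivlMr// => hh.
  have hz : modulus (h * z) < del.
    by rewrite modulusM (le_lt_trans _ hh)// ler_wpM2l ?modulus_ge0// lerDl.
  have := hd _ hz; rewrite -/f' mulrDl -mulrA (mulrC z h) => /le_trans; apply.
  rewrite modulusM (_ : _ * _ = e * modulus h * (modulus z / (modulus z + 1))); last first.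
    by field; rewrite gt_eqF.
  by rewrite ler_piMr ?mulr_ge0 ?modulus_ge0 ?(ltW e0)// ler_pdivrMr// mul1r lerDl.
have uz (t : R) : 0 <= t <= 1 -> unit_disc (t%:C * z).
  by move=> t01; rewrite /unit_disc/=; exact: le_lt_trans (scale _ _ t01 (ltW zr)) r1.
have cdk : cts_on 0 1 (fun t => dk (0 + t%:C * 1)).
  apply: cts_on_comp => t t01; rewrite add0r mulr1.
  have S g : ccont g (t%:C * z) -> ccont (fun u => g (u * z)) t%:C.
    move=> G e e0; have [a a0 ha] := G e e0.
    have K0 : 0 < modulus z + 1 by rewrite ltr_wpDl ?modulus_ge0.
    exists (a / (modulus z + 1)); first by rewrite divr_gt0.
    move=> h; rewrite ltr_pdivlMr// => hh; rewrite mulrDl; apply: ha.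
    by rewrite modulusM (le_lt_trans _ hh)// ler_wpM2l ?modulus_ge0// lerDl.
  apply: ccontD; first by apply/S/analytic_ccont => //; exact: uz.
  apply: ccontM; first by apply: cderiv_ccont; exists 1; exact: cderiv_id.
  apply: ccontM (ccont_cst _ _); apply: (S (complex_derive f)); apply: derive_ccont => //; exact: uz.
have FTC : cint 0 1 (fun t => dk t%:C) = f z.
  have := @ftc_line R (fun u => u * f (u * z)) dk 0 1 _ cdk.
  rewrite add0r !mul1r mul0r subr0 => <-.
    by apply: eq_cint => t _; rewrite add0r !mulr1.
  by move=> t t01; rewrite add0r mulr1; apply: dkE; exact: uz.
have E (t : R) : 0 + t%:C * 1 = t%:C by rewrite add0r mulr1.
have cdk' : cts_on 0 1 (fun t => dk t%:C).
  have -> : (fun t : R => dk t%:C) = (fun t : R => dk (0 + t%:C * 1)).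
    by apply/funext => t; rewrite E.
  exact: cdk.
move=> e e0; pose K := 2 * (C + B).
have K0 : 0 < K by rewrite /K; lra.
exists (Num.min (rho - modulus z) (e / K)); first by rewrite lt_min subr_gt0 zr divr_gt0.
move=> h; rewrite lt_min => /andP[hs]; rewrite ltr_pdivlMr// => hK.
have zhr : modulus (z + h) <= rho by have := ler_modulusD z h; lra.
have czh := cts _ zhr; have cz := cts _ (ltW zr).
have -> : segment_integral f (z + h) - segment_integral f z - f z * h =
   cint 0 1 (fun t => f (t%:C * (z + h)) * (z + h) - f (t%:C * z) * z - h * dk t%:C).
  rewrite !segment_integralE.
  rewrite (cintB (cts_onB czh cz) (cts_onZ h cdk')) (cintB czh cz) (cintZ h cdk').
  by rewrite FTC (mulrC h).
have -> : e * modulus h = 2 * (e * modulus h / 2) * (1 - 0) by field.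
apply: (modulus_cint_bound ler01 (cts_onB (cts_onB czh cz) (cts_onZ h cdk'))).
move=> t t01.
have -> : f (t%:C * (z + h)) * (z + h) - f (t%:C * z) * z - h * dk t%:C =
  (f (t%:C * z + t%:C * h) - f (t%:C * z) - f' (t%:C * z) * (t%:C * h)) * (z + h) +
  f' (t%:C * z) * (t%:C * (h * h)).
  rewrite /dk -(mulrDr t%:C z h).
  move: (f (t%:C * (z + h))) (f (t%:C * z)) (f' (t%:C * z)) (t%:C) => a1 a2 a3 a4.
  by ring.
rewrite (le_trans (ler_modulusD _ _))//.
have m0 := modulus_ge0 h.
have th : modulus (t%:C * h) <= modulus h.
  rewrite modulusM modulus_real ger0_norm; last lra.
  by rewrite ler_piMl//; lra.
have T1 : modulus (f (t%:C * z + t%:C * h) - f (t%:C * z) - f' (t%:C * z) * (t%:C * h)) <= C * modulus h ^+ 2.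
  apply: le_trans (HC _ _ _ _) _; [exact: scale (ltW zr)|by rewrite -mulrDr; exact: scale|].
  by rewrite ler_wpM2l ?(ltW C0)// lerXn2r// nnegrE ?modulus_ge0.
have T2 : modulus ((f (t%:C * z + t%:C * h) - f (t%:C * z) - f' (t%:C * z) * (t%:C * h)) * (z + h)) <= C * modulus h ^+ 2.
  by rewrite modulusM; apply: le_trans T1; rewrite ler_piMr ?modulus_ge0// (le_trans zhr)// ltW.
have T3 : modulus (f' (t%:C * z) * (t%:C * (h * h))) <= B * modulus h ^+ 2.
  rewrite modulusM ler_pM ?modulus_ge0//; first by apply: HB; exact: scale (ltW zr).
  by rewrite mulrA modulusM expr2 ler_wpM2r.
apply: le_trans (lerD T2 T3) _.
rewrite -mulrDl expr2 mulrA.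
rewrite (_ : e * modulus h / 2 = e / 2 * modulus h); last by field.
rewrite ler_wpM2r// -(ler_pM2l (ltr0n _ 2))// mulrA ltW//.
by move: hK; rewrite mulrC /K (_ : 2 * (e / 2) = e)//; field.
Qed.

End analytic.

(** * Area integrals *)

Section plane_measurability.
Variable R : realType.
Implicit Types (E D : set R[i]) (F G : R[i] -> R) (f : R[i] -> R[i]) (z : R[i]).
Local Notation mR := (measurableTypeR R).
Local Notation cop := (@complex_of_pair R).

Definition cmeasurable E := measurable ((cop @^-1` E) : set (mR * mR)).
Definition cmeasurable_fun E F := measurable_fun ((cop @^-1` E) : set (mR * mR)) (F \o cop).

(** An open set is the countable union of the products of balls with rational centres and radius
    [1 / (n + 1)] that it contains. *)
Lemma open_measurable_pair (U : set (R * R)) : open U -> measurable (U : set (mR * mR)).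
Proof.
move=> oU.
pose B (q : rat * rat * nat) : set (mR * mR) :=
  ball (ratr q.1.1 : R) (q.2.+1%:R^-1) `*` ball (ratr q.1.2 : R) (q.2.+1%:R^-1).
have -> : U = \bigcup_(q in [set: rat * rat * nat])
    (if `[< B q `<=` U >] then B q else set0) :> set (mR * mR).
  apply/seteqP; split => [p Up|p [q _]]; last by case: ifPn => // /asboolP; apply.
  have [[V W] /= [Vp Wp] VW] := open_nbhs_nbhs (conj oU Up).
  have /nbhs_ballP[e /= e0 Ve] := Vp; have /nbhs_ballP[e' /= e'0 We] := Wp.
  pose m := Num.min e e'; have m0 : 0 < m by rewrite lt_min e0.
  have [n hn] : exists n : nat, n.+1%:R^-1 < m / 2.
    have m2 : 0 < m / 2 by rewrite divr_gt0.
    exists (Num.truncn (m / 2)^-1); rewrite invf_plt ?posrE//; exact: truncnS_gt.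
  have n0 : 0 < n.+1%:R^-1 :> R by rewrite invr_gt0.
  have dens (x : R) : exists q : rat, ball (ratr q : R) n.+1%:R^-1 x.
    move: n0; set d := _^-1 => n0.
    have /rat_in_itvoo[q] : x - d < x + d by lra.
    rewrite in_itv/= => hq; exists q; rewrite /ball/= ltr_norml; lra.
  have [q1 h1] := dens p.1; have [q2 h2] := dens p.2.
  exists (q1, q2, n) => //; rewrite ifT; first by split.
  apply/asboolP => r [/= r1 r2]; apply: VW; split => /=.
    apply: Ve; rewrite /ball/=; move: h1 r1; rewrite /ball/= => h1 r1.
    have : m <= e by rewrite ge_min lexx.
    move: n0 hn h1 r1; set d := _^-1 => n0 hn.
    rewrite distrC !ltr_norml => h1 r1 me; apply/andP; split; lra.
  apply: We; rewrite /ball/=; move: h2 r2; rewrite /ball/= => h2 r2.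
  have : m <= e' by rewrite ge_min lexx orbT.
  move: n0 hn h2 r2; set d := _^-1 => n0 hn.
  rewrite distrC !ltr_norml => h2 r2 me; apply/andP; split; lra.
apply: countable_bigcupT_measurable => [|q]; first exact: countableP.
case: ifPn => // _; apply: measurableX; apply: open_measurable; apply: ball_open; rewrite invr_gt0.
Qed.

Definition rcont F z := forall e : R, 0 < e -> exists2 del : R, 0 < del &
  forall h, modulus h < del -> `|F (z + h) - F z| < e.

Definition copen E := forall z, E z -> exists2 del : R, 0 < del &
  forall h, modulus h < del -> E (z + h).

Lemma copen_open E : copen E -> open (cop @^-1` E).
Proof.
move=> oE; rewrite openE => p /= /oE[del del0 H]; rewrite /interior.
exists (ball p.1 (del / 2), ball p.2 (del / 2)) => /=.
  by split; apply: nbhsx_ballx; rewrite divr_gt0.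
move=> q [/=]; rewrite /ball/= => q1 q2.
have -> : cop q = cop p + ((q.1 - p.1) +i* (q.2 - p.2)).
  by apply: complex_ext; rewrite ?(creD,cimD)/=; ring.
apply: H; rewrite (le_lt_trans (modulus_le_ReIm _))//= distrC (distrC q.2).
lra.
Qed.

Lemma copen_cmeasurable E : copen E -> cmeasurable E.
Proof. by move=> /copen_open; exact: open_measurable_pair. Qed.

Lemma rcont_cmeasurable_fun E F : copen E -> (forall z, E z -> rcont F z) ->
  cmeasurable_fun E F.
Proof.
move=> oE cF mE; apply: (measurability _ (RGenOInfty.measurableE R)) => //.
move=> _ [_ [x ->] <-]; apply: open_measurable_pair.
rewrite (_ : _ `&` _ = cop @^-1` [set z | E z /\ x < F z]); last first.
  by apply/seteqP; split => p /=; rewrite in_itv/= andbT.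
apply: copen_open => z [Ez xF]; have [d d0 hd] := oE z Ez.
have [|d' d'0 hd'] := cF z Ez (F z - x); first by rewrite subr_gt0.
exists (Num.min d d'); first by rewrite lt_min d0.
move=> h; rewrite lt_min => /andP[h1 h2]; split; first exact: hd.
have := hd' _ h2; rewrite ltr_norml; lra.
Qed.

Lemma copen_disc : copen (@unit_disc R).
Proof.
move=> z z1; exists (1 - modulus z); first by rewrite subr_gt0.
move=> h hz; rewrite /unit_disc/= (le_lt_trans (ler_modulusD _ _))//.
by rewrite addrC -ltrBrDr.
Qed.

Lemma cmeasurable_disc : cmeasurable (@unit_disc R).
Proof. exact: copen_cmeasurable copen_disc. Qed.

Lemma cmeasurable_funS E D F : cmeasurable D -> E `<=` D ->
  cmeasurable_fun D F -> cmeasurable_fun E F.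
Proof. by move=> mD ED; apply: measurable_funS => // p; exact: ED. Qed.

Lemma cmeasurable_fun_modulus f E : cmeasurable E -> E `<=` @unit_disc R ->
  analytic_on_disc f -> cmeasurable_fun E (fun z => modulus (f z)).
Proof.
move=> mE ED Af; apply: cmeasurable_funS ED _; first exact: cmeasurable_disc.
apply: rcont_cmeasurable_fun; first exact: copen_disc.
move=> z z1 e e0; have [d d0 hd] := analytic_ccont Af z1 e0.
by exists d => // h /hd; apply: le_lt_trans; exact: modulus_lip.
Qed.

Lemma cmeasurable_fun_id E : cmeasurable_fun E (@modulus R).
Proof.
apply: (@measurable_funS _ _ _ _ setT) => //.
apply: (@rcont_cmeasurable_fun setT) => [z _|z _ e e0]; first by exists 1.
exists e => // h he; rewrite (le_lt_trans (modulus_lip _ _))//.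
by rewrite addrC addKr.
Qed.

Lemma cmeasurable_fun_cst E (c : R) : cmeasurable_fun E (fun=> c).
Proof. exact: measurable_cst. Qed.

Lemma cmeasurable_funM E F G : cmeasurable_fun E F -> cmeasurable_fun E G ->
  cmeasurable_fun E (fun z => F z * G z).
Proof. exact: measurable_funM. Qed.

Lemma cmeasurable_funD E F G : cmeasurable_fun E F -> cmeasurable_fun E G ->
  cmeasurable_fun E (fun z => F z + G z).
Proof. exact: measurable_funD. Qed.

Lemma cmeasurable_funB E F G : cmeasurable_fun E F -> cmeasurable_fun E G ->
  cmeasurable_fun E (fun z => F z - G z).
Proof. exact: measurable_funB. Qed.

Lemma cmeasurable_funX E F n : cmeasurable_fun E F -> cmeasurable_fun E (fun z => F z ^+ n).
Proof. exact: measurable_funX. Qed.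

Lemma cmeasurable_fun_powR E F (a : R) : cmeasurable_fun E F ->
  cmeasurable_fun E (fun z => F z `^ a).
Proof. by move=> mF; apply: (measurableT_comp (measurable_powR _)). Qed.

Lemma cmeasurable_weight E (a : R) :
  cmeasurable_fun E (fun z => (1 - modulus z ^+ 2) `^ a).
Proof.
apply: cmeasurable_fun_powR; apply: cmeasurable_funB; first exact: cmeasurable_fun_cst.
by apply: cmeasurable_funX; exact: cmeasurable_fun_id.
Qed.

End plane_measurability.

Section area_integral_theory.
Variable R : realType.
Implicit Types (E D : set R[i]) (F G : R[i] -> R) (z : R[i]).
Local Notation cop := (@complex_of_pair R).
Local Notation mR := (measurableTypeR R).

Lemma area_integral_ge0 E F : (forall z, E z -> 0 <= F z) -> (0 <= area_integral E F)%E.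
Proof. by move=> F0; apply: integral_ge0 => p /F0; rewrite lee_fin. Qed.

Lemma cmeasurable_EFin E F : cmeasurable_fun E F ->
  measurable_fun ((cop @^-1` E) : set (mR * mR)) (fun p => (F (cop p))%:E).
Proof. by move=> mF; exact/measurable_EFinP. Qed.

Lemma le_area_integral E F G : cmeasurable E -> cmeasurable_fun E F ->
  cmeasurable_fun E G -> (forall z, E z -> 0 <= F z) -> (forall z, E z -> F z <= G z) ->
  (area_integral E F <= area_integral E G)%E.
Proof.
move=> mE mF mG F0 FG; apply: ge0_le_integral => //.
- by move=> p /F0; rewrite lee_fin.
- exact: cmeasurable_EFin.
- exact: cmeasurable_EFin.
- by move=> p /FG; rewrite lee_fin.
Qed.

Lemma eq_area_integral E F G : (forall z, E z -> F z = G z) ->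
  area_integral E F = area_integral E G.
Proof. by move=> FG; apply: eq_integral => p; rewrite inE => /FG ->. Qed.

Lemma area_integral_subset E D F : cmeasurable E -> cmeasurable D ->
  cmeasurable_fun D F -> (forall z, D z -> 0 <= F z) -> E `<=` D ->
  (area_integral E F <= area_integral D F)%E.
Proof.
move=> mE mD mF F0 ED; apply: ge0_subset_integral => //.
- exact: cmeasurable_EFin.
- by move=> p /F0; rewrite lee_fin.
- by move=> p /ED.
Qed.

Lemma area_integralZ E F c : cmeasurable E -> cmeasurable_fun E F ->
  (forall z, E z -> 0 <= F z) -> 0 <= c ->
  area_integral E (fun z => c * F z) = (c%:E * area_integral E F)%E.
Proof.
move=> mE mF F0 c0; rewrite /area_integral.
under eq_integral do rewrite EFinM.
apply: ge0_integralZl_EFin => //; first by move=> p /F0; rewrite lee_fin.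
exact: cmeasurable_EFin.
Qed.

Lemma area_integralD E F G : cmeasurable E -> cmeasurable_fun E F ->
  cmeasurable_fun E G -> (forall z, E z -> 0 <= F z) -> (forall z, E z -> 0 <= G z) ->
  area_integral E (fun z => F z + G z) = (area_integral E F + area_integral E G)%E.
Proof.
move=> mE mF mG F0 G0; rewrite /area_integral.
under eq_integral do rewrite EFinD.
apply: ge0_integralD => //.
- by move=> p /F0; rewrite lee_fin.
- exact: cmeasurable_EFin.
- by move=> p /G0; rewrite lee_fin.
- exact: cmeasurable_EFin.
Qed.

Lemma area_integral_cst E c : cmeasurable E -> area_integral E (fun=> c) = (c%:E * area E)%E.
Proof. by move=> mE; apply: integral_cst. Qed.

(** Bounded overlap: the sum of the integrals is the integral of [F] against the sum of the
    indicators, which is at most [N]. *)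
Lemma area_integral_overlap (I : Type) (s : seq I) (P : I -> set R[i]) D F (N : R) :
  cmeasurable D -> (forall i, cmeasurable (P i)) -> (forall i, P i `<=` D) ->
  cmeasurable_fun D F -> (forall z, D z -> 0 <= F z) ->
  (forall z, D z -> \sum_(i <- s) \1_(P i) z <= N) ->
  (\sum_(i <- s) area_integral (P i) F <= N%:E * area_integral D F)%E.
Proof.
move=> mD mP PD mF F0 HN.
have mI i : measurable_fun ((cop @^-1` D) : set (mR * mR)) (fun p => \1_(P i) (cop p) : R).
  have -> : (fun p => \1_(P i) (cop p)) = \1_(cop @^-1` (P i)) :> (_ -> R).
    by apply/funext => p; rewrite !indicE; congr (nat_of_bool _)%:R.
  by apply: measurable_indic; exact: mP.
have E i : area_integral (P i) F = area_integral D (fun z => \1_(P i) z * F z).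
  rewrite /area_integral [LHS]integral_mkcond [RHS]integral_mkcond.
  apply: eq_integral => p _; rewrite !patchE !indicE.
  have PE : (p \in cop @^-1` (P i)) = (cop p \in P i) by [].
  rewrite PE; have [h|h] := boolP (cop p \in P i); last by rewrite mul0r; case: ifP.
  have hD : p \in cop @^-1` D by apply/mem_set/(PD i)/set_mem.
  by rewrite hD mul1r.
have [[z0 Dz0]|D0] := pselect (exists z, D z); last first.
  have De : cop @^-1` D = set0 by apply/seteqP; split=> // p Dp; apply: D0; exists (cop p).
  rewrite big1 => [|i _]; first by rewrite /area_integral De integral_set0 mule0.
  by rewrite E /area_integral De integral_set0.
have N0 : 0 <= N.
  by apply: le_trans (HN _ Dz0); apply: sumr_ge0.
under eq_bigr do rewrite E.
apply: (@le_trans _ _ (area_integral D (fun z => N * F z))); last by rewrite area_integralZ.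
rewrite /area_integral -ge0_integral_sum//; last 2 first.
- move=> i; apply/measurable_EFinP; apply: measurable_funM => //; exact: mF.
- by move=> i p Dp; rewrite lee_fin mulr_ge0// F0.
apply: ge0_le_integral => //.
- by move=> p Dp; apply: sume_ge0 => i _; rewrite lee_fin mulr_ge0 ?F0.
- apply: emeasurable_sum => i; apply/measurable_EFinP; apply: measurable_funM => //; exact: mF.
- by apply/measurable_EFinP; apply: measurable_funM => //; exact: mF.
by move=> p Dp; rewrite sumEFin lee_fin -mulr_suml ler_wpM2r ?F0// HN.
Qed.

Lemma area_integral_bigcup_le (P : nat -> set R[i]) F (K : \bar R) :
  (forall i, cmeasurable (P i)) -> trivIset setT P ->
  cmeasurable_fun (\bigcup_i P i) F -> (forall z, (\bigcup_i P i) z -> 0 <= F z) ->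
  (forall M, \sum_(0 <= i < M) area_integral (P i) F <= K)%E ->
  (area_integral (\bigcup_i P i) F <= K)%E.
Proof.
move=> mP tP mF F0 HK.
have UE : cop @^-1` (\bigcup_i P i) = \bigcup_i (cop @^-1` (P i)) by rewrite preimage_bigcup.
rewrite /area_integral UE ge0_integral_bigcup//.
- apply: lime_le; last by near=> M; exact: HK.
  by apply: is_cvg_nneseries => n _ _; apply: area_integral_ge0 => z Pz; apply: F0; exists n.
- by rewrite -UE; exact: cmeasurable_EFin.
- by move=> p; rewrite -UE => /F0; rewrite lee_fin.
- apply/trivIsetP => i j _ _ ij; move/trivIsetP : tP => /(_ i j I I ij) h.
  by rewrite -preimage_setI h preimage_set0.
Unshelve. all: by end_near. Qed.

Definition crect (x0 x1 y0 y1 : R) : set R[i] :=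
  [set z | x0 <= complex.Re z <= x1 /\ y0 <= complex.Im z <= y1].

Lemma crectE x0 x1 y0 y1 :
  cop @^-1` (crect x0 x1 y0 y1) = `[x0, x1]%classic `*` `[y0, y1]%classic.
Proof. by apply/seteqP; split => p /=; rewrite !in_itv. Qed.

Lemma cmeasurable_crect x0 x1 y0 y1 : cmeasurable (crect x0 x1 y0 y1).
Proof. by rewrite /cmeasurable crectE; apply: measurableX; exact: measurable_itv. Qed.

Lemma area_crect x0 x1 y0 y1 : x0 <= x1 -> y0 <= y1 ->
  area (crect x0 x1 y0 y1) = (pi^-1 * ((x1 - x0) * (y1 - y0)))%:E.
Proof.
move=> x01 y01; rewrite /area crectE.
transitivity ((pi^-1)%:E * (lebesgue_measure \x lebesgue_measure)
  ((`[x0, x1]%classic : set mR) `*` (`[y0, y1]%classic : set mR)))%E; first by [].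
rewrite product_measure1E//.
have H (a b : R) : a <= b -> (if a < b then (b%:E - a%:E)%E else 0%E) = (b - a)%:E.
  move=> ab; case: ltP => // ba; have -> : a = b by apply/eqP; rewrite eq_le ab.
  by rewrite subrr.
have L (a b : R) : a <= b -> lebesgue_measure (`[a, b]%classic : set mR) = (b - a)%:E.
  by move=> ab; rewrite [LHS]lebesgue_measure_itv/= lte_fin H.
by rewrite !EFinM; congr (_ * (_ * _))%E; exact: L.
Qed.

End area_integral_theory.

(** * Translations and reflections of one-dimensional integrals *)

Section translation_invariance.
Variable R : realType.
Local Notation mR := (measurableTypeR R).
Local Notation mu := (@lebesgue_measure R).

Lemma lebesgue_itvcc (a b : R) : a <= b ->
  mu (`[a, b]%classic : set mR) = (b - a)%:E.
Proof.
move=> ab; rewrite [LHS]lebesgue_measure_itv/= lte_fin.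
case: ltP => // ba; have -> : a = b by apply/eqP; rewrite eq_le ab.
by rewrite subrr.
Qed.

Definition translate (a : R) (x : mR) : mR := a + x.

Lemma measurable_translate (a : R) : measurable_fun setT (translate a).
Proof. exact: measurable_funD. Qed.

HB.instance Definition _ (a : R) :=
  isMeasurableFun.Build _ _ mR mR (translate a) (measurable_translate a).

(** Both measures agree on half-open intervals, and Lebesgue measure is determined by its values
    there. *)
Lemma lebesgue_measure_translate (a : R) (A : set mR) : measurable A ->
  pushforward mu (translate a) A = mu A.
Proof.
move=> mA; apply/esym.
have := @lebesgue_measure_unique R (pushforward mu (translate a)) .
move=> /(_ (measurable_translate a)); apply => // _ [[b c] _ <-].
transitivity (mu (`]b - a, c - a]%classic : set mR)); last first.
  congr (mu _); apply/seteqP; split => x /=; rewrite /translate !in_itv/= => /andP[h1 h2]; apply/andP; split; lra.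
rewrite [LHS]lebesgue_measure_itv [RHS]lebesgue_measure_itv/= !lte_fin ltrD2r.
by case: ifP => // _; rewrite -!EFinD; congr EFin; lra.
Qed.

Lemma ge0_integral_translate (f : mR -> \bar R) (a : R) :
  measurable_fun setT f -> (forall x, (0 <= f x)%E) ->
  (\int[mu]_t f (a + t)%R = \int[mu]_x f x)%E.
Proof.
move=> mf f0.
have E1 := @ge0_integral_pushforward _ _ _ _ R _ (measurable_translate a) mu setT f
  measurableT mf (fun y _ => f0 y).
rewrite preimage_setT in E1; rewrite -[LHS]E1.
by apply: eq_measure_integral => A mA _; have H := lebesgue_measure_translate a mA; (exact: H || exact: esym H).
Qed.

Lemma ge0_integral_reflect (f : mR -> \bar R) (a : R) :
  measurable_fun setT f -> (forall x, (0 <= f x)%E) ->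
  (\int[mu]_t f (a - t)%R = \int[mu]_x f x)%E.
Proof.
move=> mf f0; rewrite -(ge0_integral_translate a mf f0).
have mg : measurable_fun setT (fun x : mR => f (a + x)).
  by apply: (measurableT_comp mf); exact: measurable_translate.
have mN : measurable_fun setT (-%R : mR -> mR) by exact: oppr_measurable.
have E1 := @ge0_integral_pushforward _ _ _ _ R _ mN mu setT _
  measurableT mg (fun y _ => f0 _).
rewrite preimage_setT in E1; rewrite -[LHS]E1.
by apply: eq_measure_integral => A mA _; have H := lebesgue_measureN mA; (exact: H || exact: esym H).
Qed.

Lemma le_integral_add4 (A : set mR) (K1 K2 K3 K4 : mR -> \bar R) : measurable A ->
  measurable_fun setT K1 -> measurable_fun setT K2 ->
  measurable_fun setT K3 -> measurable_fun setT K4 ->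
  (forall x, (0 <= K1 x)%E) -> (forall x, (0 <= K2 x)%E) ->
  (forall x, (0 <= K3 x)%E) -> (forall x, (0 <= K4 x)%E) ->
  (\int[mu]_(x in A) ((K1 x + K2 x) + (K3 x + K4 x)) <=
   (\int[mu]_x K1 x + \int[mu]_x K2 x) + (\int[mu]_x K3 x + \int[mu]_x K4 x))%E.
Proof.
move=> mA m1 m2 m3 m4 p1 p2 p3 p4.
have sub K : measurable_fun setT K -> (forall r, (0 <= K r)%E) ->
   (\int[mu]_(r in A) K r <= \int[mu]_r K r)%E.
  by move=> mK K0; apply: ge0_subset_integral.
have mS K : measurable_fun setT K -> measurable_fun A (K : mR -> \bar R).
  by move=> mK; exact: measurable_funTS.
rewrite (@ge0_integralD _ _ _ mu _ mA (fun x => K1 x + K2 x)%E (fun x => K3 x + K4 x)%E); last 4 first.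
- by move=> r _; rewrite adde_ge0.
- by apply: emeasurable_funD; exact: mS.
- by move=> r _; rewrite adde_ge0.
- by apply: emeasurable_funD; exact: mS.
rewrite (@ge0_integralD _ _ _ mu _ mA K1 K2)//; [|exact: mS|exact: mS].
rewrite (@ge0_integralD _ _ _ mu _ mA K3 K4)//; [|exact: mS|exact: mS].
by apply: leeD; apply: leeD; exact: sub.
Qed.

End translation_invariance.

(** * The submean value property on squares *)

Section submean.
Variable R : realType.
Implicit Types (f : R[i] -> R[i]) (z : R[i]) (s : R).
Local Notation mR := (measurableTypeR R).
Local Notation mu := (@lebesgue_measure R).
Local Notation cop := (@complex_of_pair R).

Definition csquare z s : set R[i] :=
  crect (complex.Re z - s) (complex.Re z + s) (complex.Im z - s) (complex.Im z + s).

Lemma csquare_modulus z s w : csquare z s w -> modulus (w - z) <= 2 * s.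
Proof.
case: z w => a b [x y] [/= h1 h2].
rewrite (le_trans (modulus_le_ReIm _))//=.
have : `|x - a| <= s by rewrite ler_norml; lra.
have : `|y - b| <= s by rewrite ler_norml; lra.
lra.
Qed.

Lemma csquare_in_disc z s : modulus z + 2 * s < 1 -> csquare z s `<=` @unit_disc R.
Proof.
move=> zs w /csquare_modulus h; rewrite /unit_disc/=.
by have := ler_modulusD z (w - z); rewrite subrKC; lra.
Qed.

Lemma cmeasurable_csquare z s : cmeasurable (csquare z s).
Proof. exact: cmeasurable_crect. Qed.

Lemma area_csquare z s : 0 <= s -> area (csquare z s) = (pi^-1 * (4 * s ^+ 2))%:E.
Proof.
move=> s0; rewrite area_crect; [|lra|lra].
by congr (_%:E); congr (_ * _); ring.
Qed.

(** Cauchy's formula on the square of half-side [r], with [1 / |w| <= 1 / s] on its sides and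
    [|sqW r| >= 4]. Fixing [s] while [r] varies prepares an average over [r]. *)
Lemma cauchy_sides f z s r : analytic_on_disc f -> 0 < s -> s <= r -> r <= 2 * s ->
  modulus z + 4 * s < 1 ->
  2 * s * modulus (f z) <=
   \int[mu]_(t in `[(- r), r]) modulus (f (z + (t +i* (- r)))) +
   \int[mu]_(t in `[(- r), r]) modulus (f (z + (t +i* r))) +
   (\int[mu]_(t in `[(- r), r]) modulus (f (z + ((- r) +i* t))) +
    \int[mu]_(t in `[(- r), r]) modulus (f (z + (r +i* t)))).
Proof.
move=> Af s0 sr rs zs.
have r0 : 0 < r by lra.
have zr : modulus z + 2 * r < 1 by lra.
have W := sqW_ge4 r0.
have H1 : 4 * modulus (f z) <= modulus (f z * sqW r).
  by rewrite modulusM mulrC ler_wpM2l ?modulus_ge0.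
have C w : on_square r w -> ccont (fun w => f (z + w)) w.
  move=> [w1 _ _]; apply/ccont_shift/analytic_ccont => //; exact: in_disc_sq w1.
have C' w : on_square r w -> ccont (fun w => f (z + w) * w^-1) w.
  by move=> rw; apply: ccontM (C _ rw) _; exact: ccont_inv (on_square_neq0 rw).
have [c1 c2 c3 c4] := sq_side_cts r0 C.
have [d1 d2 d3 d4] := sq_side_cts r0 C'.
have N w : on_square r w -> modulus (f (z + w) * w^-1) <= s^-1 * modulus (f (z + w)).
  move=> [_ w2 _]; rewrite modulusM modulusV mulrC ler_wpM2r ?modulus_ge0//.
  by rewrite lef_pV2 ?posrE//; lra.
have [Nh Nv] := square_sides r0 N.
have side (k k' : R -> R[i]) : cts_on (- r) r k -> cts_on (- r) r k' ->
    (forall t, - r <= t <= r -> modulus (k t) <= s^-1 * modulus (k' t)) ->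
    modulus (cint (- r) r k) <= 2 * s^-1 * \int[mu]_(t in `[(- r), r]) modulus (k' t).
  move=> ck ck' kk; apply: le_trans (modulus_cint_le ck) _.
  rewrite -mulrA ler_pM2l// -RintegralZl//; last exact: cts_integrable_modulus.
  apply: le_Rintegral => //; first exact: cts_integrable_modulus.
    have := @integrableZl _ _ _ mu _ (measurable_itv _) s^-1 _ (cts_integrable_modulus ck').
    exact.
have S1 := side _ _ d1 c1 (fun t ht => (Nh t ht).1).
have S2 := side _ _ d2 c2 (fun t ht => (Nh t ht).2).
have S3 := side _ _ d3 c3 (fun t ht => (Nv t ht).1).
have S4 := side _ _ d4 c4 (fun t ht => (Nv t ht).2).
have H2 : modulus (f z * sqW r) <= 2 * s^-1 * (
   \int[mu]_(t in `[(- r), r]) modulus (f (z + (t +i* (- r)))) +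
   \int[mu]_(t in `[(- r), r]) modulus (f (z + (t +i* r))) +
   (\int[mu]_(t in `[(- r), r]) modulus (f (z + ((- r) +i* t))) +
    \int[mu]_(t in `[(- r), r]) modulus (f (z + (r +i* t))))).
  rewrite (cauchy_formula Af r0 zr) !mulrDr.
  apply: le_trans (ler_modulusD _ _) _; apply: lerD.
    by apply: le_trans (ler_modulusB _ _) _; exact: lerD S1 S2.
  rewrite modulusM modulusi mul1r [leRHS]addrC.
  by apply: le_trans (ler_modulusB _ _) _; exact: lerD S4 S3.
have := le_trans H1 H2.
rewrite mulrAC ler_pdivlMr//.
rewrite -[in X in _ -> X](ler_pM2l (ltr0n R 2))//.
by rewrite (_ : 2 * (2 * s * modulus (f z)) = 4 * modulus (f z) * s)//; ring.
Qed.

(** [cauchy_sides] is integrated over [s <= r <= 2 s]. As [r] varies, each of the four sides sweeps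
    out part of the square of half-side [2 s], so by Tonelli it contributes at most the integral [I]
    of [|f|] over that square. Thus [2 s^2 |f z| <= 4 I]; the factor [pi] undoes the normalisation
    of the area. *)
Lemma submean_L1 f z s : analytic_on_disc f -> 0 < s -> modulus z + 4 * s < 1 ->
  ((s ^+ 2 * modulus (f z))%:E <=
   (2 * pi)%:E * area_integral (csquare z (2 * s)) (fun w => modulus (f w)))%E.
Proof.
move=> Af s0 zs; set a := complex.Re z; set b := complex.Im z.
have zE : z = a +i* b by rewrite -complexE.
pose Sq : set (mR * mR) := cop @^-1` (csquare z (2 * s)).
have mSq : measurable Sq by exact: cmeasurable_csquare.
have SqD : csquare z (2 * s) `<=` @unit_disc R by apply: csquare_in_disc; lra.
have mF : cmeasurable_fun (csquare z (2 * s)) (fun w => modulus (f w)).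
  by apply: cmeasurable_fun_modulus => //; exact: cmeasurable_csquare.
pose u : mR * mR -> \bar R := (fun p => (modulus (f (cop p)))%:E) \_ Sq.
have mu_ : measurable_fun setT u.
  exact: (measurable_restrictT _ mSq).1 (cmeasurable_EFin mF).
have u0 p : (0 <= u p)%E by apply: erestrict_ge0 => q _; rewrite lee_fin modulus_ge0.
pose I := (\int[(mu \x mu)%E]_p u p)%E.
have IE : (area_integral (csquare z (2 * s)) (fun w => modulus (f w)) = (pi^-1)%:E * I)%E.
  rewrite /area_integral /plane_area ge0_integral_mscale//.
  - by rewrite /I [in RHS]/u -integral_mkcond.
  - exact: (cmeasurable_EFin mF).
  - by move=> p _; rewrite lee_fin modulus_ge0.
(* Integrals over vertical and horizontal slices, of [|f|] extended by zero outside the square; they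
   dominate the side integrals, and each of [V] and [H] integrates to [I]. *)
pose V (x : mR) := (\int[mu]_y u (x, y))%E.
pose H (y : mR) := (\int[mu]_x u (x, y))%E.
have mV : measurable_fun setT V by exact: measurable_fun_fubini_tonelli_F.
have mH : measurable_fun setT H by exact: measurable_fun_fubini_tonelli_G.
have V0 x : (0 <= V x)%E by apply: integral_ge0.
have H0 x : (0 <= H x)%E by apply: integral_ge0.
have IV : (\int[mu]_x V x = I)%E by rewrite /I fubini_tonelli1.
have IH : (\int[mu]_x H x = I)%E by rewrite /I fubini_tonelli2.
have uE (x y : R) : `|x| <= 2 * s -> `|y| <= 2 * s -> u (a + x, b + y) = (modulus (f (z + (x +i* y))))%:E.
  rewrite !ler_norml => hx hy; rewrite /u patchE ifT.
    by congr ((modulus (f _))%:E); rewrite zE.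
  by rewrite inE /Sq/= /csquare /crect/= -/a -/b; split; lra.
have cts (k : R -> R[i]) r : (forall t, - r <= t <= r -> unit_disc (z + k t)) ->
   (forall t t', modulus (k t - k t') = `|t - t'|) -> cts_on (- r) r (fun t => f (z + k t)).
  move=> kD kk t tr e e0; have [d d0 hd] := analytic_ccont Af (kD t tr) e0.
  exists d => // t' t'r tt'.
  have -> : z + k t' = z + k t + (k t' - k t) by ring.
  by apply: hd; rewrite kk.
have kh (y t t' : R) : modulus (t +i* y - (t' +i* y)) = `|t - t'|.
  by rewrite -modulus_real; congr modulus; apply: complex_ext; rewrite ?(creD,creN,cimD,cimN)/=; ring.
have kv (y t t' : R) : modulus (y +i* t - (y +i* t')) = `|t - t'|.
  rewrite -modulus_real -[RHS]mul1r -(modulusi R) -modulusM; congr modulus.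
  by apply: complex_ext; rewrite ?(creD,creN,cimD,cimN,creM,cimM)/=; ring.
have inD (x y : R) : `|x| <= 2 * s -> `|y| <= 2 * s -> unit_disc (z + (x +i* y)).
  move=> hx hy; apply: SqD; rewrite /csquare /crect/= zE/= -/a -/b.
  by move: hx hy; rewrite !ler_norml; split; lra.
have RE (k : R -> R[i]) r : cts_on (- r) r (fun t => f (z + k t)) ->
   (\int[mu]_(t in `[(- r), r]) modulus (f (z + k t)))%:E =
    (\int[mu]_(t in `[(- r)%R, r]) (modulus (f (z + k t)%R))%:E)%E.
  move=> ck; rewrite /Rintegral fineK//; apply: integrable_fin_num => //.
  exact: (cts_integrable_modulus ck).
have sideV (r x : R) : 0 <= r <= 2 * s -> `|x| <= 2 * s ->
    ((\int[mu]_(t in `[(- r), r]) modulus (f (z + (x +i* t))))%R%:E <= V (a + x)%R)%E.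
  move=> rs xs.
  have tr t : - r <= t <= r -> `|t| <= 2 * s by move=> ht; rewrite ler_norml; lra.
  rewrite RE; last by apply: cts; [move=> t /tr; exact: inD|exact: kv].
  have muV : measurable_fun setT (fun y : mR => u (a + x, y)).
    by apply: (measurableT_comp mu_); exact: measurable_pair1.
  rewrite /V -(ge0_integral_translate b muV)//.
  apply: (@le_trans _ _ (\int[mu]_(t in `[(- r)%R, r]) u (a + x, b + t)%R)%E).
    rewrite le_eqVlt; apply/orP; left; apply/eqP; apply: eq_integral => t.
    by rewrite inE/= in_itv/= => /tr ts; rewrite uE.
  apply: ge0_subset_integral => //.
  by apply: (measurableT_comp muV); exact: measurable_translate.
have sideH (r y : R) : 0 <= r <= 2 * s -> `|y| <= 2 * s ->
    ((\int[mu]_(t in `[(- r), r]) modulus (f (z + (t +i* y))))%R%:E <= H (b + y)%R)%E.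
  move=> rs xs.
  have tr t : - r <= t <= r -> `|t| <= 2 * s by move=> ht; rewrite ler_norml; lra.
  rewrite RE; last by apply: cts; [move=> t /tr ht; exact: inD|exact: kh].
  have muH : measurable_fun setT (fun x : mR => u (x, b + y)).
    by apply: (measurableT_comp mu_); exact: measurable_pair2.
  rewrite /H -(ge0_integral_translate a muH)//.
  apply: (@le_trans _ _ (\int[mu]_(t in `[(- r)%R, r]) u (a + t, b + y)%R)%E).
    rewrite le_eqVlt; apply/orP; left; apply/eqP; apply: eq_integral => t.
    by rewrite inE/= in_itv/= => /tr ts; rewrite uE.
  apply: ge0_subset_integral => //.
  by apply: (measurableT_comp muH); exact: measurable_translate.
pose c := 2 * s * modulus (f z).
have key r : s <= r <= 2 * s ->
   (c%:E <= (H (b - r)%R + H (b + r)%R) + (V (a - r)%R + V (a + r)%R))%E.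
  move=> rs; have r0 : 0 <= r <= 2 * s by lra.
  have r1 : `|r| <= 2 * s by rewrite ger0_norm; lra.
  have r2 : `|- r| <= 2 * s by rewrite normrN.
  apply: le_trans (leeD (leeD (sideH r _ r0 r2) (sideH r _ r0 r1)) (leeD (sideV r _ r0 r2) (sideV r _ r0 r1))).
  by rewrite -!EFinD lee_fin /c; apply: cauchy_sides => //; lra.
have mVp : measurable_fun setT (fun r : mR => V (a + r)) by apply: (measurableT_comp mV); exact: measurable_translate.
have mHp : measurable_fun setT (fun r : mR => H (b + r)) by apply: (measurableT_comp mH); exact: measurable_translate.
have mVm : measurable_fun setT (fun r : mR => V (a - r)).
  exact: (measurableT_comp mVp (@oppr_measurable R setT)).
have mHm : measurable_fun setT (fun r : mR => H (b - r)).
  exact: (measurableT_comp mHp (@oppr_measurable R setT)).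
have E1 : ((c * s)%:E <= \int[mu]_(r in `[s, (2 * s)%R]) ((H (b - r)%R + H (b + r)%R) + (V (a - r)%R + V (a + r)%R)))%E.
  have -> : (c * s)%:E = (\int[mu]_(r in `[s, (2 * s)%R]) c%:E)%E.
    rewrite (@integral_cst _ _ _ mu _ (measurable_itv `[s, 2 * s]) c%:E).
    transitivity (c%:E * (2 * s - s)%:E)%E; first by rewrite -EFinM; congr EFin; ring.
    by congr (_ * _)%E; apply/esym/lebesgue_itvcc; lra.
  apply: ge0_le_integral => //.
  - by move=> r _; rewrite lee_fin /c !mulr_ge0 ?modulus_ge0// ltW.
  - apply: measurable_funTS; apply: emeasurable_funD; exact: emeasurable_funD.
have E2 : ((c * s)%:E <= (I + I) + (I + I))%E.
  apply: (le_trans E1); rewrite -{1 2}IH -{1 2}IV.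
  rewrite -{1}(ge0_integral_reflect b mH H0) -{1}(ge0_integral_translate b mH H0).
  rewrite -{1}(ge0_integral_reflect a mV V0) -{1}(ge0_integral_translate a mV V0).
  exact: le_integral_add4.
rewrite IE muleA -EFinM mulfK ?gt_eqF ?pi_gt0//.
have I0 : (0 <= I)%E by apply: integral_ge0.
move: E2; case: (I) I0 => [i i0 | _ _|//].
  rewrite -!EFinD -EFinM !lee_fin /c; move: (modulus (f z)) => y; nra.
by rewrite mulry gtr0_sg// mul1e leey.
Qed.

(** Since [|f|^2 = |f^2|] and [f^2] is analytic, the previous bound applies. *)
Lemma submean f z s : analytic_on_disc f -> 0 < s -> modulus z + 4 * s < 1 ->
  ((s ^+ 2 * modulus (f z) ^+ 2)%:E <=
   (2 * pi)%:E * area_integral (csquare z (2 * s)) (fun w => modulus (f w) ^+ 2)%R)%E.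
Proof.
move=> Af s0 zs; have := submean_L1 (analyticX (n:=2) Af) s0 zs.
by rewrite modulusX; under eq_area_integral do rewrite modulusX.
Qed.

End submean.

(** * Whitney boxes *)


Section polar.
Variable R : realType.
Implicit Types (s t u v : R) (z w : R[i]).

Lemma expiD s t : expi (s + t) = expi s * expi t.
Proof. by rewrite /expi cosD sinD; apply: complex_ext; rewrite ?(creM,cimM)/=; ring. Qed.

Lemma expi0 : expi (0 : R) = 1.
Proof. by rewrite /expi cos0 sin0. Qed.

Lemma modulus_expi t : modulus (expi t) = 1.
Proof.
apply/eqP; rewrite -(@eqrXn2 _ 2)// ?modulus_ge0//.
by rewrite sqr_modulus /= cos2Dsin2 expr1n.
Qed.

Lemma expi_neq0 t : expi t != 0.
Proof. by rewrite -modulus_gt0 modulus_expi. Qed.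

Lemma expiB s t : expi (s - t) = expi s / expi t.
Proof. by apply: (canRL (mulfK (expi_neq0 t))); rewrite -expiD subrK. Qed.

Lemma expiD2pi t : expi (t + 2 * pi) = expi t.
Proof. by rewrite /expi -[2 * pi]/(2%:R * pi) mulr_natl cosD2pi sinD2pi. Qed.

Lemma modulus_expiB1 u : modulus (expi u - 1) = 2 * `|sin (u / 2)|.
Proof.
apply/eqP; rewrite -(@eqrXn2 _ 2)// ?modulus_ge0 ?mulr_ge0//.
rewrite sqr_modulus creD cimD creN cimN/= subr0 exprMn real_normK ?num_real//.
have E : u / 2 *+ 2 = u by rewrite -mulr_natr divfK.
have c2 := cos_mulr2n (u / 2); have s2 := sin_mulr2n (u / 2); rewrite E in c2 s2.
rewrite c2 s2; have := cos2Dsin2 (u / 2).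
move: (cos (u / 2)) (sin (u / 2)) => c s cs.
have cE : c ^+ 2 = 1 - s ^+ 2 by rewrite -cs; ring.
apply/eqP; rewrite !mulr2n.
have -> : (c ^+ 2 + c ^+ 2 - 1 - 1) ^+ 2 + (c * s + c * s) ^+ 2 = 4 * c ^+ 2 * (c ^+ 2 + s ^+ 2) - 8 * c ^+ 2 + 4 by ring.
rewrite cs cE; ring.
Qed.

Lemma sin_le_id v : 0 <= v -> sin v <= v.
Proof.
rewrite le_eqVlt => /predU1P[<-|v0]; first by rewrite sin0.
have [c _] := @MVT R sin cos 0 v v0 (fun x _ => is_derive_sin x)
  (continuous_subspaceT (@continuous_sin R)).
by rewrite sin0 !subr0 => ->; rewrite ler_piMl ?cos_le1// ltW.
Qed.

Lemma normr_sin_le v : `|sin v| <= `|v|.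
Proof.
have [v0|v0] := leP 0 v.
  rewrite (ger0_norm v0) ler_norml sin_le_id// andbT.
  have [v1|v1] := leP v 1; last by have := sin_geN1 v; lra.
  have p2 := pi_ge2 R.
  have : 0 <= sin v by apply: sin_ge0_pi; lra.
  lra.
rewrite -normrN -sinN (ltr0_norm v0).
have nv : 0 <= - v by lra.
rewrite ler_norml sin_le_id// andbT.
have [v1|v1] := leP (- v) 1; last by have := sin_geN1 (- v); lra.
have p2 := pi_ge2 R.
have : 0 <= sin (- v) by apply: sin_ge0_pi; lra.
lra.
Qed.

Lemma modulus_expiB s t : modulus (expi s - expi t) <= `|s - t|.
Proof.
have -> : expi s - expi t = expi t * (expi (s - t) - 1).
  by rewrite mulrBr -expiD mulr1 subrKC.
rewrite modulusM modulus_expi mul1r modulus_expiB1.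
have := normr_sin_le ((s - t) / 2); rewrite normrM [in X in _ <= _ * X]ger0_norm ?invr_ge0//.
lra.
Qed.

(* [sin v = 2 sin (v/2) cos (v/2)], where [sin (v/2) = (v/2) cos c] and both
   cosines are at least [1/sqrt 2]. *)
Lemma sin_ge_half v : 0 <= v <= pi / 2 -> v / 2 <= sin v.
Proof.
move=> /andP[]; rewrite le_eqVlt => /predU1P[<-|v0] vp; first by rewrite sin0 mul0r.
have h0 : 0 < v / 2 by lra.
have [c] := @MVT R sin cos 0 (v / 2) h0 (fun x _ => is_derive_sin x)
  (continuous_subspaceT (@continuous_sin R)).
rewrite in_itv/= sin0 !subr0 => cv sE.
have C x : 0 <= x <= v / 2 -> 0 <= cos x /\ 2^-1 <= cos x ^+ 2.
  move=> hx; split; first by apply: cos_ge0_pihalf; lra.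
  have xx : - (pi / 2) <= x + x <= pi / 2 by lra.
  by have := cos_ge0_pihalf xx; rewrite -mulr2n cos_mulr2n mulr2n; lra.
have [] : 0 <= c <= v / 2 /\ 0 <= v / 2 <= v / 2 by split; lra.
move=> /C[c0 c2] /C[d0 d2].
have -> : sin v = sin (v / 2 *+ 2) by rewrite -mulr_natr divfK.
rewrite sin_mulr2n sE.
have K : 2^-1 <= cos (v / 2) * cos c.
  rewrite -(@ler_pXn2r _ 2)// ?nnegrE ?mulr_ge0 ?invr_ge0//.
  rewrite exprMn expr2; apply: ler_pM => //; by rewrite invr_ge0.
have -> : (cos (v / 2) * (cos c * (v / 2))) *+ 2 = (cos (v / 2) * cos c) * v by rewrite -mulr_natr; field.
have := ler_wpM2r (ltW v0) K; move: (cos (v / 2) * cos c * v) => x; lra.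
Qed.

Lemma chord_ge u : `|u| <= pi -> `|u| <= 2 * modulus (expi u - 1).
Proof.
move=> up; rewrite modulus_expiB1.
have -> : `|sin (u / 2)| = `|sin (`|u| / 2)|.
  case: (leP 0 u) => u0; first by rewrite (ger0_norm u0).
  by rewrite (ltr0_norm u0) mulNr sinN normrN.
have := @sin_ge_half (`|u| / 2); have := normr_ge0 u; move: (`|u|) up => x xp x0.
have -> : (0 <= x / 2 <= pi / 2) = true by lra.
move=> /(_ isT) h; have := ler_norm (sin (x / 2)); lra.
Qed.

Lemma expi_inj s t : 0 <= s < 2 * pi -> 0 <= t < 2 * pi -> expi s = expi t -> s = t.
Proof.
move=> hs ht st; have : modulus (expi (s - t) - 1) = 0.
  by rewrite expiB st divff ?expi_neq0// subrr modulus0.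
rewrite modulus_expiB1 => /eqP; rewrite mulf_eq0 pnatr_eq0/= normr_eq0 => /eqP h.
apply/eqP; rewrite -subr_eq0; apply/eqP.
have [d|d|//] := ltgtP (s - t) 0.
  have : 0 < sin (- ((s - t) / 2)) by apply: sin_gt0_pi; lra.
  by rewrite sinN h oppr0 ltxx.
have : 0 < sin ((s - t) / 2) by apply: sin_gt0_pi; lra.
by rewrite h ltxx.
Qed.

Lemma polar z : exists2 t, 0 <= t < 2 * pi & z = (modulus z)%:C * expi t.
Proof.
have p0 := pi_gt0 R.
have [->|z0] := eqVneq z 0.
  by exists 0; [lra|rewrite modulus0 mul0r].
have m0 : 0 < modulus z by rewrite modulus_gt0.
pose x := complex.Re z / modulus z; pose y := complex.Im z / modulus z.
have xy : x ^+ 2 + y ^+ 2 = 1.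
  by rewrite /x /y !exprMn -mulrDl -sqr_modulus exprVn mulfV// expf_neq0// gt_eqF.
have x1 : -1 <= x <= 1.
  by rewrite -ler_norml -(@ler_pXn2r _ 2)// ?nnegrE// expr1n real_normK ?num_real//; have := sqr_ge0 y; lra.
have zE : z = (modulus z)%:C * (x +i* y).
  by apply: complex_ext; rewrite ?(creM,cimM)/= /x /y; field; rewrite gt_eqF.
have yE : `|y| = Num.sqrt (1 - x ^+ 2) by rewrite -xy addrAC subrr add0r sqrtr_sqr.
have a0 := acos_ge0 x1; have a1 := acos_lepi x1.
have ca : cos (acos x) = x by apply: acosK; rewrite in_itv.
have [y0|y0] := leP 0 y.
  exists (acos x); first lra.
  by rewrite {1}zE /expi ca sin_acos// -yE ger0_norm.
exists (2 * pi - acos x).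
  suff : acos x != 0 by move: a0; rewrite le_eqVlt eq_sym => /orP[->//|a0 _]; lra.
  apply/eqP => ax; move: yE; rewrite -sin_acos// ax sin0 => /normr0_eq0 yz.
  by rewrite yz ltxx in y0.
rewrite {1}zE; congr (_ * _); rewrite /expi.
have -> : 2 * pi - acos x = - acos x + pi *+ 2 by rewrite mulr2n; ring.
by rewrite cosD2pi sinD2pi cosN sinN ca sin_acos// -yE ltr0_norm// opprK.
Qed.

End polar.

Section boxes.
Variable R : realType.
Implicit Types (n k : nat) (z w : R[i]) (t : R).

Definition rr n : R := (2 ^+ n)^-1.

Lemma rr_gt0 n : 0 < rr n. Proof. by rewrite invr_gt0 exprn_gt0. Qed.
Lemma rr_ge0 n : 0 <= rr n. Proof. exact/ltW/rr_gt0. Qed.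
Lemma rrS n : rr n = 2 * rr n.+1.
Proof. by rewrite /rr exprS invfM mulrA mulfV// mul1r. Qed.
Lemma rr0 : rr 0 = 1. Proof. by rewrite /rr expr0 invr1. Qed.
Lemma rr_le1 n : rr n <= 1.
Proof. by rewrite /rr invf_le1 ?exprn_gt0// exprn_ege1// ler1n. Qed.
Lemma rr_le m n : (m <= n)%N -> rr n <= rr m.
Proof. by move=> mn; rewrite /rr lef_pV2 ?posrE ?exprn_gt0// ler_eXn2l// ltr1n. Qed.
Lemma rr_nat n : rr n * 2 ^+ n = 1. Proof. by rewrite mulVf// expf_neq0. Qed.

(** At level 0 the only index is [k = 0], and the box is the disc of radius 1/2. *)
Definition box n k : set R[i] := [set z | rr n.+1 < 1 - modulus z <= rr n /\
  exists2 t, 2 * pi * k%:R * rr n <= t < 2 * pi * k.+1%:R * rr n & z = (modulus z)%:C * expi t].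

(** A corner of the box, at its smallest modulus and smallest angle. It serves as reference point;
    [boxm] is the midpoint. *)
Definition boxc n k : R[i] := (1 - rr n)%:C * expi (2 * pi * k%:R * rr n).

Lemma box_disc n k : box n k `<=` @unit_disc R.
Proof. by move=> z [h _]; rewrite /unit_disc/=; have := rr_gt0 n.+1; lra. Qed.

(** At most [rr n] radially, and at most [2 pi rr n <= 8 rr n] along the arc. *)
Lemma box_dist n k z : box n k z -> modulus (z - boxc n k) <= 9 * rr n.
Proof.
move=> [h [t ht zE]]; have r0 := rr_gt0 n; have r1 := rr_le1 n; have rS := rrS n.
rewrite {1}zE /boxc.
set th := 2 * pi * k%:R * rr n; set m := modulus z.
have -> : m%:C * expi t - (1 - rr n)%:C * expi th =
   (m - (1 - rr n))%:C * expi t + (1 - rr n)%:C * (expi t - expi th).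
  by rewrite rmorphB/=; ring.
rewrite (le_trans (ler_modulusD _ _))// !modulusM !modulus_real modulus_expi mulr1.
have h1 : `|m - (1 - rr n)| <= rr n by rewrite ler_norml /m; lra.
have h2 : modulus (expi t - expi th) <= 8 * rr n.
  rewrite (le_trans (modulus_expiB _ _))//.
  have : 2 * pi * k.+1%:R * rr n = th + 2 * pi * rr n by rewrite /th -natr1; ring.
  have := pihalf_lt2 R => p2 hk; rewrite hk in ht.
  have : 2 * pi * rr n <= 8 * rr n by rewrite ler_pM2r//; lra.
  rewrite ler_norml; lra.
have h3 : `|1 - rr n| * modulus (expi t - expi th) <= modulus (expi t - expi th).
  by rewrite ler_piMl ?modulus_ge0// ler_norml; lra.
lra.
Qed.

Lemma box_disjoint n k n' k' z : (k < 2 ^ n)%N -> (k' < 2 ^ n')%N ->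
  box n k z -> box n' k' z -> n = n' /\ k = k'.
Proof.
move=> kn kn' [h [t ht zE]] [h' [t' ht' zE']].
have nn' : n = n'.
  apply/eqP; rewrite eqn_leq; apply/andP; split; rewrite leqNgt; apply/negP => lt.
    by have := rr_le lt; lra.
  by have := rr_le lt; lra.
split=> //; subst n'.
have range m s : (m < 2 ^ n)%N -> 2 * pi * m%:R * rr n <= s < 2 * pi * m.+1%:R * rr n ->
    0 <= s < 2 * pi.
  move=> mn hs; have p0 := pi_gt0 R.
  have : 0 <= 2 * pi * m%:R * rr n by rewrite !mulr_ge0// ?(ltW p0)// rr_ge0.
  have : 2 * pi * m.+1%:R * rr n <= 2 * pi.
    rewrite -mulrA ler_piMr ?mulr_ge0 ?(ltW p0)//.
    by rewrite /rr ler_pdivrMr ?exprn_gt0// mul1r -natrX ler_nat.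
  lra.
(* Level 0 is separate because its box contains 0, which has no well-defined angle; there both
   indices are 0. *)
case: n => [|n] in kn kn' h ht h' ht' range *.
  by move: kn kn'; rewrite expn0 !ltnS !leqn0 => /eqP -> /eqP ->.
have z0 : (modulus z)%:C != 0 :> R[i].
  rewrite -[0]/(0%:C) (inj_eq (@complexI R)) gt_eqF//.
  by have := rrS 0; have := rr_le (ltn0Sn n); rewrite rr0; have := h; lra.
have tt' : t = t'.
  apply: expi_inj; [exact: range kn ht|exact: range kn' ht'|].
  by apply: (mulfI z0); rewrite -zE -zE'.
subst t'; have p0 : 0 < 2 * pi * rr n.+1 by rewrite !mulr_gt0// ?pi_gt0// rr_gt0.
have cmp a b : 2 * pi * a%:R * rr n.+1 <= t -> t < 2 * pi * b.+1%:R * rr n.+1 -> (a <= b)%N.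
  move=> ha hb; have : 2 * pi * a%:R * rr n.+1 < 2 * pi * b.+1%:R * rr n.+1 by lra.
  have E m : 2 * pi * m%:R * rr n.+1 = 2 * pi * rr n.+1 * m%:R by ring.
  by rewrite (E a) (E b.+1) ltr_pM2l// ltr_nat ltnS.
case/andP: ht => a1 a2; case/andP: ht' => b1 b2.
by apply/eqP; rewrite eqn_leq (cmp k k')// (cmp k' k).
Qed.

Lemma rr_level (x : R) : 0 < x <= 1 -> exists n, rr n.+1 < x <= rr n.
Proof.
move=> /andP[x0 x1].
have [n hn] : exists n, rr n < x.
  have [N _ /(_ N (leqnn _)) hN] := near_infty_natSinv_expn_lt (PosNum x0).
  by exists N; rewrite /rr -div1r.
have ex : exists n, rr n < x by exists n.
case: (ex_minnP ex) => -[|m] hm mmin; first by move: hm; rewrite rr0; lra.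
exists m; rewrite hm/= leNgt; apply/negP => /mmin; by rewrite ltnn.
Qed.

Lemma box_angle n t : 0 <= t < 2 * pi -> exists2 k, (k < 2 ^ n)%N &
  2 * pi * k%:R * rr n <= t < 2 * pi * k.+1%:R * rr n.
Proof.
move=> ht; have p0 : 0 < 2 * pi :> R by rewrite mulr_gt0// pi_gt0.
have q0 : 0 < 2 * pi * rr n by rewrite mulr_gt0// rr_gt0.
have t0 : 0 <= t / (2 * pi * rr n) by rewrite divr_ge0 ?(ltW q0)//; lra.
have /andP[h1 h2] := truncn_itv t0.
move: h1 h2; rewrite ler_pdivlMr// ltr_pdivrMr//; set k := Num.truncn _ => h1 h2.
exists k; last by rewrite ![2 * pi * _ * rr n]mulrAC mulrC h1 mulrC h2.
rewrite -(ltr_nat R) natrX -(ltr_pM2r q0) (le_lt_trans h1)//.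
have -> : 2 ^+ n * (2 * pi * rr n) = 2 * pi * (rr n * 2 ^+ n) by ring.
by rewrite rr_nat mulr1; case/andP: ht.
Qed.

Lemma box_cover z : unit_disc z -> exists n k, (k < 2 ^ n)%N /\ box n k z.
Proof.
move=> z1; have [|n hn] := @rr_level (1 - modulus z).
  by rewrite subr_gt0 z1/= gerBl modulus_ge0.
have [t ht zE] := polar z; have [k kn hk] := box_angle n ht.
by exists n, k; split=> //; split=> //; exists t.
Qed.

(** The midpoint in polar coordinates: in the box [1 - |z|] runs over [(rr n / 2, rr n]]. *)
Definition boxm n k : R[i] := (1 - 3 / 4 * rr n)%:C * expi (2 * pi * (k%:R + 2^-1) * rr n).

(** The modulus moves by at most [rr n / 8], less than half the radial thickness. For [n >= 1],
    where [|w| >= 1/2], the chord is at most [rr n / 2], so the angle moves by at most [rr n], less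
    than half the angular width [2 pi rr n]. *)
Lemma box_contains n k w : (k < 2 ^ n)%N -> modulus (w - boxm n k) <= rr n / 8 -> box n k w.
Proof.
move=> kn hw; have r0 := rr_gt0 n; have r1 := rr_le1 n; have rS := rrS n.
have p0 := pi_gt0 R; have p2 := pi_ge2 R.
set rho := 1 - 3 / 4 * rr n; set tau := 2 * pi * (k%:R + 2^-1) * rr n.
have mm : modulus (boxm n k) = rho.
  by rewrite modulusM modulus_real modulus_expi mulr1 ger0_norm// /rho; lra.
have mw : `|modulus w - rho| <= rr n / 8 by rewrite -mm (le_trans (modulus_lip _ _)).
have lev : rr n.+1 < 1 - modulus w <= rr n.
  by move: mw; rewrite ler_norml /rho; lra.
split=> //.
have [t ht wE] := polar w.
case: n => [|n] in kn hw r0 r1 rS rho tau mm mw lev *.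
  exists t => //; move: kn; rewrite expn0 ltnS leqn0 => /eqP ->.
  by rewrite rr0; lra.
have rn : rr n.+1 <= 2^-1 by have := rrS n; have := rr_le1 n; lra.
have tau0 : 0 <= tau <= 2 * pi.
  have : 0 <= tau by rewrite /tau !mulr_ge0// ?(ltW p0)// ?rr_ge0// addr_ge0.
  suff : tau <= 2 * pi by lra.
  rewrite /tau -mulrA ler_piMr ?mulr_ge0 ?(ltW p0)//.
  rewrite /rr ler_pdivrMr ?exprn_gt0// mul1r -natrX.
  have : k.+1%:R <= (2 ^ n.+1)%:R :> R by rewrite ler_nat.
  by rewrite -natr1; lra.
(* a representative of the angle within [pi] of [tau] *)
have [u [uE ut]] : exists u, expi u = expi t /\ `|u - tau| <= pi.
  have [h|h] := leP (t - tau) (- pi).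
    by exists (t + 2 * pi); rewrite expiD2pi; split=> //; rewrite ler_norml; lra.
  have [h'|h'] := leP pi (t - tau).
    exists (t - 2 * pi); rewrite -[in RHS](subrK (2 * pi) t) expiD2pi; split=> //.
    by rewrite ler_norml; lra.
  by exists t; split=> //; rewrite ler_norml; lra.
have ch := chord_ge ut.
have m2 : 2^-1 <= modulus w by move: mw; rewrite ler_norml /rho; lra.
have ch2 : modulus w * modulus (expi (u - tau) - 1) <= rr n.+1 / 4.
  have -> : modulus w * modulus (expi (u - tau) - 1) = modulus ((modulus w)%:C * (expi u - expi tau)).
    rewrite modulusM modulus_real ger0_norm ?modulus_ge0//; congr (_ * _).
    have -> : expi u - expi tau = expi tau * (expi (u - tau) - 1).
      by rewrite mulrBr -expiD mulr1 subrKC.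
    by rewrite modulusM modulus_expi mul1r.
  have -> : (modulus w)%:C * (expi u - expi tau) = (w - boxm n.+1 k) + (rho - modulus w)%:C * expi tau.
    rewrite [X in X - boxm _ _]wE uE (rmorphB (real_complex R) rho (modulus w)) /boxm -/rho -/tau.
    clear -tau rho; move: rho tau => rho tau; ring.
  rewrite (le_trans (ler_modulusD _ _))// modulusM modulus_real modulus_expi mulr1 distrC; lra.
have ch3 : 2^-1 * modulus (expi (u - tau) - 1) <= rr n.+1 / 4.
  by apply: le_trans ch2; rewrite ler_wpM2r ?modulus_ge0.
have d : `|u - tau| <= rr n.+1 by lra.
have pr : rr n.+1 * 2 <= pi * rr n.+1 by rewrite mulrC ler_pM2r.
exists u; last by rewrite uE.
move: d; rewrite ler_norml -[k.+1%:R]natr1.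
have -> : tau = 2 * pi * k%:R * rr n.+1 + pi * rr n.+1 by rewrite /tau; field.
have -> : 2 * pi * (k%:R + 1) * rr n.+1 = 2 * pi * k%:R * rr n.+1 + 2 * (pi * rr n.+1) by ring.
lra.
Qed.

Lemma csquare_boxm n k : (k < 2 ^ n)%N -> csquare (boxm n k) (rr n / 16) `<=` box n k.
Proof. by move=> kn w /csquare_modulus h; apply: box_contains => //; lra. Qed.

Lemma box_csquare n k : box n k `<=` csquare (boxc n k) (9 * rr n).
Proof.
move=> w /box_dist; rewrite /csquare /crect; move: (boxc n k) => c h /=.
have := le_trans (normr_Re_le _) h; have := le_trans (normr_Im_le _) h.
by rewrite creD creN cimD cimN !ler_norml; split; lra.
Qed.

(** A closed sector is the image of the compact rectangle [[0, 1] x [a, b]] under polar coordinates,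
    hence closed. *)
Lemma cmeasurable_cone (a b : R) : a <= b ->
  cmeasurable [set z : R[i] | modulus z <= 1 /\ exists2 t, a <= t <= b & z = (modulus z)%:C * expi t].
Proof.
move=> ab; pose K : set (R * R) := `[0, 1]%classic `*` `[a, b]%classic.
pose phi (p : R * R) : R * R := (p.1 * cos p.2, p.1 * sin p.2).
have cphi : continuous phi.
  have c1 (h : R -> R) : continuous h -> continuous (fun p : R * R => p.1 * h p.2).
    move=> ch p; apply: cvgM; first exact: cvg_fst.
    by apply: (cvg_comp _ _ cvg_snd); exact: ch.
  move=> p; have := cvg_pair (c1 _ (@continuous_cos R) p) (c1 _ (@continuous_sin R) p); exact.
have cK : compact (phi @` K).
  apply: continuous_compact; first exact: continuous_subspaceT.
  by apply: compact_setX; exact: segment_compact.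
have clK : closed (phi @` K).
  by apply: compact_closed cK; exact: norm_hausdorff.
rewrite /cmeasurable.
have -> : @complex_of_pair R @^-1` [set z : R[i] | modulus z <= 1 /\ exists2 t, a <= t <= b & z = (modulus z)%:C * expi t] = phi @` K.
  apply/seteqP; split => p /=.
    move=> [p1 [t tab pE]]; exists (modulus (complex_of_pair p), t).
      by rewrite /K/= !in_itv/= modulus_ge0 p1 tab.
    move: (modulus _) pE => m pE; rewrite [RHS]surjective_pairing.
    have := congr1 (@complex.Re R) pE; have := congr1 (@complex.Im R) pE.
    by rewrite creM cimM/= !mul0r subr0 addr0 => -> ->.
  move=> [[r s]] [/=]; rewrite !in_itv/= => r01 sab <-.
  have E : complex_of_pair (phi (r, s)) = r%:C * expi s.
    by apply: complex_ext; rewrite ?(creM,cimM)/=; ring.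
  have M : modulus (complex_of_pair (phi (r, s))) = r.
    by rewrite E modulusM modulus_real modulus_expi mulr1 ger0_norm//; lra.
  by rewrite M; split; [lra|exists s].
rewrite -[phi @` K]setCK; apply: measurableC; apply: open_measurable_pair.
exact: closed_openC.
Qed.

(** The angular interval is half-open, so the box is an annulus intersected with a countable union
    of closed sectors exhausting that interval. *)
Lemma cmeasurable_box n k : cmeasurable (box n k).
Proof.
set a := 2 * pi * k%:R * rr n; set b := 2 * pi * k.+1%:R * rr n.
have ab : a < b.
  by rewrite /a /b ltr_pM2r ?rr_gt0// ltr_pM2l ?mulr_gt0 ?pi_gt0// ltr_nat.
pose S (j : nat) := [set z : R[i] | modulus z <= 1 /\
  exists2 t, a <= t <= b - (b - a) / j.+1%:R & z = (modulus z)%:C * expi t].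
have -> : box n k = [set z | rr n.+1 < 1 - modulus z <= rr n] `&` \bigcup_j S j.
  apply/seteqP; split => z.
    move=> [h [t ht zE]]; split=> //.
    rewrite -/a -/b in ht.
    have bt : 0 < (b - t) / (b - a) by rewrite divr_gt0//; lra.
    have [j hj] : exists j : nat, j.+1%:R^-1 < (b - t) / (b - a).
      by exists (Num.truncn ((b - t) / (b - a))^-1); rewrite invf_plt ?posrE//; exact: truncnS_gt.
    exists j => //; split; first by have := rr_gt0 n.+1; lra.
    exists t => //; move: hj; rewrite ltr_pdivlMr; last lra.
    by rewrite mulrC; case/andP: ht => -> _ /= hd; rewrite lerBrDr -lerBrDl ltW.
  move=> [hl [j _ [_ [t ht zE]]]]; split=> //; exists t => //.
  have j0 : 0 < (b - a) / j.+1%:R by rewrite divr_gt0//; lra.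
  by case/andP: ht => -> h2 /=; rewrite (le_lt_trans h2)// gtrBl.
rewrite /cmeasurable preimage_setI; apply: measurableI; last first.
  rewrite preimage_bigcup; apply: bigcupT_measurable => j.
  have [h|h] := leP a (b - (b - a) / j.+1%:R); first exact: cmeasurable_cone.
  rewrite [X in measurable X](_ : _ = set0)//.
  apply/seteqP; split=> // p [_ [t ht _]].
  by case/andP: ht => h1 h2; have := lt_le_trans h (le_trans h1 h2); rewrite ltxx.
have -> : @complex_of_pair R @^-1` [set z | rr n.+1 < 1 - modulus z <= rr n] =
   setT `&` ((fun p => 1 - modulus (complex_of_pair p)) @^-1` `]rr n.+1, rr n]).
  by apply/seteqP; split => p /=; rewrite in_itv/=; [split|case].
have : cmeasurable_fun setT (fun z : R[i] => 1 - modulus z).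
  by apply: cmeasurable_funB; [exact: cmeasurable_fun_cst|exact: cmeasurable_fun_id].
by apply; [exact: measurableT|exact: measurable_itv].
Qed.

End boxes.

(** * Finite families of boxes and bounded overlap *)

Section finite_sums.
Variables (R : realType) (T : eqType).
Implicit Types (s t : seq T) (F : T -> R).

Lemma sum_sub_le s t F : uniq s -> {subset s <= t} -> (forall x, 0 <= F x) ->
  \sum_(x <- s) F x <= \sum_(x <- t) F x.
Proof.
elim: s t => [|x s IH] t; first by move=> _ _ F0; rewrite big_nil; apply: sumr_ge0.
move=> /= /andP[xs us] st F0; have xt : x \in t by apply: st; rewrite mem_head.
rewrite big_cons (big_rem x xt)/= lerD2l IH// => y ys.
have yx : y != x by apply: contraNneq xs => <-.
have := st y; rewrite inE ys orbT => /(_ isT).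
by have /perm_mem -> := perm_to_rem xt; rewrite inE (negbTE yx).
Qed.

Lemma sum_indic (S : Type) (P : T -> set S) s (z : S) :
  \sum_(x <- s) \1_(P x) z = (size [seq x <- s | z \in P x])%:R :> R.
Proof.
elim: s => [|x s IH]; first by rewrite big_nil.
rewrite big_cons IH /= indicE -natrD.
by congr (_%:R); case: (z \in P x).
Qed.

Lemma sum_indic_le1 (S : Type) (P : T -> set S) s (z : S) : uniq s ->
  (forall x y, x \in s -> y \in s -> P x z -> P y z -> x = y) ->
  \sum_(x <- s) \1_(P x) z <= 1 :> R.
Proof.
move=> us H; rewrite sum_indic -[1]/(1%:R) ler_nat.
have : uniq [seq x <- s | z \in P x] by rewrite filter_uniq.
have : {in [seq x <- s | z \in P x] &, forall x y, x = y}.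
  move=> x y; rewrite !mem_filter => /andP[/set_mem Px xs] /andP[/set_mem Py ys].
  exact: H.
case: [seq x <- s | _] => [|x [|y t]]// /(_ x y); rewrite !inE !eqxx orbT => /(_ isT isT) ->.
by rewrite /= inE eqxx.
Qed.

End finite_sums.

Section box_families.
Variable R : realType.
Implicit Types (n k : nat) (q : nat * nat) (s : seq (nat * nat)) (z w : R[i]) (d r x b : R)
  (f : R[i] -> R[i]).

Definition valid q := (q.2 < 2 ^ q.1)%N.

Definition levels (M : nat) : seq (nat * nat) :=
  [seq (n, k) | n <- iota 0 M, k <- iota 0 (2 ^ n)].

Lemma big_levels (M : nat) (F : nat * nat -> R) :
  \sum_(q <- levels M) F q = \sum_(0 <= n < M) \sum_(0 <= k < 2 ^ n) F (n, k).
Proof.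
by rewrite big_allpairs_dep /index_iota subn0; apply: eq_bigr => n _; rewrite subn0.
Qed.

Lemma mem_levels M q : valid q -> (q.1 < M)%N -> q \in levels M.
Proof.
case: q => n k /= kn nM; apply/allpairsPdep; exists n, k.
by rewrite !mem_iota.
Qed.

(** Any finite family of boxes fits into the first [M] full levels, where sums can be computed level
    by level. *)
Lemma sum_levels_le s (F : nat * nat -> R) : uniq s -> all valid s -> (forall q, 0 <= F q) ->
  exists M, \sum_(q <- s) F q <= \sum_(0 <= n < M) \sum_(0 <= k < 2 ^ n) F (n, k).
Proof.
move=> us vs F0; exists (\max_(q <- s) q.1).+1; rewrite -big_levels.
apply: sum_sub_le => // q qs; apply: mem_levels; first exact: (allP vs).
by rewrite ltnS; exact: (leq_bigmax_seq (F := fun q : nat * nat => q.1)).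
Qed.

(** Countable additivity over the boxes, enumerated by the coding of pairs of naturals. All global
    estimates are obtained this way from bounds on finite sums of boxes. *)
Lemma area_integral_disc_le (F : R[i] -> R) (K : \bar R) :
  cmeasurable_fun (@unit_disc R) F -> (forall z, unit_disc z -> 0 <= F z) ->
  (forall s, uniq s -> all valid s -> (\sum_(q <- s) area_integral (@box R q.1 q.2) F <= K)%E) ->
  (area_integral (@unit_disc R) F <= K)%E.
Proof.
move=> mF F0 HK.
pose idx i : option (nat * nat) := pickle_inv i.
pose P i : set R[i] := if idx i is Some q then (if valid q then box q.1 q.2 else set0) else set0.
have DE : @unit_disc R = \bigcup_i P i.
  apply/seteqP; split => z.
    move=> /box_cover[n [k [kn bz]]]; exists (pickle (n, k)) => //.
    by rewrite /P /idx pickleK_inv /valid/= kn.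
  by move=> [i _]; rewrite /P; case: (idx i) => // q; case: ifP => // _ /box_disc.
rewrite DE; apply: area_integral_bigcup_le.
- move=> i; rewrite /P; case: (idx i) => [q|]; last exact: measurable0.
  by case: ifP => _; [exact: cmeasurable_box|exact: measurable0].
- apply/trivIsetP => i j _ _ ij; apply/seteqP; split=> // z [].
  rewrite /P; case Ei : (idx i) => [q|]//; case Ej : (idx j) => [q'|]//.
  case: ifP => // vq; case: ifP => // vq' bq bq'; exfalso; move/eqP: ij; apply.
  have [e1 e2] := box_disjoint vq vq' bq bq'.
  have qq : q = q' by case: q q' e1 e2 {Ei Ej vq vq' bq bq'} => a b [a' b'] /= -> ->.
  have hi : oapp pickle i (idx i) = i := pickle_invK i.
  have hj : oapp pickle j (idx j) = j := pickle_invK j.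
  by rewrite -hi -hj Ei Ej /= qq.
- by rewrite -DE.
- by move=> z; rewrite -DE; exact: F0.
move=> M; pose s := [seq q <- pmap idx (iota 0 M) | valid q].
have us : uniq s.
  by rewrite filter_uniq// (@pmap_uniq _ _ idx pickle) ?iota_uniq//; exact: pickle_invK.
apply: le_trans (HK s us (filter_all _ _)).
rewrite /s {us s}/index_iota subn0; elim: (iota 0 M) => [|i l IH]; first by rewrite !big_nil.
rewrite big_cons /=; have A0 : area_integral set0 F = 0%E.
  by rewrite /area_integral preimage_set0 integral_set0.
rewrite {1}/P; case: (idx i) => [q|] /=; last by rewrite A0 add0e.
case: ifP => _ /=; last by rewrite A0 add0e.
by rewrite big_cons leeD2l.
Qed.

Lemma powR_comparable r x b : 0 < r -> 0 < x -> r <= 4 * x -> x <= 4 * r ->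
  x `^ b <= 4 `^ `|b| * r `^ b.
Proof.
move=> r0 x0 rx xr; have [b0|b0] := leP 0 b.
  rewrite (ger0_norm b0) -powRM ?(ltW r0)//; apply: ge0_ler_powR => //; rewrite nnegrE; lra.
have h : r `^ (- b) <= 4 `^ (- b) * x `^ (- b).
  rewrite -powRM ?(ltW x0)//; apply: ge0_ler_powR => //; rewrite ?nnegrE; lra.
have E y : y `^ b = (y `^ (- b))^-1 by rewrite powRN invrK.
rewrite (E x) (E r) ltr0_norm//.
have := powR_gt0 (- b) r0; have := powR_gt0 (- b) x0; move: h.
move: (r `^ - b) (x `^ - b) (4 `^ - b) => u v c h v0 u0.
by rewrite ler_pdivlMr// mulrC ler_pdivrMr.
Qed.

(** Applied with [d = 1/4]: since [1 - |z| > rr n / 2] on the box, [1 - |w|] then stays comparable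
    to [rr n]. *)
Definition nbox n k d : set R[i] := [set w | exists2 z, box n k z & modulus (w - z) < d * rr R n].

Lemma box_nbox n k d : 0 < d -> box n k `<=` nbox n k d.
Proof. by move=> d0 z bz; exists z => //; rewrite subrr modulus0 mulr_gt0// rr_gt0. Qed.

Lemma copen_nbox n k d : copen (nbox n k d).
Proof.
move=> w [z bz h]; exists (d * rr R n - modulus (w - z)); first by rewrite subr_gt0.
move=> e he; exists z => //; rewrite addrAC (le_lt_trans (ler_modulusD _ _))//.
by lra.
Qed.

Lemma cmeasurable_nbox n k d : cmeasurable (nbox n k d).
Proof. exact: copen_cmeasurable (@copen_nbox n k d). Qed.

Lemma nbox_level n k w : nbox n k 4^-1 w -> rr R n / 4 < 1 - modulus w < 5 / 4 * rr R n.
Proof.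
move=> [z [h _]] wz; have := modulus_lip w z; have := rrS R n; move: h.
by rewrite ler_norml; lra.
Qed.

Lemma nbox_disc n k : nbox n k 4^-1 `<=` @unit_disc R.
Proof. by move=> w /nbox_level; have := rr_gt0 R n; rewrite /unit_disc/=; lra. Qed.

Lemma weight_ge (m : R) : 0 <= m -> m < 1 -> 1 - m <= 1 - m ^+ 2 <= 2 * (1 - m).
Proof. by move=> m0 m1; nra. Qed.

Lemma weight_gt0 z : unit_disc z -> 0 < 1 - modulus z ^+ 2.
Proof.
by move=> z1; have := weight_ge (modulus_ge0 z) z1; move: z1; rewrite /unit_disc/=; lra.
Qed.

Lemma nbox_weight n k w : nbox n k 4^-1 w ->
  rr R n / 4 <= 1 - modulus w ^+ 2 <= 4 * rr R n.
Proof.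
move=> h; have := nbox_level h; have := weight_ge (modulus_ge0 w) (nbox_disc h).
by have := rr_gt0 R n; lra.
Qed.

Lemma nbox_powR n k w b : nbox n k 4^-1 w ->
  (1 - modulus w ^+ 2) `^ b <= 4 `^ `|b| * rr R n `^ b /\
  rr R n `^ b <= 4 `^ `|b| * (1 - modulus w ^+ 2) `^ b.
Proof.
move=> h; have := nbox_weight h; have r0 := rr_gt0 R n; have := weight_gt0 (nbox_disc h).
by move: (1 - _) => x x0 hx; split; apply: powR_comparable => //; lra.
Qed.

Lemma area_box_le n k : (area (@box R n k) <= (162 * rr R n ^+ 2)%:E)%E.
Proof.
have r0 := rr_ge0 R n; have p2 := pi_ge2 R.
apply: (@le_trans _ _ (area (csquare (boxc R n k) (9 * rr R n)))).
  by apply: le_measure; rewrite ?inE; [exact: cmeasurable_box|exact: cmeasurable_csquare|move=> p; exact: box_csquare].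
rewrite area_csquare ?mulr_ge0// lee_fin mulrC ler_pdivrMr ?pi_gt0//.
by have := sqr_ge0 (rr R n); nra.
Qed.

Lemma area_box_ge n k : (k < 2 ^ n)%N -> ((rr R n ^+ 2 / 256)%:E <= area (@box R n k))%E.
Proof.
move=> kn; have r0 := rr_ge0 R n; have p0 := pi_gt0 R; have := pihalf_lt2 R => p4.
apply: (@le_trans _ _ (area (csquare (boxm R n k) (rr R n / 16)))); last first.
  by apply: le_measure; rewrite ?inE; [exact: cmeasurable_csquare|exact: cmeasurable_box|move=> p; exact: csquare_boxm].
rewrite area_csquare ?divr_ge0// lee_fin [leRHS]mulrC ler_pdivlMr ?pi_gt0//.
by have := sqr_ge0 (rr R n); nra.
Qed.

Definition overlap : R := 10 ^+ 8.

(** Packing by area. With [rho = 1 - |w|], each such box contains a square of half-side at least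
    [rho / 20] lying in the square of half-side [80 rho] about [w]. The boxes are disjoint, so there
    are at most [400 * 6400] of them, well below [overlap]. *)
Lemma nbox_overlap s w : uniq s -> all valid s -> unit_disc w ->
  \sum_(q <- s) \1_(nbox q.1 q.2 4^-1) w <= overlap.
Proof.
move=> us vs w1; rewrite sum_indic; set t := [seq _ <- _ | _].
have ut : uniq t by rewrite filter_uniq.
pose rho := 1 - modulus w; have rho0 : 0 < rho by rewrite subr_gt0.
have tP q : q \in t -> valid q /\ nbox q.1 q.2 4^-1 w.
  by rewrite mem_filter => /andP[/set_mem h /(allP vs)].
pose S := csquare w (80 * rho).
pose P q := box q.1 q.2 `&` S.
have mS : cmeasurable S by exact: cmeasurable_csquare.
have mP q : cmeasurable (P q).
  by rewrite /cmeasurable preimage_setI; apply: measurableI => //; exact: cmeasurable_box.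
have := @area_integral_overlap R _ t P S (fun=> 1) 1 mS mP (fun q => @subIsetr _ _ _)
  (@cmeasurable_fun_cst R S 1) (fun z _ => ler01).
have H1 z : S z -> \sum_(q <- t) \1_(P q) z <= 1 :> R.
  move=> _; apply: sum_indic_le1 => // -[a b] [a' b'] /tP[v _] /tP[v' _] [h _] [h' _].
  by have [/= -> ->] := box_disjoint v v' h h'.
move=> /(_ H1); rewrite mul1e area_integral_cst// mul1e area_csquare; last lra.
have L q : q \in t -> ((pi^-1 * (4 * (rho / 20) ^+ 2))%:E <= area_integral (P q) (fun=> 1%R))%E.
  move=> /tP[vq nq]; rewrite area_integral_cst// mul1e.
  have lev := nbox_level nq; rewrite -/rho in lev.
  have r0 := rr_gt0 R q.1.
  apply: (@le_trans _ _ (area (csquare (boxm R q.1 q.2) (rr R q.1 / 16)))).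
    rewrite area_csquare; last lra.
    rewrite lee_fin ler_pM2l ?invr_gt0 ?pi_gt0// ler_pM2l// ler_pXn2r// ?nnegrE; lra.
  apply: le_measure; rewrite ?inE; [exact: cmeasurable_csquare|exact: mP|].
  move=> p /= /(csquare_boxm vq) bp; split=> //.
  case: nq => z bz wz; have d1 := box_dist bp; have d2 := box_dist bz.
  have : modulus (complex_of_pair p - w) <= 80 * rho.
    have -> : complex_of_pair p - w = (complex_of_pair p - boxc R q.1 q.2) - (z - boxc R q.1 q.2) - (w - z) by ring.
    have := ler_modulusB (complex_of_pair p - boxc R q.1 q.2 - (z - boxc R q.1 q.2)) (w - z).
    have := ler_modulusB (complex_of_pair p - boxc R q.1 q.2) (z - boxc R q.1 q.2).
    lra.
  move: (complex_of_pair p) => y h; rewrite /S /csquare /crect/=.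
  have := le_trans (normr_Re_le _) h; have := le_trans (normr_Im_le _) h.
  by rewrite creD creN cimD cimN !ler_norml; split; lra.
have L2 : ((\sum_(q <- t) pi^-1 * (4 * (rho / 20) ^+ 2))%:E <= \sum_(q <- t) area_integral (P q) (fun=> 1%R))%E.
  by rewrite -sumEFin big_seq [leRHS]big_seq; apply: lee_sum.
move=> /(le_trans L2); rewrite lee_fin big_const_seq count_predT iter_addr_0 -[_ *+ size t]mulr_natr.
move: (size t)%:R => N h; have c0 : 0 < pi^-1 * (4 * rho ^+ 2) :> R.
  by rewrite !mulr_gt0 ?invr_gt0 ?pi_gt0.
have : pi^-1 * (4 * rho ^+ 2) * (N / 400) <= pi^-1 * (4 * rho ^+ 2) * 6400.
  apply: le_trans (le_trans _ h) _; apply: eqW; [|ring].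
  by move: pi^-1 => c; field.
rewrite ler_pM2l// /overlap; lra.
Qed.

Lemma sum_nbox_le s (F : R[i] -> R) : uniq s -> all valid s ->
  cmeasurable_fun (@unit_disc R) F -> (forall z, unit_disc z -> 0 <= F z) ->
  (\sum_(q <- s) area_integral (nbox q.1 q.2 4^-1) F <= overlap%:E * area_integral (@unit_disc R) F)%E.
Proof.
move=> us vs mF F0; apply: area_integral_overlap => //.
- exact: cmeasurable_disc.
- by move=> q; exact: cmeasurable_nbox.
- by move=> q; exact: nbox_disc.
by move=> w; exact: nbox_overlap.
Qed.

End box_families.

(** * Local estimates on a box *)

Section local_estimates.
Variable R : realType.
Implicit Types (n k : nat) (q : nat * nat) (s : seq (nat * nat)) (z w : R[i]) (r x b : R)
  (f : R[i] -> R[i]) (E : set R[i]).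
Local Notation rr := (rr R).
Local Notation D := (@unit_disc R).

Lemma area_disc_le : (area D <= 4%:E)%E.
Proof.
apply: (@le_trans _ _ (area (csquare (0 : R[i]) 1))).
  apply: le_measure; rewrite ?inE; [exact: cmeasurable_disc|exact: cmeasurable_csquare|].
  move=> p /=; rewrite /unit_disc /csquare /crect /= => h.
  have := le_trans (normr_Re_le _) (ltW h); have := le_trans (normr_Im_le _) (ltW h).
  by rewrite !ler_norml; split; lra.
rewrite area_csquare// lee_fin expr1n mulr1 mulrC ler_pdivrMr ?pi_gt0//.
by have := pi_ge2 R; lra.
Qed.

Lemma area_integral_bounded E (F : R[i] -> R) (B : R) : cmeasurable E -> E `<=` D ->
  cmeasurable_fun E F -> (forall z, E z -> 0 <= F z <= B) ->
  (area_integral E F <= (`|B| * 4)%:E)%E.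
Proof.
move=> mE ED mF HB; apply: (@le_trans _ _ (area_integral E (fun=> `|B|))).
  apply: le_area_integral => //; first exact: cmeasurable_fun_cst.
    by move=> z /HB/andP[].
  by move=> z /HB/andP[_ h]; apply: le_trans h _; exact: ler_norm.
rewrite area_integral_cst// EFinM; apply: lee_wpmul2l; first by rewrite lee_fin.
apply: le_trans area_disc_le; apply: le_measure; rewrite ?inE//; first exact: cmeasurable_disc.
by move=> p; exact: ED.
Qed.

Lemma area_integral_fin E (F : R[i] -> R) (B : R) : cmeasurable E -> E `<=` D ->
  cmeasurable_fun E F -> (forall z, E z -> 0 <= F z <= B) ->
  area_integral E F \is a fin_num.
Proof.
move=> mE ED mF HB; rewrite ge0_fin_numE; last by apply: area_integral_ge0 => z /HB/andP[].
by apply: le_lt_trans (area_integral_bounded mE ED mF HB) (ltry _).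
Qed.

Definition wint b E f : \bar R :=
  area_integral E (fun z => modulus (f z) ^+ 2 * (1 - modulus z ^+ 2) `^ b).

Lemma wint_fun_ge0 b f z : 0 <= modulus (f z) ^+ 2 * (1 - modulus z ^+ 2) `^ b.
Proof. by rewrite mulr_ge0// ?sqr_ge0// powR_ge0. Qed.

Lemma wint_ge0 b E f : (0 <= wint b E f)%E.
Proof. by apply: area_integral_ge0 => z _; exact: wint_fun_ge0. Qed.

Lemma cmeasurable_sqr E f : cmeasurable E -> E `<=` D -> analytic_on_disc f ->
  cmeasurable_fun E (fun z => modulus (f z) ^+ 2).
Proof. by move=> mE ED Af; apply: cmeasurable_funX; exact: cmeasurable_fun_modulus. Qed.

Lemma cmeasurable_wint b E f : cmeasurable E -> E `<=` D -> analytic_on_disc f ->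
  cmeasurable_fun E (fun z => modulus (f z) ^+ 2 * (1 - modulus z ^+ 2) `^ b).
Proof.
by move=> mE ED Af; apply: cmeasurable_funM; [exact: cmeasurable_sqr|exact: cmeasurable_weight].
Qed.

(** The local mass of [|f|^2] that controls values and derivatives of [f] on the box. For analytic
    [f] it is finite, the neighbourhood being inside a smaller disc. *)
Definition locI f q : R := fine (area_integral (@nbox R q.1 q.2 4^-1) (fun z => modulus (f z) ^+ 2)).

Lemma locIE f q : analytic_on_disc f ->
  area_integral (@nbox R q.1 q.2 4^-1) (fun z => modulus (f z) ^+ 2) = (locI f q)%:E.
Proof.
move=> Af; rewrite fineK//.
have r1 : 1 - rr q.1 / 4 < 1 by have := rr_gt0 R q.1; lra.
have [B B0 HB] := analytic_bounded Af r1.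
have mE : cmeasurable (nbox q.1 q.2 4^-1 : set R[i]) by exact: cmeasurable_nbox.
apply: (@area_integral_fin _ _ (B ^+ 2)) => //; first exact: nbox_disc.
  by apply: cmeasurable_sqr => //; exact: nbox_disc.
move=> z /nbox_level h; rewrite sqr_ge0/= ler_pXn2r ?nnegrE ?modulus_ge0 ?(ltW B0)//.
by apply: HB; lra.
Qed.

Lemma locI_ge0 f q : 0 <= locI f q.
Proof. by apply: fine_ge0; apply: area_integral_ge0 => z _; exact: sqr_ge0. Qed.

(** The submean property with [s = rr / 64], which keeps the square in the neighbourhood of the box;
    [64^2] times [2 pi <= 8] gives [2^15]. The margin [rr / 8] around the box is needed for
    derivatives. *)
Lemma box_sup f q z0 z : analytic_on_disc f -> box q.1 q.2 z0 ->
  modulus (z - z0) <= rr q.1 / 8 ->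
  modulus (f z) ^+ 2 * rr q.1 ^+ 2 <= 2 ^+ 15 * locI f q.
Proof.
move=> Af bz0 zz0; have r0 := rr_gt0 R q.1; have rS := rrS R q.1.
have h0 : rr q.1 / 2 < 1 - modulus z0 by case: bz0; lra.
have hz : modulus z <= modulus z0 + rr q.1 / 8.
  by have := modulus_lip z z0; rewrite ler_norml; lra.
have s0 : 0 < rr q.1 / 64 by lra.
have zs : modulus z + 4 * (rr q.1 / 64) < 1 by lra.
have := submean Af s0 zs.
have sub : csquare z (2 * (rr q.1 / 64)) `<=` nbox q.1 q.2 4^-1.
  move=> w /csquare_modulus h; exists z0 => //.
  have -> : w - z0 = (w - z) + (z - z0) by ring.
  by have := ler_modulusD (w - z) (z - z0); lra.
have : (area_integral (csquare z (2 * (rr q.1 / 64))) (fun w => (modulus (f w) ^+ 2)%R) <= (locI f q)%:E)%E.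
  rewrite -(locIE q Af); apply: area_integral_subset sub => //.
  - exact: cmeasurable_csquare.
  - exact: cmeasurable_nbox.
  - by apply: cmeasurable_sqr; [exact: cmeasurable_nbox|exact: nbox_disc|].
  - by move=> w _; exact: sqr_ge0.
move=> h1 h2; have p0 : 0 <= 2 * pi :> R by rewrite mulr_ge0// pi_ge0.
have := le_trans h2 (lee_wpmul2l _ h1); rewrite !lee_fin => /(_ p0).
have := pihalf_lt2 R; have := locI_ge0 f q; move: (locI f q) (modulus (f z) ^+ 2) => I F I0 p4.
move: (rr q.1) => r; rewrite exprMn => h.
have : 2 * pi * I <= 8 * I by rewrite ler_wpM2r//; lra.
lra.
Qed.

(** Cauchy's estimate at scale [rr / 64] for the values bounded by [box_sup]. It costs a factor
    [2^9 / rr] on the derivative, hence [2^18 * 2^15] after squaring. *)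
Lemma box_deriv f q z0 z : analytic_on_disc f -> box q.1 q.2 z0 ->
  modulus (z - z0) <= rr q.1 / 16 ->
  modulus (complex_derive f z) ^+ 2 * rr q.1 ^+ 4 <= 2 ^+ 33 * locI f q.
Proof.
move=> Af bz0 zz0; have r0 := rr_gt0 R q.1; have rS := rrS R q.1.
have h0 : rr q.1 / 2 < 1 - modulus z0 by case: bz0; lra.
have hz : modulus z <= modulus z0 + rr q.1 / 8.
  by have := modulus_lip z z0; rewrite ler_norml; lra.
have s0 : 0 < rr q.1 / 64 by lra.
have zs : modulus z + 2 * (rr q.1 / 64) < 1 by lra.
pose M := Num.sqrt (2 ^+ 15 * locI f q) / rr q.1.
have HM w : modulus (w - z0) <= rr q.1 / 8 -> modulus (f w) <= M.
  move=> h; rewrite ler_pdivlMr// -(@ler_pXn2r _ 2)// ?nnegrE ?mulr_ge0 ?modulus_ge0 ?sqrtr_ge0 ?(ltW r0)//.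
  by rewrite exprMn sqr_sqrtr ?mulr_ge0 ?exprn_ge0 ?locI_ge0//; exact: box_sup bz0 h.
have osc w : modulus w <= 2 * (rr q.1 / 64) -> modulus (f (z + w) - f z) <= 2 * M.
  move=> hw; have h1 := HM z; have h2 := HM (z + w).
  have := ler_modulusD w (z - z0); have -> : w + (z - z0) = z + w - z0 by ring.
  move=> h3; have := ler_modulusB (f (z + w)) (f z).
  have {}h1 : modulus (f z) <= M by apply: h1; lra.
  have {}h2 : modulus (f (z + w)) <= M by apply: h2; lra.
  by move: (modulus (f z)) (modulus (f (z + w))) h1 h2 => x y; lra.
have := deriv_bound_by_osc Af s0 zs osc; move: (modulus _) (modulus_ge0 (complex_derive f z)) => d d0.
rewrite ler_pdivlMr// => h.
have h' : d * rr q.1 ^+ 2 <= 2 ^+ 9 * Num.sqrt (2 ^+ 15 * locI f q).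
  have MS : M * rr q.1 = Num.sqrt (2 ^+ 15 * locI f q) by rewrite divfK// gt_eqF.
  have := ler_wpM2r (ltW r0) h; rewrite -MS; move: (rr q.1) (M) => r N; lra.
have K0 : 0 <= 2 ^+ 15 * locI f q by rewrite mulr_ge0 ?exprn_ge0 ?locI_ge0.
have S0 := sqrtr_ge0 (2 ^+ 15 * locI f q); have S2 := sqr_sqrtr K0.
have -> : 2 ^+ 33 * locI f q = (2 ^+ 9) ^+ 2 * (2 ^+ 15 * locI f q) by ring.
rewrite -S2; move: (Num.sqrt _) S0 h' => S S0 h'; clear -d0 r0 S0 h'.
have -> : d ^+ 2 * rr q.1 ^+ 4 = (d * rr q.1 ^+ 2) ^+ 2 by ring.
rewrite -exprMn; apply: lerXn2r; last exact: h'.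
  by rewrite nnegrE mulr_ge0// exprn_ge0// ltW.
by rewrite nnegrE mulr_ge0// exprn_ge0.
Qed.

Lemma wloc_le b f q : analytic_on_disc f ->
  ((rr q.1 `^ b * locI f q)%:E <= (4 `^ `|b|)%:E * wint b (nbox q.1 q.2 4^-1) f)%E.
Proof.
move=> Af; rewrite EFinM -(locIE q Af).
have mE : cmeasurable (nbox q.1 q.2 4^-1 : set R[i]) by exact: cmeasurable_nbox.
have ED := @nbox_disc R q.1 q.2.
have m1 : cmeasurable_fun (nbox q.1 q.2 4^-1) (fun z => modulus (f z) ^+ 2) by exact: cmeasurable_sqr.
have m2 : cmeasurable_fun _ (fun z => modulus (f z) ^+ 2 * (1 - modulus z ^+ 2) `^ b) := cmeasurable_wint b mE ED Af.
rewrite -area_integralZ ?powR_ge0//; last by move=> z _; exact: sqr_ge0.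
rewrite -area_integralZ ?powR_ge0//; last by move=> z _; exact: wint_fun_ge0.
apply: le_area_integral => //.
- by apply: cmeasurable_funM => //; exact: cmeasurable_fun_cst.
- by apply: cmeasurable_funM => //; exact: cmeasurable_fun_cst.
- by move=> z _; rewrite mulr_ge0 ?powR_ge0 ?sqr_ge0.
move=> z /(nbox_powR b)[_ h].
have := ler_wpM2l (sqr_ge0 (modulus (f z))) h.
by rewrite (mulrC (rr q.1 `^ b)) (mulrCA (4 `^ `|b|)).
Qed.

(** The return from local masses to a global weighted norm: the weight is almost constant on each
    neighbourhood and the neighbourhoods overlap boundedly. *)
Lemma sum_locI_le b f s : analytic_on_disc f -> uniq s -> all valid s ->
  ((\sum_(q <- s) rr q.1 `^ b * locI f q)%:E <= (4 `^ `|b| * overlap R)%:E * wint b D f)%E.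
Proof.
move=> Af us vs; rewrite -sumEFin.
apply: (@le_trans _ _ (\sum_(q <- s) (4 `^ `|b|)%:E * wint b (nbox q.1 q.2 4^-1) f)%E).
  by apply: lee_sum => q _; exact: wloc_le.
rewrite -ge0_sume_distrr; last by move=> q _; exact: wint_ge0.
rewrite EFinM -muleA lee_wpmul2l ?lee_fin ?powR_ge0//; apply: sum_nbox_le => //.
  by apply: cmeasurable_wint => //; exact: cmeasurable_disc.
by move=> z _; exact: wint_fun_ge0.
Qed.

Lemma wint_box_le b f q (B : R) : analytic_on_disc f -> 0 <= B ->
  (forall z, box q.1 q.2 z -> modulus (f z) ^+ 2 <= B) ->
  (wint b (box q.1 q.2) f <= (4 `^ `|b| * 162 * (rr q.1 `^ b * rr q.1 ^+ 2 * B))%:E)%E.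
Proof.
move=> Af B0 HB; have mE : cmeasurable (box q.1 q.2 : set R[i]) by exact: cmeasurable_box.
have ED := @box_disc R q.1 q.2; pose c := 4 `^ `|b| * rr q.1 `^ b * B.
have c0 : 0 <= c by rewrite !mulr_ge0 ?powR_ge0.
apply: (@le_trans _ _ (area_integral (box q.1 q.2) (fun=> c))).
  apply: le_area_integral => //.
  - exact: cmeasurable_wint.
  - exact: cmeasurable_fun_cst.
  - by move=> z _; exact: wint_fun_ge0.
  move=> z bz; rewrite /c mulrC; apply: ler_pM; rewrite ?powR_ge0 ?sqr_ge0 ?HB//.
  have d0 : 0 < 4^-1 :> R by [].
  by have [h _] := nbox_powR b (box_nbox d0 bz); exact: h.
rewrite area_integral_cst//; apply: le_trans (lee_wpmul2l _ (area_box_le R q.1 q.2)) _.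
  by rewrite lee_fin.
by rewrite -EFinM lee_fin /c; apply: eqW; ring.
Qed.

End local_estimates.

(** * A Hardy inequality *)


Section hardy_sums.
Variable R : realType.

(** Summing the recursion over the levels. The induction carries the boundary terms [a * x M] and
    [y M], which are dropped at the end. For [a < 1] this is a discrete Hardy inequality. *)
Lemma geometric_recursion (x y : nat -> R) (a c : R) (M : nat) : 0 <= a -> 0 <= c ->
  (forall n, 0 <= x n) -> (forall n, 0 <= y n) ->
  x 0%N <= c * y 0%N -> (forall n, x n.+1 <= a * x n + c * (y n.+1 + y n)) ->
  (1 - a) * \sum_(0 <= n < M) x n <= 2 * c * \sum_(0 <= n < M) y n.
Proof.
move=> a0 c0 x0 y0 h0 hS; case: M => [|M]; first by rewrite !big_geq// !mulr0.
suff : (1 - a) * (\sum_(0 <= n < M.+1) x n) + a * x M <= c * (2 * (\sum_(0 <= n < M.+1) y n) - y M).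
  have := mulr_ge0 a0 (x0 M); have := mulr_ge0 c0 (y0 M); lra.
elim: M => [|M IH]; first by rewrite !big_nat1; lra.
rewrite !(big_nat_recr M.+1)//=.
move: (\sum_(_ <= _ < _) _) (\sum_(_ <= _ < _) _) IH (hS M) => X Y IH h.
lra.
Qed.

Lemma two_powR_lt1 (x : R) : x < 0 -> 2 `^ x < 1.
Proof.
move=> x0; have h : 0 < - x by lra.
have : 1 `^ (- x) < 2 `^ (- x) :> R by apply: gt0_ltr_powR => //; rewrite ?nnegrE// ltr1n.
rewrite powR1 powRN => h1.
by rewrite -[2 `^ x]invrK invf_lt1// (lt_trans ltr01).
Qed.

(** Each box has two children, [k] and its parent [k./2]. *)
Lemma sum_halves (F : nat -> R) (m : nat) :
  \sum_(0 <= k < m.*2) F k./2 = 2 * \sum_(0 <= k < m) F k.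
Proof.
elim: m => [|m IH]; first by rewrite !big_geq// mulr0.
rewrite doubleS !big_nat_recr//= IH uphalf_double doubleK; lra.
Qed.

Lemma sqr_add_le (x y e : R) : 0 < e -> (x + y) ^+ 2 <= (1 + e) * x ^+ 2 + (1 + e^-1) * y ^+ 2.
Proof.
move=> e0; have : 0 <= e^-1 * (e * x - y) ^+ 2 by rewrite mulr_ge0 ?sqr_ge0// invr_ge0 ltW.
have -> : e^-1 * (e * x - y) ^+ 2 = e * x ^+ 2 - 2 * (x * y) + e^-1 * y ^+ 2.
  by field; rewrite gt_eqF.
move: e^-1 => d; lra.
Qed.

End hardy_sums.

Lemma levels_uniq M : uniq (levels M).
Proof.
apply: allpairs_uniq_dep; [exact: iota_uniq|by move=> n _; exact: iota_uniq|].
by move=> [? ?] [? ?] _ _ /= [-> ->].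
Qed.

Lemma levels_valid M : all valid (levels M).
Proof. by apply/allP => q /allpairsPdep[n [k [_ hk ->]]]; move: hk; rewrite mem_iota. Qed.

Section hardy.
Variable R : realType.
Implicit Types (n k : nat) (q : nat * nat) (z w : R[i]) (G : R[i] -> R[i]).
Local Notation rr := (rr R).
Local Notation D := (@unit_disc R).

(** Moving a point of the sector of box [(n + 1, k)] radially to level [n] leads into the box
    [(n, k./2)]. *)
Lemma box_parent n k (m t : R) : rr n.+1 < 1 - m <= rr n -> 0 <= m ->
  2 * pi * k%:R * rr n.+1 <= t < 2 * pi * k.+1%:R * rr n.+1 ->
  box n k./2 (m%:C * expi t).
Proof.
move=> h m0 ht; have mE : modulus (m%:C * expi t) = m.
  by rewrite modulusM modulus_real modulus_expi mulr1 ger0_norm.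
split; rewrite mE//; exists t => //.
have P x : 2 * pi * x * rr n = 2 * pi * rr n.+1 * (2 * x) by rewrite rrS; ring.
have P1 x : 2 * pi * x * rr n.+1 = 2 * pi * rr n.+1 * x by ring.
have p0 : 0 <= 2 * pi * rr n.+1 by rewrite !mulr_ge0// ?pi_ge0// rr_ge0.
have h1 : 2 * (k./2)%:R <= k%:R :> R by rewrite -natrM ler_nat; lia.
have h2 : k.+1%:R <= 2 * (k./2).+1%:R :> R by rewrite -natrM ler_nat; lia.
have := ler_wpM2l p0 h1; have := ler_wpM2l p0 h2; move: ht; rewrite !P !P1.
move=> /andP[t1 t2] h3 h4; rewrite (le_trans h4 t1)/=; exact: lt_le_trans t2 h3.
Qed.

Section growth.
Variables (G : R[i] -> R[i]).
Hypotheses (AG : analytic_on_disc G) (G0 : G 0 = 0).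
Let F := complex_derive G.

(** By [box_sup] this bounds [rr * |G'|] on the box, hence the variation of [G] across it, up to a
    constant. *)
Definition osc q : R := Num.sqrt (2 ^+ 15 * locI F q).

Lemma osc_ge0 q : 0 <= osc q. Proof. exact: sqrtr_ge0. Qed.

Lemma sqr_osc q : osc q ^+ 2 = 2 ^+ 15 * locI F q.
Proof. by rewrite sqr_sqrtr ?mulr_ge0 ?exprn_ge0 ?locI_ge0. Qed.

Lemma box_osc q z : box q.1 q.2 z -> modulus (F z) * rr q.1 <= osc q.
Proof.
move=> bz; have r0 := rr_gt0 R q.1; rewrite -(@ler_pXn2r _ 2)// ?nnegrE ?mulr_ge0 ?modulus_ge0 ?osc_ge0 ?(ltW r0)//.
rewrite exprMn sqr_osc; apply: (box_sup _ bz); first exact: derive_analytic.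
by rewrite subrr modulus0; lra.
Qed.

(** A bound for [|G|] on the box, accumulated along its chain of ancestors down to the central box,
    where [G 0 = 0] starts the chain. *)
Fixpoint growth n k : R :=
  if n is m.+1 then growth m k./2 + (2 * osc (n, k) + osc (m, k./2)) else 2 * osc (0%N, 0%N).

Lemma growth_ge0 n k : 0 <= growth n k.
Proof.
elim: n k => [|n IH] k /=; first by rewrite mulr_ge0 ?osc_ge0.
by rewrite addr_ge0// addr_ge0 ?osc_ge0// mulr_ge0 ?osc_ge0.
Qed.

Lemma box_growth n k z : (k < 2 ^ n)%N -> box n k z -> modulus (G z) <= growth n k.
Proof.
elim: n k z => [|n IH] k z kn bz.
  rewrite [growth _ _]/=.
  have z1 : modulus z < 2^-1 by case: bz; have := rrS R 0; rewrite rr0; lra.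
  have half : 2^-1 < 1 :> R by lra.
  have := @analytic_mvi R G 0 z 2^-1 (osc (0%N, 0%N)) AG half.
  rewrite modulus0 G0 !subr0 (ltW z1) => /(_ _ isT) h.
  apply: le_trans (h _ _) _; first lra.
    move=> t t01; rewrite add0r.
    have m1 : modulus (t%:C * z) < 2^-1.
      rewrite modulusM modulus_real ger0_norm; last lra.
      by apply: le_lt_trans z1; rewrite ler_piMl ?modulus_ge0//; lra.
    have bt : box 0 0 (t%:C * z).
      have [u hu uE] := polar (t%:C * z); split; last first.
        by exists u => //; rewrite rr0; lra.
      by have := rrS R 0; have := modulus_ge0 (t%:C * z); rewrite rr0; lra.
    by have := @box_osc (0%N, 0%N) _ bt; rewrite rr0 mulr1.
  by rewrite ler_piMr ?mulr_ge0 ?osc_ge0//; lra.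
have [h [t ht zE]] := bz; rewrite [growth _ _]/=.
set rho := modulus z in h zE; have rS := rrS R n; have rS1 := rrS R n.+1; have rn1 := rr_le1 R n.
have rn0 := rr_gt0 R n.+1.
(* The point on the same ray with [1 - |z'| = 2 (1 - |z|)]: it lies in the parent box, and the
   segment from [z'] to [z] stays in the two boxes. *)
pose z' := (2 * rho - 1)%:C * expi t.
have bz' : box n k./2 z' by apply: box_parent ht; lra.
have kn' : (k./2 < 2 ^ n)%N by move: kn; rewrite expnS; lia.
have := IH _ _ kn' bz'.
have mz' : modulus z' = 2 * rho - 1.
  by rewrite modulusM modulus_real modulus_expi mulr1 ger0_norm//; lra.
have dE : modulus (z - z') = 1 - rho.
  rewrite /z' zE -mulrBl -rmorphB modulusM modulus_real modulus_expi mulr1 ger0_norm; lra.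
have r1 : rho < 1 by lra.
have zr : modulus z <= rho by [].
have zr' : modulus z' <= rho by rewrite mz'; lra.
have := @analytic_mvi R G z' z rho ((osc (n.+1, k) + osc (n, k./2) / 2) / rr n.+1) AG r1 zr' zr.
have H : forall s : R, 0 <= s <= 1 -> modulus (complex_derive G (z' + s%:C * (z - z'))) <= (osc (n.+1, k) + osc (n, k./2) / 2) / rr n.+1.
  move=> s s01; have := osc_ge0 (n.+1, k); have := osc_ge0 (n, k./2) => o1 o2.
  pose m := 2 * rho - 1 + s * (1 - rho).
  have -> : z' + s%:C * (z - z') = m%:C * expi t.
    rewrite /z' zE -mulrBl -rmorphB mulrA -rmorphM -mulrDl -rmorphD; congr (_%:C * _).
    by rewrite /m; ring.
  have sm : 0 <= s * (1 - rho) <= 1 - rho by rewrite mulr_ge0 ?ler_piMl//; lra.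
  rewrite ler_pdivlMr//; have [hm|hm] := leP (1 - m) (rr n.+1).
    have bm : box n.+1 k (m%:C * expi t).
      have mE : modulus (m%:C * expi t) = m.
        by rewrite modulusM modulus_real modulus_expi mulr1 ger0_norm// /m; lra.
      by split; [rewrite mE /m; rewrite /m in hm; lra|exists t; rewrite ?mE].
    by have := @box_osc (n.+1, k) _ bm; rewrite /=; lra.
  have bm : box n k./2 (m%:C * expi t).
    by apply: box_parent ht; rewrite /m in hm *; lra.
  by have := @box_osc (n, k./2) _ bm; rewrite /= rS; move: (modulus _) (rr n.+1) => x y; lra.
move=> /(_ H); rewrite dE => h1 h2.
have : modulus (G z) <= modulus (G z') + modulus (G z - G z').
  by rewrite -{1}(subrKC (G z') (G z)) ler_modulusD.
have : 2 * ((osc (n.+1, k) + osc (n, k./2) / 2) / rr n.+1) * (1 - rho) <= 2 * osc (n.+1, k) + osc (n, k./2).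
  have -> : 2 * osc (n.+1, k) + osc (n, k./2) = 2 * ((osc (n.+1, k) + osc (n, k./2) / 2) / rr n.+1) * rr n.+1.
    by field; rewrite gt_eqF.
  have := osc_ge0 (n.+1, k); have := osc_ge0 (n, k./2) => o1 o2.
  rewrite ler_wpM2l//; last lra.
  by rewrite mulr_ge0// divr_ge0 ?(ltW rn0)//; lra.
lra.
Qed.

(** Squaring with the parameter [e] keeps the coefficient of the inherited term near 1; the factor 2
    counts the children of a box. *)
Lemma growth_level (e : R) n : 0 < e ->
  \sum_(0 <= k < 2 ^ n.+1) growth n.+1 k ^+ 2 <=
  2 * (1 + e) * \sum_(0 <= k < 2 ^ n) growth n k ^+ 2 +
  (1 + e^-1) * (8 * \sum_(0 <= k < 2 ^ n.+1) osc (n.+1, k) ^+ 2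
               + 4 * \sum_(0 <= k < 2 ^ n) osc (n, k) ^+ 2).
Proof.
move=> e0; have e1 : 0 < e^-1 by rewrite invr_gt0.
have twos : (2 ^ n.+1)%N = (2 ^ n).*2 by rewrite expnS mul2n.
have E1 := sum_halves (fun k => growth n k ^+ 2) (2 ^ n).
have E2 := sum_halves (fun k => osc (n, k) ^+ 2) (2 ^ n).
have -> : 2 * (1 + e) * \sum_(0 <= k < 2 ^ n) growth n k ^+ 2 +
  (1 + e^-1) * (8 * \sum_(0 <= k < 2 ^ n.+1) osc (n.+1, k) ^+ 2
               + 4 * \sum_(0 <= k < 2 ^ n) osc (n, k) ^+ 2) =
  \sum_(0 <= k < 2 ^ n.+1) ((1 + e) * growth n k./2 ^+ 2 +
     (1 + e^-1) * (8 * osc (n.+1, k) ^+ 2 + 2 * osc (n, k./2) ^+ 2)).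
  rewrite big_split /= -!mulr_sumr big_split /= -!mulr_sumr.
  rewrite [in RHS]twos E1 E2 -[in RHS]twos; move: e^-1 => d; ring.
apply: ler_sum => k _ /=; apply: le_trans (sqr_add_le _ _ e0) _; rewrite lerD2l ler_wpM2l//; first lra.
move: (osc (n.+1, k)) (osc (n, k./2)) => x y; have := sqr_ge0 (2 * x - y); lra.
Qed.

End growth.

(** From level [n] to [n + 1] the number of boxes doubles while the weight [rr ^ (b + 2)] is divided
    by [2 ^ (b + 2)]. The resulting ratio [d = 2 ^ (-1 - b)] is below 1 exactly when [b > -1], so
    the level sums of [growth ^ 2] satisfy a contracting recursion driven by the level sums of
    [osc ^ 2]. *)
Theorem hardy (b : R) : -1 < b -> exists2 C : R, 0 < C & forall G, analytic_on_disc G -> G 0 = 0 ->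
  (wint b D G <= C%:E * wint (b + 2) D (complex_derive G))%E.
Proof.
move=> b1; pose be := b + 2; have two0 : 0 < 2 :> R by [].
pose d : R := 2 `^ (1 - be).
have d0 : 0 < d by rewrite powR_gt0.
have d1 : d < 1.
  by apply: two_powR_lt1; rewrite /be; lra.
pose a := (1 + d) / 2; have a1 : a < 1 by rewrite /a; lra.
have a0 : 0 < a by rewrite /a; lra.
(* Makes [d (1 + e)] equal to [a], the midpoint of [d] and 1: the loss in squaring still leaves a
   contraction. *)
pose e := a / d - 1; have e0 : 0 < e by rewrite subr_gt0 ltr_pdivlMr// mul1r /a; lra.
(* The summand 4 covers level 0, where [growth] is twice [osc]. *)
pose c := 8 * (1 + e^-1) + 4; have e1 : 0 < e^-1 by rewrite invr_gt0.
have c0 : 0 <= c by rewrite /c; lra.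
pose C := 4 `^ `|b| * 162 * (2 * c / (1 - a) * 2 ^+ 15 * (4 `^ `|be| * overlap R)).
have C0 : 0 < C.
  rewrite /C !mulr_gt0 ?powR_gt0 ?exprn_gt0 ?invr_gt0//; last by rewrite subr_gt0.
  by rewrite /c; lra.
exists C => // G AG G0; set F := complex_derive G; have AF : analytic_on_disc F by exact: derive_analytic.
apply: area_integral_disc_le.
- by apply: cmeasurable_wint => //; exact: cmeasurable_disc.
- by move=> z _; exact: wint_fun_ge0.
move=> s us vs.
pose X (q : nat * nat) := rr q.1 `^ be * growth G q.1 q.2 ^+ 2.
have X0 q : 0 <= X q by rewrite mulr_ge0 ?powR_ge0 ?sqr_ge0.
have [M hM] := sum_levels_le us vs X0.
pose x n := \sum_(0 <= k < 2 ^ n) X (n, k).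
pose y n := \sum_(0 <= k < 2 ^ n) rr n `^ be * osc G (n, k) ^+ 2.
have half n : rr n.+1 `^ be = d / 2 * rr n `^ be.
  rewrite (rrS R n) powRM// ?rr_ge0// mulrA.
  have -> : d / 2 * 2 `^ be = 1; last by rewrite mul1r.
  have -> : d = 2 `^ (- be) * 2.
    by rewrite /d addrC powRD ?powRr1//; apply/implyP => /eqP; lra.
  by rewrite mulfK// -powRD ?addNr ?powRr0//; apply/implyP => /eqP; lra.
have := @geometric_recursion R x y a c M (ltW a0) c0.
have x0 n : 0 <= x n by apply: sumr_ge0.
have y0 n : 0 <= y n by apply: sumr_ge0 => k _; rewrite mulr_ge0 ?powR_ge0 ?sqr_ge0.
have xE n : x n = rr n `^ be * \sum_(0 <= k < 2 ^ n) growth G n k ^+ 2 by rewrite mulr_sumr.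
have yE n : y n = rr n `^ be * \sum_(0 <= k < 2 ^ n) osc G (n, k) ^+ 2 by rewrite mulr_sumr.
have h0 : x 0%N <= c * y 0%N.
  rewrite /x /y !expn0 !big_nat1 /X /= rr0 powR1 !mul1r exprMn /c.
  have := sqr_ge0 (osc G (0%N, 0%N)); have : 0 <= 8 * (1 + e^-1) by lra.
  move: (8 * _) (_ ^+ 2) => u v u0 v0; have := mulr_ge0 u0 v0; lra.
have hS n : x n.+1 <= a * x n + c * (y n.+1 + y n).
  rewrite (xE n.+1) (xE n) (yE n.+1) (yE n).
  have := growth_level G n e0; have rp := powR_ge0 (rr n.+1) be.
  move=> /(ler_wpM2l rp)/le_trans; apply.
  set S := \sum_(_ <= _ < _) growth _ _ _ ^+ 2.
  set O1 := \sum_(_ <= _ < _) _ ^+ 2; set O := \sum_(_ <= _ < _) _ ^+ 2.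
  have O10 : 0 <= O1 by apply: sumr_ge0 => k _; exact: sqr_ge0.
  have O0 : 0 <= O by apply: sumr_ge0 => k _; exact: sqr_ge0.
  have E1 : rr n.+1 `^ be * (2 * (1 + e) * S) = a * (rr n `^ be * S).
    have -> : a = d * (1 + e) by rewrite /e addrC subrK mulrC divfK// gt_eqF.
    by rewrite half; field.
  rewrite mulrDr E1 lerD2l.
  have r1 : rr n.+1 `^ be <= rr n `^ be.
    by rewrite half ler_piMl ?powR_ge0//; lra.
  have h1 := ler_wpM2r O0 r1.
  move: (rr n.+1 `^ be) (rr n `^ be) rp h1 {E1} => u v u0 h1.
  have k0 : 0 <= 1 + e^-1 by lra.
  rewrite /c; move: (1 + e^-1) k0 => k k0.
  have := ler_wpM2l k0 h1; have := mulr_ge0 u0 O10; have := mulr_ge0 u0 O0.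
  have := mulr_ge0 k0 (mulr_ge0 u0 O0); lra.
move=> /(_ x0 y0 h0 hS) key.
have yM : \sum_(0 <= n < M) y n = 2 ^+ 15 * \sum_(q <- levels M) rr q.1 `^ be * locI F q.
  rewrite big_levels mulr_sumr; apply: eq_bigr => n _; rewrite mulr_sumr; apply: eq_bigr => k _ /=.
  by rewrite sqr_osc mulrCA.
have := sum_locI_le be AF (levels_uniq M) (levels_valid M).
set W := wint be D F; set L := \sum_(q <- levels M) _ => hL.
apply: (@le_trans _ _ (\sum_(q <- s) ((4 `^ `|b| * 162) * X q)%:E)%E).
  rewrite big_seq [leRHS]big_seq; apply: lee_sum => q qs.
  have := @wint_box_le R b G q (growth G q.1 q.2 ^+ 2) AG (sqr_ge0 _).
  have -> : rr q.1 `^ b * rr q.1 ^+ 2 * growth G q.1 q.2 ^+ 2 = X q.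
    rewrite /X /be powRD; last by apply/implyP => _; rewrite gt_eqF// rr_gt0.
    by rewrite -powR_mulrn ?rr_ge0.
  apply=> z bz; rewrite ler_pXn2r// ?nnegrE ?modulus_ge0 ?growth_ge0//.
  by apply: box_growth => //; exact: (allP vs).
rewrite sumEFin -mulr_sumr.
pose K := 4 `^ `|b| * 162 * (2 * c / (1 - a) * 2 ^+ 15).
have K0 : 0 <= K.
  rewrite /K !mulr_ge0 ?powR_ge0 ?exprn_ge0 ?invr_ge0//; lra.
have -> : C = K * (4 `^ `|be| * overlap R) by rewrite /C /K !mulrA.
apply: (@le_trans _ _ (K%:E * L%:E)%E); last by rewrite (EFinM K) -muleA; apply: lee_wpmul2l; rewrite ?lee_fin.
rewrite -EFinM lee_fin /K -[leRHS]mulrA ler_wpM2l ?mulr_ge0 ?powR_ge0//.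
apply: (le_trans hM); rewrite -(mulrA (2 * c / (1 - a))) -yM (mulrAC (2 * c)) ler_pdivlMr ?subr_gt0// mulrC.
exact: key.
Qed.

End hardy.

(** * The Bergman space *)


Section primitives.
Variable R : realType.
Implicit Types (f g h : R[i] -> R[i]) (b z : R[i]).

Lemma segment_integral0 f : segment_integral f 0 = 0.
Proof.
rewrite /segment_integral.
have E (G : R[i] -> R) : G 0 = 0 -> (\int[lebesgue_measure]_(t in `[0%R, 1%R]) G (f (t%:C * 0) * 0))%R = 0.
  by move=> G0; under eq_Rintegral do rewrite mulr0 G0; rewrite Rintegral_cst// mul0r.
by rewrite !E.
Qed.

Opaque segment_integral.

Lemma analytic_zero f : analytic_on_disc f -> f 0 = 0 ->
  (forall z, unit_disc z -> complex_derive f z = 0) -> forall z, unit_disc z -> f z = 0.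
Proof.
move=> Af f0 df z z1; have m0 : modulus (0 : R[i]) <= modulus z by rewrite modulus0 modulus_ge0.
have := @analytic_mvi R f 0 z (modulus z) 0 Af z1 m0 (lexx _).
rewrite f0 !subr0 mulr0 mul0r => H.
apply: modulus_eq0; apply/eqP; rewrite eq_le modulus_ge0 andbT; apply: H => t t01.
rewrite df ?modulus0// add0r /unit_disc/= modulusM modulus_real ger0_norm; last lra.
by apply: le_lt_trans z1; rewrite ler_piMl ?modulus_ge0//; lra.
Qed.

Lemma primitive_uniq f h (F : R[i] -> R[i]) : (forall z, unit_disc z -> cderiv f z (F z)) ->
  (forall z, unit_disc z -> cderiv h z (F z)) -> f 0 = h 0 -> forall z, unit_disc z -> f z = h z.
Proof.
move=> dF dH fh z z1; have D w : unit_disc w -> cderiv (fun w => f w - h w) w 0.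
  by move=> w1; rewrite -(subrr (F w)); exact: cderivB (dF w w1) (dH w w1).
apply/eqP; rewrite -subr_eq0; apply/eqP.
apply: (@analytic_zero (fun w => f w - h w)) z1.
- exact: cderiv_analytic D.
- by rewrite fh subrr.
by move=> w /D/cderiv_derive.
Qed.


Lemma analytic_comb b f h : analytic_on_disc f -> analytic_on_disc h ->
  analytic_on_disc (fun w => b * f w + h w).
Proof.
by move=> Af Ah; exact: (@analyticD R _ _ (@analyticM R _ _ (@analytic_cst R b) Af) Ah).
Qed.

Lemma analytic_segment_integral f : analytic_on_disc f -> analytic_on_disc (segment_integral f).
Proof. by move=> Af; apply: (cderiv_analytic (df := f)) => z; exact: segment_integral_cderiv. Qed.

Lemma derive_segment_integral f z : analytic_on_disc f -> unit_disc z ->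
  complex_derive (segment_integral f) z = f z.
Proof. by move=> Af z1; apply: cderiv_derive; exact: segment_integral_cderiv. Qed.

Lemma segment_integral_linear b f h z : analytic_on_disc f -> analytic_on_disc h -> unit_disc z ->
  segment_integral (fun w => b * f w + h w) z = b * segment_integral f z + segment_integral h z.
Proof.
move=> Af Ah z1; have Afh := @analytic_comb b f h Af Ah.
apply: (@primitive_uniq _ (fun z => b * segment_integral f z + segment_integral h z)
  (fun w => b * f w + h w)) z1.
- by move=> w; exact: segment_integral_cderiv.
- move=> w w1; have -> : b * f w + h w = (0 * segment_integral f w + b * f w) + h w.
    by rewrite mul0r add0r.
  apply: cderivD; last exact: segment_integral_cderiv.
  by apply: cderivM; [exact: cderiv_cst|exact: segment_integral_cderiv].
by rewrite !segment_integral0 mulr0 addr0.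
Qed.

End primitives.

Section bergman.
Variables (R : realType) (alpha : R).
Hypothesis alpha1 : 0 < alpha + 1.
Implicit Types (f g h v x : R[i] -> R[i]) (b s z : R[i]).
Local Notation D := (@unit_disc R).
Local Notation W f := (wint alpha D f).

Lemma bergman_normE f : bergman_norm alpha f = sqrte ((alpha + 1)%:E * W f).
Proof. by []. Qed.

Lemma bergman_norm_fin f : (bergman_norm alpha f < +oo)%E = (W f < +oo)%E.
Proof.
have a0 := alpha1.
rewrite bergman_normE; have := wint_ge0 alpha D f; case: (W f) => [x _|_|]; last by rewrite leeNy_eq.
  by rewrite -EFinM /= !ltry.
by rewrite gt0_muley ?lte_fin.
Qed.

Lemma bergman_spaceP f : bergman_space alpha f <-> analytic_on_disc f /\ (W f < +oo)%E.
Proof. by rewrite /bergman_space/= bergman_norm_fin. Qed.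

Lemma bergman_norm_le f (c : R) : 0 <= c ->
  (bergman_norm alpha f <= c%:E)%E = ((alpha + 1)%:E * W f <= (c ^+ 2)%:E)%E.
Proof.
move=> c0; rewrite bergman_normE.
have : (0 <= (alpha + 1)%:E * W f)%E by rewrite mule_ge0 ?wint_ge0// lee_fin ltW.
case: (_ * _)%E => [x|_|]//=; rewrite !lee_fin => x0.
by rewrite -(@ler_pXn2r _ 2)// ?nnegrE ?sqrtr_ge0// sqr_sqrtr.
Qed.

(** The squared norm without the factor [alpha + 1], as a real number; on the space [wintE]
    justifies [fine]. *)
Definition sq f : R := fine (W f).

Lemma wintE f : bergman_space alpha f -> W f = (sq f)%:E.
Proof. by move=> /bergman_spaceP[_ h]; rewrite fineK// ge0_fin_numE// wint_ge0. Qed.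

Lemma sq_ge0 f : 0 <= sq f. Proof. exact/fine_ge0/wint_ge0. Qed.

Lemma eq_wint (r : R) (E : set (R[i])) f h : (forall z, E z -> f z = h z) -> wint r E f = wint r E h.
Proof. by move=> fh; apply: eq_area_integral => z /fh ->. Qed.

Lemma bergman_space_eq f h : (forall z, D z -> f z = h z) -> bergman_space alpha f ->
  bergman_space alpha h.
Proof.
move=> fh /bergman_spaceP[Af Wf]; apply/bergman_spaceP; split; first exact: eq_analytic Af.
by rewrite -(eq_wint alpha fh).
Qed.

Lemma measurable_wintZ (k : R) f : analytic_on_disc f ->
  cmeasurable_fun D (fun z => k * (modulus (f z) ^+ 2 * (1 - modulus z ^+ 2) `^ alpha)).
Proof.
move=> Af; apply: cmeasurable_funM; first exact: cmeasurable_fun_cst.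
by apply: cmeasurable_wint; [exact: cmeasurable_disc|exact: subset_refl|exact: Af].
Qed.

Lemma wintZ (k : R) f : 0 <= k -> analytic_on_disc f ->
  area_integral D (fun z => k * (modulus (f z) ^+ 2 * (1 - modulus z ^+ 2) `^ alpha)) = (k%:E * W f)%E.
Proof.
move=> k0 Af; apply: area_integralZ => //; first exact: cmeasurable_disc.
  by apply: cmeasurable_wint; [exact: cmeasurable_disc|exact: subset_refl|exact: Af].
by move=> z _; exact: wint_fun_ge0.
Qed.

Lemma wint_comb_le b f h : analytic_on_disc f -> analytic_on_disc h ->
  (W (fun z => b * f z + h z)%R <= (2 * modulus b ^+ 2)%:E * W f + 2%:E * W h)%E.
Proof.
move=> Af Ah; have c0 : 0 <= 2 * modulus b ^+ 2 by rewrite mulr_ge0// sqr_ge0.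
rewrite -(wintZ c0 Af) -(wintZ (ler0n R 2) Ah) -area_integralD; last first.
- by move=> z _; rewrite mulr_ge0 ?wint_fun_ge0.
- by move=> z _; rewrite mulr_ge0 ?wint_fun_ge0.
- exact: measurable_wintZ.
- exact: measurable_wintZ.
- exact: cmeasurable_disc.
apply: le_area_integral; first exact: cmeasurable_disc.
- by apply: cmeasurable_wint; [exact: cmeasurable_disc|exact: subset_refl|exact: analytic_comb].
- by apply: cmeasurable_funD; exact: measurable_wintZ.
- by move=> z _; exact: (wint_fun_ge0 alpha (fun z => b * f z + h z) z).
move=> z _; rewrite !mulrA -mulrDl ler_wpM2r ?powR_ge0//.
have := ler_modulusD (b * f z) (h z); rewrite modulusM.
move: (modulus_ge0 (b * f z + h z)) (modulus b) (modulus (f z)) (modulus (h z)).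
move: (modulus (_ + _)) => m m0' p q r h1; have := sqr_ge0 (p * q - r).
have : m ^+ 2 <= (p * q + r) ^+ 2 by rewrite ler_pXn2r ?nnegrE//; lra.
lra.
Qed.

Lemma bergman_space_comb b f h : bergman_space alpha f -> bergman_space alpha h ->
  bergman_space alpha (fun z => b * f z + h z).
Proof.
move=> Bf Bh; have /bergman_spaceP[Af _] := Bf; have /bergman_spaceP[Ah _] := Bh.
apply/bergman_spaceP.
split; first exact: (@analytic_comb R b f h Af Ah).
apply: le_lt_trans (wint_comb_le b Af Ah) _.
by rewrite (wintE Bf) (wintE Bh) -!EFinM -EFinD ltry.
Qed.

Lemma sq_comb_le b f h : bergman_space alpha f -> bergman_space alpha h ->
  sq (fun z => b * f z + h z) <= 2 * modulus b ^+ 2 * sq f + 2 * sq h.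
Proof.
move=> Bf Bh; have /bergman_spaceP[Af _] := Bf; have /bergman_spaceP[Ah _] := Bh.
have := wint_comb_le b Af Ah.
by rewrite (wintE (bergman_space_comb b Bf Bh)) (wintE Bf) (wintE Bh).
Qed.

Lemma bergman_space0 : bergman_space alpha (fun=> 0 : R[i]).
Proof.
apply/bergman_spaceP; split; first exact: analytic_cst.
rewrite /wint; under eq_area_integral do rewrite modulus0 expr0n/= mul0r.
by rewrite area_integral_cst ?mul0e ?ltry//; exact: cmeasurable_disc.
Qed.

Lemma bergman_spaceZ b f : bergman_space alpha f -> bergman_space alpha (fun z => b * f z).
Proof.
move=> Bf; apply: bergman_space_eq (bergman_space_comb b Bf bergman_space0).
by move=> z _; rewrite addr0.
Qed.

Lemma bergman_spaceB f h : bergman_space alpha f -> bergman_space alpha h ->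
  bergman_space alpha (fun z => f z - h z).
Proof.
move=> Bf Bh; apply: bergman_space_eq (bergman_space_comb (-1) Bh Bf).
by move=> z _; rewrite mulN1r addrC.
Qed.

Lemma sqZ b f : bergman_space alpha f -> sq (fun z => b * f z) = modulus b ^+ 2 * sq f.
Proof.
move=> Bf; have /bergman_spaceP[Af _] := Bf; apply: EFin_inj.
rewrite -wintE; last exact: bergman_spaceZ.
rewrite EFinM -(wintE Bf) -(wintZ (sqr_ge0 _) Af).
by apply: eq_area_integral => z _; rewrite modulusM exprMn mulrA.
Qed.

(* Integrates the identity [|v + c x|^2 + c (1 - c) |x|^2 = (1 - c) |v|^2 + c |x + v|^2]. *)
Lemma sq_convex (c : R) v x : 0 <= c <= 1 -> bergman_space alpha v -> bergman_space alpha x ->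
  sq (fun z => c%:C * x z + v z) + c * (1 - c) * sq x = (1 - c) * sq v + c * sq (fun z => 1 * x z + v z).
Proof.
move=> c01 Bv Bx; have /bergman_spaceP[Av _] := Bv; have /bergman_spaceP[Ax _] := Bx.
have B1 := bergman_space_comb c%:C Bx Bv; have B2 := bergman_space_comb 1 Bx Bv.
have Z (k : R) u : 0 <= k -> bergman_space alpha u ->
    (k * sq u)%:E = area_integral D (fun z => k * (modulus (u z) ^+ 2 * (1 - modulus z ^+ 2) `^ alpha)).
  by move=> k0 Bu; have /bergman_spaceP[Au _] := Bu; rewrite EFinM -(wintE Bu) (wintZ k0 Au).
have mZ (k : R) u : bergman_space alpha u -> cmeasurable_fun D (fun z => k * (modulus (u z) ^+ 2 * (1 - modulus z ^+ 2) `^ alpha)).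
  by move=> /bergman_spaceP[Au _]; exact: measurable_wintZ.
have P (k : R) u z : 0 <= k -> D z -> 0 <= k * (modulus (u z) ^+ 2 * (1 - modulus z ^+ 2) `^ alpha).
  by move=> k0 _; rewrite mulr_ge0 ?wint_fun_ge0.
have c0 : 0 <= c by lra.
have c1 : 0 <= 1 - c by lra.
have c2 : 0 <= c * (1 - c) by rewrite mulr_ge0.
have mD := @cmeasurable_disc R.
apply: EFin_inj; rewrite -[sq (fun z => c%:C * x z + v z)]mul1r 2!EFinD.
rewrite (Z _ _ ler01 B1) (Z _ _ c2 Bx) (Z _ _ c1 Bv) (Z _ _ c0 B2).
rewrite -(area_integralD mD (mZ _ _ B1) (mZ _ _ Bx) (P _ _ ^~ ler01) (P _ _ ^~ c2)).
rewrite -(area_integralD mD (mZ _ _ Bv) (mZ _ _ B2) (P _ _ ^~ c1) (P _ _ ^~ c0)).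
apply: eq_area_integral => z _; rewrite !sqr_modulus !creD !cimD !creM !cimM /=.
move: (_ `^ alpha) (x z) (v z) => w [p q] [r t] /=; ring.
Qed.

(** [box_sup] on the box of [z], and the comparison of the local mass with the norm. It keeps the
    norms of functions with value 1 at [z] away from zero. *)
Lemma point_evaluation z : D z -> exists2 K : R, 0 < K & forall f, bergman_space alpha f ->
  modulus (f z) ^+ 2 <= K * sq f.
Proof.
move=> /box_cover[n [k [kn bz]]]; have r0 := rr_gt0 R n.
pose K := 2 ^+ 15 * 4 `^ `|alpha| / rr R n `^ alpha / rr R n ^+ 2.
have ra := powR_gt0 alpha r0.
exists K; first by rewrite /K !mulr_gt0 ?invr_gt0 ?exprn_gt0 ?powR_gt0.
move=> f Bf; have /bergman_spaceP[Af _] := Bf.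
have h1 : modulus (f z) ^+ 2 * rr R n ^+ 2 <= 2 ^+ 15 * locI f (n, k).
  by apply: (@box_sup _ f (n, k) z z Af bz); rewrite subrr modulus0 /=; lra.
have h2 : rr R n `^ alpha * locI f (n, k) <= 4 `^ `|alpha| * sq f.
  rewrite -lee_fin [in leRHS]EFinM -(wintE Bf); apply: le_trans (wloc_le alpha (n, k) Af) _.
  apply: lee_wpmul2l; first by rewrite lee_fin powR_ge0.
  apply: area_integral_subset; [exact: cmeasurable_nbox|exact: cmeasurable_disc| | |exact: nbox_disc].
    by apply: cmeasurable_wint => //; exact: cmeasurable_disc.
  by move=> w _; exact: wint_fun_ge0.
rewrite /K mulrAC ler_pdivlMr ?exprn_gt0// (le_trans h1)// -(mulrA (2 ^+ 15)) -(mulrA (2 ^+ 15)) ler_wpM2l ?exprn_ge0//.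
by rewrite mulrAC ler_pdivlMr// mulrC.
Qed.

End bergman.

(** * Finite rank interpolation of almost minimal norm *)

Section projection.
Variables (R : realType) (alpha : R).
Hypothesis alpha1 : 0 < alpha + 1.
Implicit Types (f g h v x : R[i] -> R[i]) (b s z : R[i]) (k : nat) (zs : seq R[i])
  (l : nat -> (R[i] -> R[i]) -> R[i]) (u : nat -> R[i] -> R[i]).
Local Notation D := (@unit_disc R).
Local Notation space := (bergman_space alpha).
Local Notation sq := (sq alpha).

(** Linearity on all functions, so that the finite rank maps built below are linear without side
    conditions. *)
Definition linear_functional (p : (R[i] -> R[i]) -> R[i]) :=
  forall b f h, p (fun w => b * f w + h w) = b * p f + p h.

Definition comb k l u f : R[i] -> R[i] := fun z => \sum_(i < k) l i f * u i z.

Lemma bergman_space_sum k (c : nat -> R[i]) u : (forall i, space (u i)) ->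
  space (fun z => \sum_(i < k) c i * u i z).
Proof.
move=> Bu; elim: k => [|k IH].
  by apply: (bergman_space_eq alpha1 _ (bergman_space0 alpha1)) => z _; rewrite big_ord0.
apply: (bergman_space_eq alpha1 _ (bergman_space_comb alpha1 (c k) (Bu k) IH)) => z _.
by rewrite big_ord_recr/= addrC.
Qed.

Lemma comb_linear k l u z : (forall i, linear_functional (l i)) ->
  linear_functional (fun f => comb k l u f z).
Proof.
move=> Ll b f h; rewrite /comb mulr_sumr -big_split/=; apply: eq_bigr => i _.
by rewrite Ll; ring.
Qed.

Lemma eq_sq f h : (forall z, D z -> f z = h z) -> sq f = sq h.
Proof. by move=> fh; rewrite /sq (eq_wint alpha fh). Qed.

Section near_minimizer.
Variables (zs : seq R[i]) (z0 : R[i]) (v0 : R[i] -> R[i]).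
Hypotheses (Dz0 : D z0) (Bv0 : space v0) (v0zs : forall z, z \in zs -> v0 z = 0)
  (v0z0 : v0 z0 != 0).

Definition competitor v := [/\ space v, forall z, z \in zs -> v z = 0 & v z0 = 1].

(** The infimum of [sq] over competitors is positive by point evaluation, so some competitor is
    below the infimum divided by [t]. *)
Lemma near_minimizer (t : R) : 0 < t < 1 -> exists2 v, competitor v &
  forall w, competitor w -> t * sq v <= sq w.
Proof.
move=> t01; have [K K0 HK] := point_evaluation alpha1 Dz0.
pose S := [set sq v | v in competitor].
have S0 : S !=set0.
  exists (sq (fun z => (v0 z0)^-1 * v0 z)), (fun z => (v0 z0)^-1 * v0 z) => //; split.
  - exact: bergman_spaceZ.
  - by move=> z /v0zs ->; rewrite mulr0.
  by rewrite mulVf.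
have lbS : lbound S K^-1.
  move=> _ [v [Bv _ v1] <-]; have := HK _ Bv; rewrite v1 modulus1 expr1n.
  by rewrite mulrC -ler_pdivrMr// div1r.
have iS : K^-1 <= inf S by apply: lb_le_inf.
have i0 : 0 < inf S by apply: lt_le_trans iS; rewrite invr_gt0.
have e0 : 0 < inf S / t - inf S.
  by rewrite subr_gt0 ltr_pdivlMr; [rewrite gtr_pMr; lra|lra].
have hi : has_inf S by split=> //; exists K^-1.
have [_ [v cv <-]] := inf_adherent e0 hi.
rewrite addrC subrK ltr_pdivlMr; last lra.
move=> hv; exists v => // w cw; rewrite mulrC (le_trans (ltW hv))//.
by apply: ge_inf; [exists K^-1|exists w].
Qed.

End near_minimizer.

(* Near-minimality of [v] says [sq (v + a x) >= t sq v] for all scalars [a], when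
   [x] vanishes on [z0 :: zs]. This bounds the cosine of the angle between [v] and
   [x], a symmetric condition, whence the same inequality with the roles exchanged. *)
Lemma near_minimizer_sym zs z0 v x s (t : R) : 0 < t < 1 -> competitor zs z0 v ->
  (forall w, competitor zs z0 w -> t * sq v <= sq w) -> space x ->
  (forall z, z \in zs -> x z = 0) -> x z0 = 0 ->
  t * sq x <= sq (fun z => 1 * x z + s * v z).
Proof.
move=> t01 [Bv vzs vz0] vmin Bx xzs xz0; pose c := 1 - t.
have c01 : 0 <= c <= 1 by rewrite /c; lra.
have Bsv := bergman_spaceZ alpha1 s Bv.
have := sq_convex alpha1 c01 Bsv Bx.
have : t * sq (fun z => s * v z) <= sq (fun z => c%:C * x z + s * v z).
  have [->|s0] := eqVneq s 0.
    rewrite (sqZ alpha1 0 Bv) modulus0 expr0n/= mul0r mulr0; exact: sq_ge0.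
  pose y := fun z => (s^-1 * c%:C) * x z + v z.
  have By : space y by exact: bergman_space_comb.
  have cy : competitor zs z0 y.
    split=> // [z zz|]; rewrite /y; first by rewrite xzs// vzs// mulr0 addr0.
    by rewrite xz0 vz0 mulr0 add0r.
  have := ler_wpM2l (sqr_ge0 (modulus s)) (vmin _ cy).
  rewrite -(sqZ alpha1 s By) mulrCA -(sqZ alpha1 s Bv).
  congr (_ <= _); apply: eq_sq => z _.
  by rewrite /y mulrDr !mulrA divff// mul1r.
have -> : 1 - c = t by rewrite /c opprB addrC subrK.
move: (sq (fun z => s * v z)) (sq (fun z => c%:C * x z + _)) (sq (fun z => 1 * x z + _)) (sq x) => p q r e h1 h2.
have c0 : 0 < c by rewrite /c; lra.
rewrite -(ler_pM2l c0); lra.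
Qed.

(** Approximate Gram-Schmidt, one point at a time: the value of the current remainder at the new
    point [z0] is removed by a multiple of a near minimiser [v] that vanishes at the earlier points
    and is 1 at [z0]. Near minimality makes [v] almost orthogonal to the new remainder, so each
    point costs at most a factor [t]. *)
Theorem projection (t : R) zs : 0 < t < 1 -> (forall z, z \in zs -> D z) ->
  exists k l u, [/\ (k <= size zs)%N, forall i, space (u i), forall i, linear_functional (l i),
    forall f z, space f -> z \in zs -> f z - comb k l u f z = 0
    & forall f, space f -> t ^+ size zs * sq (fun z => f z - comb k l u f z) <= sq f].
Proof.
move=> t01; elim: zs => [|z0 zs IH] Dzs.
  exists 0%N, (fun=> fun=> 0), (fun=> fun=> 0); split=> //.
  - by move=> _; exact: bergman_space0.
  - by move=> _ b f h; rewrite mulr0 addr0.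
  move=> f Bf; rewrite expr0 mul1r; apply: eqW; apply: eq_sq => z _.
  by rewrite /comb big_ord0 subr0.
have Dz0 : D z0 by apply: Dzs; rewrite mem_head.
have [|k [l [u [ks Bu Ll van norm]]]] := IH.
  by move=> z zz; apply: Dzs; rewrite inE zz orbT.
have Bcomb f : space (comb k l u f) by exact: (@bergman_space_sum k (fun i => l i f) u Bu).
have BQ f : space f -> space (fun z => f z - comb k l u f z).
  by move=> Bf; exact: (bergman_spaceB alpha1 Bf (Bcomb f)).
(* If every function vanishing at the earlier points vanishes at [z0] too (for instance when [z0] is
   repeated), the previous interpolant already works. *)
have [[v0 [Bv0 v0zs v0z0]]|none] := pselect (exists v, [/\ space v, forall z, z \in zs -> v z = 0 & v z0 != 0]); last first.
  exists k, l, u; split=> //.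
  - exact: leqW.
  - move=> f z Bf; rewrite inE => /orP[/eqP ->|]; last exact: van.
    apply/eqP; apply: contrapT => /negP h; apply: none.
    exists (fun z => f z - comb k l u f z); split; [exact: BQ| |exact: h].
    by move=> w wz; exact: van.
  move=> f Bf; apply: le_trans (norm f Bf); rewrite ler_wpM2r ?sq_ge0//= exprS ler_piMl//; [|lra].
  by rewrite exprn_ge0; lra.
have [v [Bv vzs vz0] vmin] := near_minimizer Dz0 Bv0 v0zs v0z0 t01.
pose l' i := if i == k then (fun f => f z0 - comb k l u f z0) else l i.
pose u' i := if i == k then v else u i.
have combE f z : comb k.+1 l' u' f z = comb k l u f z + (f z0 - comb k l u f z0) * v z.
  rewrite /comb big_ord_recr /= /l' /u' eqxx; congr (_ + _).
  by apply: eq_bigr => i _; rewrite (ltn_eqF (ltn_ord i)).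
exists k.+1, l', u'; split=> //.
- by move=> i; rewrite /u'; case: ifP.
- move=> i; rewrite /l'; case: ifP => // _ b f h.
  by rewrite (comb_linear k u z0 Ll); ring.
- move=> f z Bf; rewrite combE inE => /orP[/eqP ->|zz]; first by rewrite vz0; ring.
  by rewrite vzs// mulr0 addr0; exact: van.
move=> f Bf; set s := f z0 - comb k l u f z0.
pose x z := f z - comb k.+1 l' u' f z.
have xE z : x z = (- s) * v z + (f z - comb k l u f z) by rewrite /x combE -/s; ring.
have Bx : space x.
  have B := bergman_space_comb alpha1 (- s) Bv (BQ f Bf).
  by apply: (bergman_space_eq alpha1 _ B) => z _; rewrite xE.
have := near_minimizer_sym s t01 (And3 Bv vzs vz0) vmin Bx.
have h1 z : z \in zs -> x z = 0 by move=> zz; rewrite xE vzs// mulr0 add0r van.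
have h2 : x z0 = 0 by rewrite xE vz0 -/s mulr1 addNr.
move=> /(_ h1 h2).
have -> : sq (fun z => 1 * x z + s * v z) = sq (fun z => f z - comb k l u f z).
  by apply: eq_sq => z _; rewrite xE; ring.
move=> h; rewrite /= exprSr -mulrA; apply: le_trans (norm f Bf).
by rewrite ler_wpM2l// exprn_ge0; lra.
Qed.

End projection.

(** * The symbol *)


Section dyadic_arcs.
Variable R : realType.
Implicit Types (n k : nat) (q : nat * nat) (z w : R[i]) (t : R) (g : R[i] -> R[i]).
Local Notation rr := (rr R).

(* The arcs are indexed from [1] to [2 ^ n], the boxes from [0] to [2 ^ n - 1]. *)
Definition arc_box q : nat * nat := (q.1, (q.2 %% 2 ^ q.1)%N).

(** The last arc [k = 2 ^ n] is the arc of index 0 after one full turn. *)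
Lemma dyadic_arcP n k w : (1 <= k <= 2 ^ n)%N ->
  @dyadic_arc R (n, k) w <->
  exists2 t, 2 * pi * (k %% 2 ^ n)%N%:R * rr n <= t < 2 * pi * (k %% 2 ^ n)%N.+1%:R * rr n & w = expi t.
Proof.
move=> /andP[k1]; rewrite leq_eqVlt => /predU1P[->|kn]; last first.
  rewrite modn_small//; split; first by move=> [t ht <-]; exists t.
  by move=> [t ht ->]; exists t.
have N0 : (2 ^ n)%:R * rr n = 1 :> R by rewrite natrX mulrC rr_nat.
have N1 : (2 ^ n).+1%:R * rr n = 1 + rr n :> R by rewrite -natr1 mulrDl N0 mul1r.
rewrite modnn; split.
  move=> [t ht <-]; exists (t - 2 * pi); last by rewrite -{1}(subrK (2 * pi) t) expiD2pi.
  by move: ht; rewrite /= -/(rr n) -!mulrA N0 N1; lra.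
move=> [t ht ->]; exists (t + 2 * pi); last exact: expiD2pi.
by rewrite /= -/(rr n) -!mulrA N0 N1; lra.
Qed.

Lemma box_arc_range n k t : (k < 2 ^ n)%N ->
  2 * pi * k%:R * rr n <= t < 2 * pi * k.+1%:R * rr n -> 0 <= t < 2 * pi.
Proof.
move=> kn ht; have p0 := pi_ge0 R.
have : 0 <= 2 * pi * k%:R * rr n by rewrite !mulr_ge0// rr_ge0.
have : 2 * pi * k.+1%:R * rr n <= 2 * pi.
  rewrite -mulrA ler_piMr ?mulr_ge0//.
  by rewrite /rr ler_pdivrMr ?exprn_gt0// mul1r -natrX ler_nat.
lra.
Qed.

Lemma arc_length_dyadic n k : (1 <= k <= 2 ^ n)%N ->
  arc_length (@dyadic_arc R (n, k)) = 2 * pi * rr n.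
Proof.
move=> hk; rewrite /arc_length; set j := (k %% 2 ^ n)%N.
have jn : (j < 2 ^ n)%N by rewrite ltn_mod expn_gt0.
have -> : [set t : R | 0 <= t < 2 * pi /\ @dyadic_arc R (n, k) (expi t)] =
    `[2 * pi * j%:R * rr n, 2 * pi * j.+1%:R * rr n[%classic.
  apply/seteqP; split => t /=; rewrite in_itv/=.
    by move=> [t2 /(dyadic_arcP _ hk)[s hs /expi_inj -> //]]; exact: box_arc_range hs.
  move=> ht; split; first exact: box_arc_range ht.
  by apply/(dyadic_arcP _ hk); exists t.
rewrite lebesgue_measure_itv/= lte_fin ltr_pM2r ?rr_gt0// ltr_pM2l ?mulr_gt0 ?pi_gt0// ltr_nat ltnSn.
by rewrite /= -natr1; ring.
Qed.

(** Since [n >= 1], points of the region have modulus at least 1/2, so that [z / |z|] is a point of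
    the circle. *)
Lemma arc_region_dyadic n k : (1 <= n)%N -> (1 <= k <= 2 ^ n)%N ->
  arc_region (@dyadic_arc R (n, k)) = box n (k %% 2 ^ n)%N.
Proof.
move=> n1 hk; rewrite /arc_region arc_length_dyadic//.
have p0 := pi_gt0 R; have r0 := rr_gt0 R n; have rS := rrS R n.
have -> : 2 * pi * rr n / (4 * pi) = rr n.+1 by apply: (canLR (mulfK _)); [rewrite gt_eqF// mulr_gt0|rewrite rS; ring].
have -> : 2 * pi * rr n / (2 * pi) = rr n by apply: (canLR (mulfK _)); [rewrite gt_eqF// mulr_gt0|ring].
have r2 : rr n <= 2^-1 by have := rr_le R n1; have := rrS R 0; rewrite rr0; lra.
have nz z : rr n.+1 < 1 - modulus z <= rr n -> (modulus z)%:C != 0.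
  by move=> h; rewrite -[0]/(0%:C) (inj_eq (@complexI R)) gt_eqF//; lra.
apply/seteqP; split => z.
  move=> [z1 h /(dyadic_arcP _ hk)[t ht zE]]; split=> //; exists t => //.
  by rewrite -zE normE mulrC divfK// nz.
move=> [h [t ht zE]]; split=> //; first by rewrite /unit_disc/=; have := rr_gt0 R n.+1; lra.
by apply/(dyadic_arcP _ hk); exists t => //; rewrite normE {1}zE mulrAC divff ?nz// mul1r.
Qed.

Definition box_mean g q : R := fine (symbol_measure g (box q.1 q.2)) / fine (area (@box R q.1 q.2)).

Lemma symbol_mean_dyadic g q : dyadic_index q ->
  symbol_mean g (@dyadic_arc R q) = box_mean g (arc_box q).
Proof. by case: q => n k [/= n1 k1]; rewrite /symbol_mean arc_region_dyadic. Qed.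

Lemma arc_box_valid q : valid (arc_box q).
Proof. by rewrite /valid /arc_box/= ltn_mod expn_gt0. Qed.

Lemma arc_box_surj q : valid q -> q = (0, 0)%N \/ exists2 q', dyadic_index q' & arc_box q' = q.
Proof.
case: q => [[|n] k]; rewrite /valid/= => kn.
  by left; move: kn; rewrite expn0 ltnS leqn0 => /eqP ->.
right; case: k kn => [|k] kn.
  exists (n.+1, (2 ^ n.+1)%N); first by split=> //=; rewrite leqnn expn_gt0.
  by rewrite /arc_box/= modnn.
exists (n.+1, k.+1); first by split=> //=; exact: ltnW.
by rewrite /arc_box/= modn_small.
Qed.

Lemma arc_box_inj q q' : dyadic_index q -> dyadic_index q' -> arc_box q = arc_box q' -> q = q'.
Proof.
case: q q' => [n k] [n' k'] [/= _ hk] [/= _ hk'] [nn]; subst n'.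
have E j : (1 <= j <= 2 ^ n)%N -> j = (if j %% 2 ^ n == 0 then 2 ^ n else j %% 2 ^ n)%N.
  move=> /andP[j1]; rewrite leq_eqVlt => /predU1P[->|jn]; first by rewrite modnn eqxx.
  by rewrite modn_small// gtn_eqF.
by move=> kk; rewrite (E k hk) (E k' hk') kk.
Qed.

End dyadic_arcs.

(** * The symbol measure of a little Bloch function *)

Section bloch.
Variables (R : realType) (g : R[i] -> R[i]).
Hypothesis Bg : little_bloch g.
Implicit Types (q : nat * nat) (z : R[i]) (f : R[i] -> R[i]).
Local Notation D := (@unit_disc R).
Local Notation dg := (complex_derive g).

Lemma bloch_analytic : analytic_on_disc g. Proof. by case: Bg. Qed.

Lemma bloch_derive_analytic : analytic_on_disc dg.
Proof. exact: derive_analytic bloch_analytic. Qed.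

(** Below 1 near the circle by the little Bloch condition, bounded on the remaining disc by
    compactness. *)
Lemma bloch_bounded : exists2 B : R, 0 < B & forall z, D z ->
  modulus (dg z) ^+ 2 * (1 - modulus z ^+ 2) ^+ 2 <= B.
Proof.
have [_ /(_ 1 ltr01)[r r1 hr]] := Bg.
have [B B0 HB] := analytic_bounded bloch_derive_analytic r1.
exists (B ^+ 2 + 1); first by rewrite ltr_pwDr// sqr_ge0.
move=> z z1; have w0 := weight_gt0 z1; have w1 : 1 - modulus z ^+ 2 <= 1.
  by rewrite gerBl sqr_ge0.
rewrite -exprMn; have d0 := modulus_ge0 (dg z).
have [zr|zr] := leP (modulus z) r.
  have := HB z zr; move: (modulus (dg z)) (1 - _) d0 w0 w1 => d w d0 w0 w1 dB.
  have : d * w <= B by rewrite (le_trans _ dB)// ler_piMr.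
  have dw0 : 0 <= d * w by rewrite mulr_ge0// ltW.
  by move=> h; have := lerXn2r 2 dw0 (ltW B0) h; rewrite ?nnegrE; lra.
have := hr z; rewrite zr z1/= => /(_ isT).
move: (modulus (dg z)) (1 - _) d0 w0 => d w d0 w0 h.
have dw0 : 0 <= w * d by rewrite mulr_ge0// ltW.
by have := sqr_ge0 B; rewrite mulrC; nra.
Qed.

Lemma symbol_measureE E : E `<=` D -> symbol_measure g E = wint 2 E dg.
Proof.
move=> ED; apply: eq_area_integral => z /ED/weight_gt0/ltW w0.
by rewrite -[2]/(2%:R) powR_mulrn.
Qed.

Lemma box_mean_ge0 q : 0 <= box_mean g q.
Proof. by rewrite divr_ge0// fine_ge0// /symbol_measure ?measure_ge0//; apply: area_integral_ge0 => z _; rewrite mulr_ge0 ?sqr_ge0. Qed.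

(** [A] is the area of the box, comparable to [rr ^ 2]; the form of the conclusion clears the
    quotient in [box_mean]. *)
Lemma box_mean_mul q : valid q ->
  exists2 A : R, rr R q.1 ^+ 2 / 256 <= A <= 162 * rr R q.1 ^+ 2 &
    wint 2 (box q.1 q.2) dg = (box_mean g q * A)%:E.
Proof.
move=> vq; have Al := area_box_ge R vq; have Au := area_box_le R q.1 q.2.
exists (fine (area (@box R q.1 q.2))).
  move: Al Au; case: (area _) => [A| |]//=; by rewrite !lee_fin => -> ->.
have [B B0 HB] := bloch_bounded.
rewrite /box_mean divfK; last first.
  move: Al Au; case: (area _) => [A| |]//=; rewrite !lee_fin => h _.
  by rewrite gt_eqF//; apply: lt_le_trans h; rewrite divr_gt0 ?exprn_gt0 ?rr_gt0.
have ED := @box_disc R q.1 q.2.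
rewrite symbol_measureE// fineK//.
apply: (@area_integral_fin _ _ _ B) => //; first exact: cmeasurable_box.
  by apply: cmeasurable_wint; [exact: cmeasurable_box|exact: ED|exact: bloch_derive_analytic].
move=> z /ED z1; rewrite wint_fun_ge0/= -[X in _ `^ X]/(2%:R) powR_mulrn ?HB//.
exact/ltW/weight_gt0.
Qed.

End bloch.

(** * The rearranged means in terms of boxes *)

Section rearrangement.
Variables (R : realType) (g : R[i] -> R[i]).
Implicit Types (a : nat -> R) (m : nat).

(** [S] consists of the boxes of the first [m - 1] arcs and of the central box, which belongs to no
    arc and whose mean is therefore not controlled by [a]. *)
Lemma rearrangement_outside a m : (1 <= m)%N -> decreasing_rearrangement g a ->
  0 <= a m /\ exists S, [/\ size S = m, all valid S &
    forall q, valid q -> q \notin S -> box_mean g q <= a m].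
Proof.
move=> m1 [e [[eD _ eS] ae am]]; split.
  by rewrite ae// symbol_mean_dyadic ?box_mean_ge0//; exact: eD.
exists ((0, 0)%N :: [seq arc_box (e j) | j <- iota 1 m.-1]); split.
- by rewrite /= size_map size_iota prednK.
- by rewrite /= all_map; apply/allP => j _; exact: arc_box_valid.
move=> q vq; rewrite inE negb_or => /andP[q0 qS].
have [qE|[q' dq' qE]] := arc_box_surj vq; first by rewrite qE eqxx in q0.
have [j /= j1 ej] := eS q' dq'.
rewrite -qE -symbol_mean_dyadic// -ej -ae//; apply: am; rewrite m1/= leqNgt.
apply: contra qS => jm; apply/mapP; exists j; last by rewrite ej qE.
by rewrite mem_iota; lia.
Qed.

Lemma rearrangement_inside a m : decreasing_rearrangement g a ->
  exists s, [/\ uniq s, size s = m, all valid s & forall q, q \in s -> a m <= box_mean g q].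
Proof.
move=> [e [[eD eI _] ae am]]; exists [seq arc_box (e j) | j <- iota 1 m]; split.
- rewrite map_inj_in_uniq ?iota_uniq// => i j; rewrite !mem_iota => /andP[i1 _] /andP[j1 _].
  move=> /(arc_box_inj (eD i i1) (eD j j1)) => E.
  by apply: eI; rewrite ?inE.
- by rewrite size_map size_iota.
- by rewrite all_map; apply/allP => j _; exact: arc_box_valid.
move=> _ /mapP[j + ->]; rewrite mem_iota => /andP[j1 jm].
by rewrite -(symbol_mean_dyadic g (eD j j1)) -(ae j j1); apply: am; rewrite j1; lia.
Qed.

End rearrangement.

(** * Upper bound *)


Section upper.
Variables (R : realType) (alpha : R).
Hypothesis alpha1 : 0 < alpha + 1.
Implicit Types (q : nat * nat) (s : seq (nat * nat)) (z : R[i]) (zs : seq R[i]) (f g h F : R[i] -> R[i]).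
Local Notation D := (@unit_disc R).
Local Notation rr := (rr R).
Local Notation space := (bergman_space alpha).
Local Notation sq := (sq alpha).

Lemma weight_split (x : R) : 0 < x -> x `^ (alpha + 2) = x `^ alpha * x `^ 2.
Proof. by move=> x0; rewrite powRD//; apply/implyP => _; rewrite gt_eqF. Qed.

(** [|f|^2] is replaced by its bound from [box_sup]; what remains is the symbol measure of the box,
    that is its mean times its area. *)
Lemma box_symbol_le f g q : little_bloch g -> analytic_on_disc f -> valid q ->
  (wint (alpha + 2) (box q.1 q.2) (fun z => f z * complex_derive g z)%R <=
    (4 `^ `|alpha| * 2 ^+ 15 * 162 * (rr q.1 `^ alpha * locI f q) * box_mean g q)%:E)%E.
Proof.
move=> Bg Af vq; have [A /andP[_ hA] AE] := box_mean_mul Bg vq.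
have r0 := rr_gt0 R q.1; have I0 := locI_ge0 f q.
have Ag := bloch_derive_analytic Bg.
have mE : cmeasurable (box q.1 q.2 : set R[i]) by exact: cmeasurable_box.
have ED := @box_disc R q.1 q.2.
pose c := 2 ^+ 15 * locI f q / rr q.1 ^+ 2 * (4 `^ `|alpha| * rr q.1 `^ alpha).
have c1 : 0 <= 2 ^+ 15 * locI f q / rr q.1 ^+ 2 by rewrite !mulr_ge0 ?exprn_ge0 ?invr_ge0 ?sqr_ge0.
have c0 : 0 <= c by rewrite mulr_ge0// mulr_ge0 ?powR_ge0.
apply: (@le_trans _ _ (c%:E * wint 2 (box q.1 q.2) (complex_derive g))%E); last first.
  rewrite AE -EFinM lee_fin.
  have bm := box_mean_ge0 g q; rewrite (mulrA c).
  apply: le_trans (ler_wpM2l (mulr_ge0 c0 bm) hA) _.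
  rewrite /c; apply: eqW.
  by move: (4 `^ _) (_ `^ alpha) (2 ^+ 15) (locI f q) (box_mean g q) => x y t I b; field; rewrite gt_eqF.
have m2 := cmeasurable_wint 2 mE ED Ag.
have p2 z : box q.1 q.2 z -> 0 <= modulus (complex_derive g z) ^+ 2 * (1 - modulus z ^+ 2) `^ 2.
  by move=> _; exact: wint_fun_ge0.
rewrite -(area_integralZ mE m2 p2 c0).
have Afg : analytic_on_disc (fun z => f z * complex_derive g z) by exact: (@analyticM R _ _ Af Ag).
have m1 := cmeasurable_wint (alpha + 2) mE ED Afg.
have m3 : cmeasurable_fun (box q.1 q.2) (fun z => c * (modulus (complex_derive g z) ^+ 2 * (1 - modulus z ^+ 2) `^ 2)).
  by apply: cmeasurable_funM; [exact: cmeasurable_fun_cst|exact: m2].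
apply: (le_area_integral mE m1 m3) => z bz.
  exact: (wint_fun_ge0 (alpha + 2) (fun z => f z * complex_derive g z) z).
have w0 := weight_gt0 (ED z bz).
rewrite (weight_split w0) modulusM exprMn.
have h1 : modulus (f z) ^+ 2 <= 2 ^+ 15 * locI f q / rr q.1 ^+ 2.
  rewrite ler_pdivlMr ?exprn_gt0//; apply: (box_sup Af bz).
  by rewrite subrr modulus0; lra.
have d0 : 0 < 4^-1 :> R by [].
have [h2 _] := nbox_powR alpha (box_nbox d0 bz).
have h3 := ler_pM (sqr_ge0 _) (powR_ge0 _ _) h1 h2.
have := ler_wpM2r (p2 z bz) h3; rewrite -/c.
move: (modulus (f z) ^+ 2) (modulus (complex_derive g z) ^+ 2) (_ `^ alpha) (_ `^ 2) => x y t u.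
by rewrite mulrACA.
Qed.

(** A square of half-side [9 rr] containing the box is cut into [N^2] cells, with [N >= 36 / eta],
    and one point of the box is taken in each cell that meets it. By scaling, [K = N^2] is the same
    for all boxes. *)
Lemma box_mesh (eta : R) : 0 < eta -> exists K : nat, forall q, valid q ->
  exists zs, [/\ (size zs <= K)%N, forall z, z \in zs -> box q.1 q.2 z &
    forall z, box q.1 q.2 z -> exists2 y, y \in zs & modulus (z - y) <= eta * rr q.1].
Proof.
move=> eta0; pose N := (Num.truncn (36 / eta)).+1.
have N0 : 0 < N%:R :> R by rewrite ltr0n.
have hN : 36 / N%:R <= eta.
  by rewrite ler_pdivrMr// mulrC -ler_pdivrMr// ltW// truncnS_gt.
exists (N * N)%N => q vq; pose r := rr q.1; have r0 : 0 < r := rr_gt0 R q.1.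
pose c := boxc R q.1 q.2; pose d := 18 * r / N%:R.
have d0 : 0 < d by rewrite divr_gt0// mulr_gt0.
pose S (i j : nat) := [set z : R[i] | [/\ box q.1 q.2 z,
  i%:R * d <= complex.Re (z - c) + 9 * r <= i.+1%:R * d &
  j%:R * d <= complex.Im (z - c) + 9 * r <= j.+1%:R * d]].
pose pt i j := xget (boxm R q.1 q.2) (S i j).
have bm : box q.1 q.2 (boxm R q.1 q.2).
  by apply: box_contains => //; rewrite subrr modulus0; have := rr_gt0 R q.1; lra.
exists [seq pt i j | i <- iota 0 N, j <- iota 0 N]; split.
- by rewrite size_allpairs !size_iota.
- move=> _ /allpairsP[[i j] [_ _ ->]] /=; rewrite /pt.
  by case: xgetP => [z _ [] //|_].
move=> z bz; have dz := box_dist bz; rewrite -/c -/r in dz.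
have cell (x : R) : 0 <= x <= 18 * r -> exists2 i : nat, (i < N)%N & i%:R * d <= x <= i.+1%:R * d.
  move=> /andP[x0 x1]; have q0 : 0 <= x / d by rewrite divr_ge0// ltW.
  have /andP[t1 t2] := truncn_itv q0; rewrite ler_pdivlMr// in t1; rewrite ltr_pdivrMr// in t2.
  have [tN|tN] := ltnP (Num.truncn (x / d)) N; first by exists (Num.truncn (x / d)) => //; rewrite t1 ltW.
  exists N.-1 => //; rewrite prednK//.
  have dN : N%:R * d = 18 * r by rewrite mulrC divfK// gt_eqF.
  rewrite dN x1 andbT; apply: le_trans t1; rewrite ler_pM2r// ler_nat.
  exact: leq_trans (leq_pred _) tN.
have := le_trans (normr_Re_le _) dz; have := le_trans (normr_Im_le _) dz.
rewrite !ler_norml => hIm hRe.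
have [|i iN hi] := @cell (complex.Re (z - c) + 9 * r); first lra.
have [|j jN hj] := @cell (complex.Im (z - c) + 9 * r); first lra.
exists (pt i j); first by apply/allpairsP; exists (i, j); rewrite !mem_iota.
have Sz : S i j z by [].
have [_ hi' hj'] : S i j (pt i j) by rewrite /pt; case: xgetP => [w _ //|/(_ z)].
apply: le_trans (modulus_le_ReIm _) _.
have dd : 2 * d <= eta * r.
  have -> : 2 * d = 36 / N%:R * r by rewrite /d; ring.
  by rewrite ler_pM2r.
have e1 x : x.+1%:R * d = x%:R * d + d by rewrite -natr1 mulrDl mul1r.
rewrite !e1 in hi hj hi' hj'.
move: hi hj hi' hj'; rewrite !creD !cimD !creN !cimN => hi hj hi' hj'.
have : `|complex.Re z - complex.Re (pt i j)| <= d by rewrite ler_norml; lra.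
have : `|complex.Im z - complex.Im (pt i j)| <= d by rewrite ler_norml; lra.
by move=> hI hR; apply: le_trans (lerD hR hI) _; rewrite -mulr2n -mulr_natl.
Qed.

(** Every point of the box is within [eta * rr] of a zero, so [|F|] is at most [2 eta rr] times a
    bound for [|F'|], taken from [box_deriv]; [eta <= 1/16] keeps the segment to the zero in the
    range of that lemma. The gain is the factor [eta ^ 2]. *)
Lemma box_vanishing_le (b eta : R) F q zs : analytic_on_disc F -> 0 <= eta <= 16^-1 ->
  (forall z, z \in zs -> F z = 0) ->
  (forall z, box q.1 q.2 z -> exists2 y, y \in zs /\ D y & modulus (z - y) <= eta * rr q.1) ->
  (wint b (box q.1 q.2) F <= (4 `^ `|b| * 162 * 2 ^+ 35 * eta ^+ 2 * (rr q.1 `^ b * locI F q))%:E)%E.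
Proof.
move=> AF heta Fzs mesh; have r0 := rr_gt0 R q.1.
pose M := Num.sqrt (2 ^+ 33 * locI F q) / rr q.1 ^+ 2.
have K0 : 0 <= 2 ^+ 33 * locI F q by rewrite mulr_ge0 ?exprn_ge0 ?locI_ge0.
have M0 : 0 <= M by rewrite divr_ge0 ?sqrtr_ge0 ?sqr_ge0.
have M2 : M ^+ 2 * rr q.1 ^+ 4 = 2 ^+ 33 * locI F q.
  rewrite -(sqr_sqrtr K0) /M; move: (Num.sqrt _) => S.
  by field; rewrite gt_eqF.
have er0 : 0 <= eta * rr q.1 by apply: mulr_ge0; [case/andP: heta|exact: ltW].
have er1 : eta * rr q.1 <= rr q.1 / 16 by rewrite mulrC ler_pM2l//; lra.
have sup z : box q.1 q.2 z -> modulus (F z) ^+ 2 <= 4 * eta ^+ 2 * (2 ^+ 33 * locI F q) / rr q.1 ^+ 2.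
  move=> bz; have z1 := box_disc bz; have [y [yzs y1] zy] := mesh z bz.
  pose rho := Num.max (modulus z) (modulus y).
  have rho1 : rho < 1 by rewrite gt_max z1 y1.
  have zr : modulus z <= rho by rewrite le_max lexx.
  have yr : modulus y <= rho by rewrite le_max lexx orbT.
  have := @analytic_mvi R F z y rho M AF rho1 zr yr.
  have H (t : R) : 0 <= t <= 1 -> modulus (complex_derive F (z + t%:C * (y - z))) <= M.
    move=> t01; have d1 : modulus (z + t%:C * (y - z) - z) <= rr q.1 / 16.
      rewrite addrAC subrr add0r modulusM modulus_real ger0_norm; last lra.
      rewrite modulusB; apply: le_trans er1; apply: le_trans zy.
      by rewrite ler_piMl ?modulus_ge0//; lra.
    have := box_deriv AF bz d1; rewrite -M2 ler_pM2r ?exprn_gt0//.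
    by rewrite ler_pXn2r ?nnegrE ?modulus_ge0.
  move=> /(_ H); rewrite (Fzs _ yzs) sub0r modulusN modulusB => h.
  have {}h : modulus (F z) <= 2 * M * (eta * rr q.1).
    apply: (le_trans h); apply: ler_wpM2l => //; exact: mulr_ge0.
  have F0 := modulus_ge0 (F z).
  have := lerXn2r 2 _ _ h; rewrite !nnegrE => /(_ F0 (le_trans F0 h)).
  rewrite -M2 => h2; apply: (le_trans h2); apply: eqW.
  by field; rewrite gt_eqF.
have B0 : 0 <= 4 * eta ^+ 2 * (2 ^+ 33 * locI F q) / rr q.1 ^+ 2.
  have e2 : 0 <= 4 * eta ^+ 2 by apply: mulr_ge0 => //; exact: sqr_ge0.
  by apply: divr_ge0; [exact: mulr_ge0|exact: sqr_ge0].
apply: (le_trans (wint_box_le b AF B0 sup)); rewrite lee_fin; apply: eqW.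
have -> : 2 ^+ 35 = 4 * 2 ^+ 33 :> R by rewrite -[35%N]/(2 + 33)%N exprD; ring.
move: (4 `^ _) (_ `^ b) (2 ^+ 33) (locI F q) => x y t I.
by field; rewrite gt_eqF.
Qed.

Lemma bernoulli (x : R) (n : nat) : 0 <= x <= 1 -> 1 - n%:R * x <= (1 - x) ^+ n.
Proof.
move=> x01; elim: n => [|n IH]; first by rewrite mul0r subr0 expr0.
rewrite exprS -natr1; have : 0 <= n%:R * x * x by rewrite !mulr_ge0//; lra.
have y0 : 0 <= 1 - x by lra.
have := ler_wpM2l y0 IH; move: (n%:R) => N; lra.
Qed.

End upper.

(** * The operator on functions vanishing on a mesh *)

Section operator.
Variables (R : realType) (alpha : R).
Hypothesis alpha1 : 0 < alpha + 1.
Implicit Types (q : nat * nat) (s : seq (nat * nat)) (z : R[i]) (zs : seq R[i]) (f g h F : R[i] -> R[i]).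
Local Notation D := (@unit_disc R).
Local Notation rr := (rr R).
Local Notation space := (bergman_space alpha).
Local Notation sq := (sq alpha).
Local Notation Ig := integration_operator.

Lemma space_analytic f : space f -> analytic_on_disc f.
Proof. by case. Qed.

Lemma product_analytic g f : little_bloch g -> space f ->
  analytic_on_disc (fun z => f z * complex_derive g z).
Proof.
by move=> Bg Bf; exact: (@analyticM R _ _ (space_analytic Bf) (bloch_derive_analytic Bg)).
Qed.

Lemma operator_analytic g f : little_bloch g -> space f -> analytic_on_disc (Ig g f).
Proof. by move=> Bg Bf; exact: analytic_segment_integral (product_analytic Bg Bf). Qed.

Lemma operator_derive g f z : little_bloch g -> space f -> D z ->
  complex_derive (Ig g f) z = f z * complex_derive g z.
Proof. by move=> Bg Bf z1; exact: (derive_segment_integral (product_analytic Bg Bf) z1). Qed.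

(** Here the constant depends on [g]. The bound serves for finiteness; the quantitative estimates
    have constants depending on [alpha] only. *)
Lemma wint_product_le g : little_bloch g -> exists2 B : R, 0 < B & forall f, space f ->
  (wint (alpha + 2) D (fun z => f z * complex_derive g z)%R <= (B * sq f)%:E)%E.
Proof.
move=> Bg; have [B B0 HB] := bloch_bounded Bg.
exists B => // f Bf; have Af := space_analytic Bf; have B0' := ltW B0.
rewrite EFinM -(wintE alpha1 Bf) -(wintZ alpha B0' Af).
apply: le_area_integral; first exact: cmeasurable_disc.
- by apply: cmeasurable_wint; [exact: cmeasurable_disc|exact: subset_refl|exact: product_analytic].
- exact: measurable_wintZ.
- by move=> z _; exact: (wint_fun_ge0 (alpha + 2) (fun z => f z * complex_derive g z) z).
move=> z z1; have w0 := weight_gt0 z1.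
rewrite (weight_split alpha w0) -[X in _ * (_ * _ `^ X)]/(2%:R) powR_mulrn ?(ltW w0)// modulusM exprMn mulrACA mulrC.
by rewrite ler_wpM2r ?HB// mulr_ge0 ?sqr_ge0 ?powR_ge0.
Qed.

Lemma wint_product_fin g f : little_bloch g -> space f ->
  (wint (alpha + 2) D (fun z => f z * complex_derive g z)%R < +oo)%E.
Proof. by move=> /wint_product_le[B _ HB] Bf; exact: le_lt_trans (HB f Bf) (ltry _). Qed.

Lemma wint_operator_le : exists2 C : R, 0 < C & forall g f, little_bloch g -> space f ->
  (wint alpha D (Ig g f) <= C%:E * wint (alpha + 2) D (fun z => f z * complex_derive g z)%R)%E.
Proof.
have a1 : -1 < alpha by rewrite -subr_gt0 opprK.
have [C C0 HC] := hardy a1; exists C => // g f Bg Bf.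
have := HC _ (operator_analytic Bg Bf) (segment_integral0 _).
have -> : wint (alpha + 2) D (complex_derive (Ig g f)) = wint (alpha + 2) D (fun z => f z * complex_derive g z).
  by apply: eq_wint => z z1; exact: operator_derive.
exact.
Qed.

Lemma operator_space g f : little_bloch g -> space f -> space (Ig g f).
Proof.
move=> Bg Bf; apply/(bergman_spaceP alpha1); split; first exact: operator_analytic.
have [C C0 HC] := wint_operator_le; apply: le_lt_trans (HC g f Bg Bf) _.
have := wint_product_fin Bg Bf.
by case: (wint _ _ _) (wint_ge0 (alpha + 2) D (fun z => f z * complex_derive g z)) => [x _ _|//|//]; rewrite -EFinM ltry.
Qed.

Lemma operator_linear g b f h z : little_bloch g -> space f -> space h -> D z ->
  Ig g (fun w => b * f w + h w) z = b * Ig g f z + Ig g h z.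
Proof.
move=> Bg Bf Bh z1.
rewrite -(segment_integral_linear b (product_analytic Bg Bf) (product_analytic Bg Bh) z1).
by congr (segment_integral _ z); apply/funext => w; rewrite mulrDl mulrA.
Qed.

(** With [F = h g'] and [x] its weighted integral, the boxes of [S] together contribute at most
    [x / 2] because [F] vanishes on a fine mesh in each of them, and the other boxes contribute a
    multiple of [M * sq h]. Hence [x] is bounded by twice the latter, and Hardy's inequality passes
    from [x] to [I_g h]. *)
Lemma vanishing_operator_le : exists K : nat, exists2 C : R, 0 < C &
  forall g S (M : R), little_bloch g -> all valid S -> 0 <= M ->
    (forall q, valid q -> q \notin S -> box_mean g q <= M) ->
  exists zs, [/\ (size zs <= size S * K)%N, forall z, z \in zs -> D z &
    forall h, space h -> (forall z, z \in zs -> h z = 0) -> sq (Ig g h) <= C * M * sq h].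
Proof.
have [CH CH0 HH] := wint_operator_le.
pose b := alpha + 2; pose k0 : R := 4 `^ `|b| * 162 * 2 ^+ 35; pose ov : R := 4 `^ `|b| * overlap R.
have k00 : 0 < k0 by rewrite /k0 !mulr_gt0 ?powR_gt0 ?exprn_gt0.
have ov0 : 0 < ov by rewrite /ov mulr_gt0 ?powR_gt0// /overlap exprn_gt0.
(* Small enough that [eta ^ 2], times the constant of [box_vanishing_le] and that of the overlap, is
   at most 1/2. It depends on [alpha] only, hence so does [K]. *)
pose eta := (16 * (1 + k0 * ov))^-1.
have kov : 0 < k0 * ov by rewrite mulr_gt0.
have eta0 : 0 < eta by rewrite invr_gt0; lra.
have eta1 : eta <= 16^-1 by rewrite lef_pV2 ?posrE//; lra.
have etak : k0 * eta ^+ 2 * ov <= 2^-1.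
  have h : eta * (16 * (1 + k0 * ov)) = 1 by rewrite mulVf// gt_eqF//; lra.
  have -> : k0 * eta ^+ 2 * ov = eta * (eta * (k0 * ov)) by ring.
  have eu : eta * (k0 * ov) <= 16^-1 by move: (eta) eta0 h => e e0 h; lra.
  apply: le_trans (ler_wpM2l (ltW eta0) eu) _; move: (eta) eta1 => e e1; lra.
have [K HK] := box_mesh eta0.
pose k1 : R := 4 `^ `|alpha| * 2 ^+ 15 * 162; pose ov1 : R := 4 `^ `|alpha| * overlap R.
have k10 : 0 < k1 by rewrite /k1 !mulr_gt0 ?powR_gt0 ?exprn_gt0.
have ov10 : 0 < ov1 by rewrite /ov1 mulr_gt0 ?powR_gt0// /overlap exprn_gt0.
exists K, (CH * (2 * (k1 * ov1))); first by rewrite !mulr_gt0.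
move=> g S M Bg vS M0 HM.
pose mesh q : seq R[i] := if pselect (valid q) is left v then projT1 (cid (HK q v)) else [::].
have meshP q : valid q -> [/\ (size (mesh q) <= K)%N, forall z, z \in mesh q -> box q.1 q.2 z &
    forall z, box q.1 q.2 z -> exists2 y, y \in mesh q & modulus (z - y) <= eta * rr q.1].
  by move=> v; rewrite /mesh; case: pselect => // v'; case: (cid _).
exists (flatten [seq mesh q | q <- S]); split.
- elim: S vS {HM} => [|q S IH]//= /andP[vq vS]; rewrite size_cat mulSn leq_add ?IH//.
  by case: (meshP q vq).
- move=> z /flatten_mapP[q qS zq]; have [_ h _] := meshP q (allP vS q qS).
  exact: box_disc (h z zq).
move=> h Bh hz; have Ah := space_analytic Bh.
pose F z := h z * complex_derive g z; have AF : analytic_on_disc F := product_analytic Bg Bh.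
(* Finiteness is what permits subtracting [x / 2] from both sides at the end. *)
have Ffin : (wint b D F < +oo)%E := wint_product_fin Bg Bh.
pose x := fine (wint b D F).
have xE : wint b D F = x%:E by rewrite fineK// ge0_fin_numE// wint_ge0.
(* Whether [q] is in [S] or not, one of the two terms suffices; with their sum as bound, all boxes
   are summed at once. *)
have boxle q : valid q -> (wint b (box q.1 q.2) F <=
    (k0 * eta ^+ 2 * (rr q.1 `^ b * locI F q) + k1 * M * (rr q.1 `^ alpha * locI h q))%:E)%E.
  move=> vq; have I1 : 0 <= rr q.1 `^ b * locI F q by rewrite mulr_ge0 ?powR_ge0 ?locI_ge0.
  have I2 : 0 <= rr q.1 `^ alpha * locI h q by rewrite mulr_ge0 ?powR_ge0 ?locI_ge0.
  have e2 : 0 <= k0 * eta ^+ 2 by rewrite mulr_ge0 ?sqr_ge0// ltW.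
  have e3 : 0 <= k1 * M by rewrite mulr_ge0// ltW.
  have [qS|qS] := boolP (q \in S).
    have he : 0 <= eta <= 16^-1 by rewrite eta1 ltW.
    have Fz z : z \in mesh q -> F z = 0.
      by move=> zq; rewrite /F hz ?mul0r//; apply/flatten_mapP; exists q.
    have [_ m1 m2] := meshP q vq.
    apply: le_trans (box_vanishing_le b AF he Fz _) _.
      by move=> z /m2[y yq zy]; exists y => //; split=> //; exact: box_disc (m1 y yq).
    rewrite lee_fin -/k0; have := mulr_ge0 e3 I2; lra.
  apply: le_trans (box_symbol_le alpha Bg Ah vq) _; rewrite lee_fin.
  have := ler_wpM2l (mulr_ge0 (ltW k10) I2) (HM q vq qS); rewrite -/k1.
  have := mulr_ge0 e2 I1; lra.
have : (wint b D F <= (2^-1 * x + k1 * M * ov1 * sq h)%:E)%E.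
  apply: area_integral_disc_le.
  - by apply: cmeasurable_wint; [exact: cmeasurable_disc|exact: subset_refl|exact: AF].
  - by move=> z _; exact: wint_fun_ge0.
  move=> s us vs.
  have := sum_locI_le b AF us vs; rewrite xE -EFinM lee_fin -/ov => s1.
  have := sum_locI_le alpha Ah us vs; rewrite (wintE alpha1 Bh) -EFinM lee_fin -/ov1 => s2.
  apply: (@le_trans _ _ (\sum_(q <- s) (k0 * eta ^+ 2 * (rr q.1 `^ b * locI F q) + k1 * M * (rr q.1 `^ alpha * locI h q))%:E)%E).
    by rewrite big_seq [leRHS]big_seq; apply: lee_sum => q qs; apply: boxle; exact: (allP vs).
  rewrite sumEFin lee_fin big_split /= -!mulr_sumr.
  have x0 : 0 <= x by exact/fine_ge0/wint_ge0.
  apply: lerD.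
    apply: le_trans (ler_wpM2l _ s1) _; first by rewrite mulr_ge0 ?sqr_ge0// ltW.
    by rewrite mulrA ler_wpM2r.
  by rewrite -[leRHS]mulrA; apply: ler_wpM2l => //; rewrite mulr_ge0// ltW.
rewrite xE lee_fin => hx.
have := HH g h Bg Bh; rewrite (wintE alpha1 (operator_space Bg Bh)) -/b -/F xE -EFinM lee_fin => h1.
apply: (le_trans h1); move: (x) (k1) (ov1) (sq h) hx => y k o t hx.
have -> : CH * (2 * (k * o)) * M * t = CH * (2 * (k * M * o * t)) by ring.
by rewrite ler_pM2l//; move: (k * M * o * t) hx => v; lra.
Qed.

End operator.

(** * The upper bound for the singular values *)

Section upper_bound.
Variables (R : realType) (alpha : R).
Hypothesis alpha1 : 0 < alpha + 1.
Implicit Types (q : nat * nat) (s : seq (nat * nat)) (z : R[i]) (zs : seq R[i]) (f g h : R[i] -> R[i])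
  (T : (R[i] -> R[i]) -> R[i] -> R[i]).
Local Notation D := (@unit_disc R).
Local Notation space := (bergman_space alpha).
Local Notation sq := (sq alpha).
Local Notation Ig := integration_operator.

Lemma linear_on_disc_sum T k (c : nat -> R[i]) (u : nat -> R[i] -> R[i]) z :
  (forall b f h, space f -> space h -> forall z, D z ->
    T (fun w => b * f w + h w) z = b * T f z + T h z) ->
  (forall i, space (u i)) -> D z ->
  T (fun w => \sum_(i < k) c i * u i w) z = \sum_(i < k) c i * T (u i) z.
Proof.
move=> LT Bu z1; elim: k => [|k IH].
  have B0 := bergman_space0 alpha1.
  (* Linearity with coefficient -1 forces the image of zero to vanish on the disc. *)
  have := LT (-1) _ _ B0 B0 z z1; rewrite (mulN1r (T _ z)) addNr => E.
  transitivity (T (fun=> -1 * 0 + 0) z); last by rewrite E big_ord0.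
  by congr (T _ z); apply/funext => w; rewrite big_ord0 mulr0 addr0.
have Bs := bergman_space_sum alpha1 k c Bu.
rewrite big_ord_recr/= -IH addrC -(LT (c k) _ _ (Bu k) Bs z z1).
by congr (T _ z); apply/funext => w; rewrite big_ord_recr/= addrC.
Qed.

Lemma operator_sum g k (c : nat -> R[i]) (u : nat -> R[i] -> R[i]) z : little_bloch g ->
  (forall i, space (u i)) -> D z ->
  Ig g (fun w => \sum_(i < k) c i * u i w) z = \sum_(i < k) c i * Ig g (u i) z.
Proof. by move=> Bg; apply: linear_on_disc_sum => b f h Bf Bh w w1; exact: (operator_linear b Bg Bf Bh w1). Qed.

Lemma operator_norm_le T (X : R) : 0 <= X ->
  (forall f, space f -> space (T f) /\ sq (T f) <= X * sq f) ->
  (operator_norm alpha T <= (Num.sqrt X)%:E)%E.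
Proof.
move=> X0 HT; apply: ge_ereal_sup => _ [f [Bf nf] <-]; have [BT nT] := HT f Bf.
have one : 0 <= 1 :> R by [].
move: nf; rewrite (bergman_norm_le alpha1 f one) (wintE alpha1 Bf) -EFinM lee_fin expr1n => nf.
rewrite (bergman_norm_le alpha1 _ (sqrtr_ge0 X)) (wintE alpha1 BT) -EFinM lee_fin sqr_sqrtr//.
have := ler_wpM2l (ltW alpha1) nT; have := ler_wpM2l X0 nf.
move: (sq f) (sq (T f)) => x y; lra.
Qed.

(** The finite rank approximant sends [f] to [I_g] of its interpolant on the meshes of [m] boxes.
    The error is [I_g] of a function vanishing on these meshes whose squared norm is at most twice
    that of [f]. *)
Theorem singular_value_le : exists2 p : nat, (1 <= p)%N & exists2 C : R, 0 < C &
  forall (g : R[i] -> R[i]) (a : nat -> R) (n m : nat), little_bloch g -> decreasing_rearrangement g a ->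
    (1 <= m)%N -> (m * p <= n)%N ->
    (singular_value alpha (integration_operator g) n <= (C * Num.sqrt (a m))%:E)%E.
Proof.
have [K [C C0 HC]] := vanishing_operator_le alpha1.
exists K.+1 => //; exists (Num.sqrt (2 * C)); first by rewrite sqrtr_gt0 mulr_gt0.
move=> g a n m Bg da m1 mpn.
have [am0 [S [sS vS HS]]] := rearrangement_outside m1 da.
have [zs [szs Dzs Hzs]] := HC g S (a m) Bg vS am0 HS.
(* There are at most [m K] points, and [m K < m (K + 1) <= n]: with [p = K + 1] the rank is strictly
   less than [n]. *)
have zn : (size zs < n)%N by move: szs; rewrite sS => h; move: mpn; rewrite mulnS; lia.
(* By Bernoulli [t ^ N >= 1 - N x >= 1/2], so the total loss of the interpolation is at most 2,
   whatever the number of points. *)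
pose N := size zs; pose x : R := (2 * N.+1%:R)^-1; pose t := 1 - x.
have N1 : 1 <= N.+1%:R :> R by rewrite ler1n.
have xN : x * (2 * N.+1%:R) = 1 by rewrite mulVf// gt_eqF//; lra.
have x0 : 0 < x by rewrite invr_gt0; lra.
have Nx : N%:R * x <= 2^-1.
  have : x * (N.+1%:R * 2) = 1 by rewrite (mulrC _ 2).
  by rewrite -natr1; move: (x) x0 (N%:R) => y y0 w; lra.
have x1 : x <= 2^-1.
  by move: (x) x0 (N.+1%:R) N1 xN => y y0 w w1 h; have : y * 1 <= y * w; [rewrite ler_pM2l|lra].
have t01 : 0 < t < 1 by rewrite /t; move: (x) x0 x1 => y; lra.
have tN : 2^-1 <= t ^+ N.
  have xx : 0 <= x <= 1 by move: (x) x0 x1 => y; lra.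
  by apply: le_trans (bernoulli N xx); move: Nx; lra.
have [k [l [u [kz Bu Ll van norm]]]] := projection alpha1 t01 Dzs.
pose U i := Ig g (u i).
have BU i : space (U i) by exact: operator_space.
pose T f z := Ig g f z - comb k l U f z.
have Bcomb f : space (comb k l u f) := @bergman_space_sum _ _ alpha1 k (fun i => l i f) u Bu.
have BcombU f : space (comb k l U f) := @bergman_space_sum _ _ alpha1 k (fun i => l i f) U BU.
have TE f z : space f -> D z -> T f z = Ig g (fun w => f w - comb k l u f w) z.
  move=> Bf z1.
  have -> : (fun w => f w - comb k l u f w) = (fun w => -1 * comb k l u f w + f w).
    by apply/funext => w; rewrite mulN1r addrC.
  rewrite (operator_linear (-1) Bg (Bcomb f) Bf z1) mulN1r addrC /T; congr (_ - _).
  by rewrite (operator_sum k (fun i => l i f) Bg Bu z1).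
have HT f : space f -> space (T f) /\ sq (T f) <= 2 * C * a m * sq f.
  move=> Bf; have Bh := bergman_spaceB alpha1 Bf (Bcomb f).
  split; first by apply: (bergman_space_eq alpha1 _ (operator_space alpha1 Bg Bh)) => z z1; rewrite TE.
  have -> : sq (T f) = sq (Ig g (fun w => f w - comb k l u f w)) by apply: eq_sq => z z1; exact: TE.
  have := Hzs _ Bh (fun z zz => van f z Bf zz) => h1.
  apply: (le_trans h1); have := norm f Bf.
  set y := sq (fun z => _ - _) => h2; have y0 : 0 <= y by exact: sq_ge0.
  have : 2^-1 * y <= sq f by apply: le_trans h2; rewrite ler_wpM2r.
  have Cam : 0 <= C * a m by rewrite mulr_ge0// ltW.
  move=> h3; have := ler_wpM2l Cam h3.
  have -> : 2 * C * a m * sq f = 2 * (C * a m * sq f) by ring.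
  move: (C * a m) (sq f) (y) => v w y'; lra.
have X0 : 0 <= 2 * C * a m by rewrite !mulr_ge0// ltW.
apply: (@le_trans _ _ (operator_norm alpha T)); last first.
  by rewrite -sqrtrM ?mulr_ge0 ?(ltW C0)//; exact: operator_norm_le.
apply: ereal_inf_lbound; exists (fun f => comb k l U f) => //; split; last first.
  exists k; first exact: leq_ltn_trans kz zn.
  by exists (fun i => U i) => // f _; exists (fun i => l i f).
split => //.
- by move=> b f h _ _ z _; exact: comb_linear.
(* The approximant is bounded as the difference of [I_g] and [T]. This bound depends on [g] but does
   not enter the estimate. *)
have [B B0 HB] := wint_product_le alpha1 Bg; have [CH CH0 HH] := wint_operator_le alpha1.
have hI f : space f -> sq (Ig g f) <= CH * B * sq f.
  move=> Bf; have BI := operator_space alpha1 Bg Bf; rewrite -lee_fin -(wintE alpha1 BI).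
  apply: le_trans (HH g f Bg Bf) _; rewrite -mulrA EFinM; apply: lee_wpmul2l; last exact: HB.
  by rewrite lee_fin ltW.
apply: (@le_lt_trans _ _ (Num.sqrt (2 * (2 * C * a m) + 2 * (CH * B)))%:E); last exact: ltry.
have CB : 0 <= CH * B by rewrite mulr_ge0// ltW.
apply: operator_norm_le; first by rewrite addr_ge0 ?mulr_ge0// ltW.
move=> f Bf; split=> //; have [BT nT] := HT f Bf.
have BI := operator_space alpha1 Bg Bf.
have E z : D z -> comb k l U f z = -1 * T f z + Ig g f z by rewrite /T => _; ring.
have -> : sq (comb k l U f) = sq (fun z => -1 * T f z + Ig g f z) by exact: eq_sq E.
have := sq_comb_le alpha1 (-1) BT BI; rewrite modulusN modulus1 expr1n => h.
apply: (le_trans h); have := hI f Bf; move: (sq f) (sq (T f)) (sq (Ig g f)) nT => x1' x2 x3.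
by move: (2 * C * a m) (CH * B) => v w; lra.
Qed.

End upper_bound.

(** * Kernel functions and the Schur test *)


Section schur_test.
Variables (R : realType) (T : eqType).
Implicit Types (s t : seq T) (a : T -> T -> R) (w x : T -> R).

(** Expand the nonnegative sum of [a (x - t w)^2 / w] at [t = X / c], where [X] is the sum of
    [a x]. *)
Lemma weighted_cauchy_schwarz s (a x w : T -> R) (c : R) : 0 < c ->
  (forall j, 0 <= a j) -> (forall j, 0 < w j) -> \sum_(j <- s) a j * w j <= c ->
  (\sum_(j <- s) a j * x j) ^+ 2 <= c * \sum_(j <- s) a j * (x j ^+ 2 / w j).
Proof.
move=> c0 a0 w0 hA; set X := \sum_(j <- s) a j * x j; set B := \sum_(j <- s) _ * (_ / _).
pose t := X / c.
have : 0 <= \sum_(j <- s) a j * ((x j - t * w j) ^+ 2 / w j).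
  by apply: sumr_ge0 => j _; rewrite mulr_ge0// divr_ge0 ?sqr_ge0// ltW.
have -> : \sum_(j <- s) a j * ((x j - t * w j) ^+ 2 / w j) =
    B - 2 * t * X + t ^+ 2 * \sum_(j <- s) a j * w j.
  rewrite /B /X 2!mulr_sumr -sumrB -big_split/=; apply: eq_bigr => j _.
  by field; rewrite gt_eqF.
move=> h; have t2 : 0 <= t ^+ 2 := sqr_ge0 t.
have := ler_wpM2l t2 hA; have tX : t * c = X by rewrite divfK// gt_eqF.
move: (\sum_(j <- s) a j * w j) h => A h hA2.
have : 0 <= B - 2 * t * X + t ^+ 2 * c by lra.
rewrite -tX => h3; have -> : (t * c) ^+ 2 = c * (t ^+ 2 * c) by ring.
by rewrite ler_pM2l//; lra.
Qed.

(** The row condition enters through the weighted Cauchy-Schwarz inequality, the column condition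
    after exchanging the sums. The test weight used later is [rr ^ (1/2)]. *)
Lemma schur_test s t a w x (c : R) : 0 < c -> (forall q j, 0 <= a q j) -> (forall j, 0 < w j) ->
  (forall q, q \in s -> \sum_(j <- t) a q j * w j <= c * w q) ->
  (forall j, j \in t -> \sum_(q <- s) a q j * w q <= c * w j) ->
  \sum_(q <- s) (\sum_(j <- t) a q j * x j) ^+ 2 <= c ^+ 2 * \sum_(j <- t) x j ^+ 2.
Proof.
move=> c0 a0 w0 rows cols.
apply: (@le_trans _ _ (\sum_(q <- s) c * w q * \sum_(j <- t) a q j * (x j ^+ 2 / w j))).
  rewrite big_seq [leRHS]big_seq; apply: ler_sum => q qs.
  by apply: weighted_cauchy_schwarz; rewrite ?rows// mulr_gt0.
under eq_bigr do rewrite mulr_sumr.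
rewrite exchange_big /= mulr_sumr big_seq [leRHS]big_seq; apply: ler_sum => j jt.
have -> : \sum_(q <- s) c * w q * (a q j * (x j ^+ 2 / w j)) =
    (c * (x j ^+ 2 / w j)) * \sum_(q <- s) a q j * w q.
  by rewrite mulr_sumr; apply: eq_bigr => q _; ring.
apply: le_trans (ler_wpM2l _ (cols j jt)) _.
  by rewrite mulr_ge0 ?divr_ge0 ?sqr_ge0// ltW.
by apply: eqW; field; rewrite gt_eqF.
Qed.

End schur_test.

(** * Kernel sums over one level of boxes *)

Section kernel_sums.
Variable R : realType.
Implicit Types (a w z : R[i]) (m n k : nat) (q j : nat * nat) (s : seq (nat * nat)) (x y : R).
Local Notation rr := (rr R).

Lemma expi_half : expi (pi : R) = -1.
Proof. by rewrite /expi cospi sinpi; apply: complex_ext; rewrite /= ?oppr0. Qed.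

Lemma sqr_modulus_pair a : modulus (1 + a) ^+ 2 + modulus (1 - a) ^+ 2 = 2 * (1 + modulus a ^+ 2).
Proof. rewrite !sqr_modulus !creD !cimD !creN !cimN; case: a => p r /=; ring. Qed.

Lemma modulus_1B_gt0 a : modulus a < 1 -> 0 < modulus (1 - a).
Proof.
move=> a1; have := ler_modulusD (1 - a) a; rewrite subrK modulus1; lra.
Qed.

(** A sum over the [2^m]-th roots of unity; multiplied by [1 - |a|^2] it samples the Poisson
    kernel. *)
Definition level_sum m a : R :=
  \sum_(0 <= k < 2 ^ m) (modulus (1 - a * expi (2 * pi * k%:R * rr m)) ^+ 2)^-1.

(** Opposite roots are paired: by the parallelogram identity, [1 / |1 - b|^2 + 1 / |1 + b|^2 = 2 (1
    + |b|^2) / |1 - b^2|^2], and squaring maps the pairs onto the roots of the previous level. *)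
Lemma level_sumS m a : modulus a < 1 ->
  level_sum m.+1 a = 2 * (1 + modulus a ^+ 2) * level_sum m (a ^+ 2).
Proof.
move=> a1; rewrite /level_sum expnS mul2n -addnn (big_cat_nat _ (leq_addr _ _))//=.
rewrite -[X in _ + \sum_(X <= _ < _) _]add0n big_addn addnK -big_split/= mulr_sumr.
apply: eq_bigr => k _.
set w := expi (2 * pi * k%:R * rr m.+1).
have -> : expi (2 * pi * (k + 2 ^ m)%:R * rr m.+1) = - w.
  have -> : 2 * pi * (k + 2 ^ m)%:R * rr m.+1 = 2 * pi * k%:R * rr m.+1 + pi.
    rewrite natrD mulrDr mulrDl; congr (_ + _).
    have := rr_nat R m; rewrite rrS natrX => h.
    have -> : 2 * pi * 2 ^+ m * rr m.+1 = pi * (2 * rr m.+1 * 2 ^+ m) by ring.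
    by rewrite h mulr1.
  by rewrite expiD expi_half mulrN1.
have -> : expi (2 * pi * k%:R * rr m) = w ^+ 2.
  by rewrite expr2 -expiD rrS; congr expi; ring.
rewrite mulrN opprK -exprMn; have w1 : modulus (a * w) = modulus a by rewrite modulusM modulus_expi mulr1.
rewrite -w1; have aw1 : modulus (a * w) < 1 by rewrite w1.
move: (a * w) aw1 => b b1.
have n1 := modulus_1B_gt0 b1; have n2 : 0 < modulus (1 + b).
  by rewrite -[b]opprK; apply: modulus_1B_gt0; rewrite modulusN.
have -> : 1 - b ^+ 2 = (1 - b) * (1 + b) by ring.
rewrite modulusM -sqr_modulus_pair; move: (modulus (1 - b)) (modulus (1 + b)) n1 n2 => u v u0 v0.
by field; rewrite !gt_eqF.
Qed.

(** The recursion telescopes because [(1 + |a|^2) (1 - |a|^2) = 1 - |a^2|^2]. *)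
Lemma level_sum_le m a : modulus a < 1 ->
  level_sum m a * (1 - modulus a ^+ 2) * modulus (1 - a ^+ (2 ^ m)) ^+ 2 <= 2 ^+ m.
Proof.
elim: m a => [|m IH] a a1.
  rewrite /level_sum expn0 expr0 expr1 big_nat1 mulr0 mul0r expi0 mulr1.
  have n1 := modulus_1B_gt0 a1; rewrite mulrAC mulVf ?mul1r; last by rewrite gt_eqF// exprn_gt0.
  by rewrite gerBl sqr_ge0.
have a2 : modulus (a ^+ 2) < 1.
  by rewrite modulusX expr2; have := modulus_ge0 a; move: (modulus a) a1 => x; nra.
have := IH _ a2; rewrite (level_sumS m a1) expnS exprM (exprS 2 m) (modulusX a).
move: (level_sum _ _) (modulus (1 - _)) (modulus a) => L u x h.
have -> : 2 * (1 + x ^+ 2) * L * (1 - x ^+ 2) * u ^+ 2 = 2 * (L * (1 - (x ^+ 2) ^+ 2) * u ^+ 2) by ring.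
by rewrite ler_pM2l.
Qed.

(** With [N = 2 ^ m] and [r = 1 / N], [(1 - r)^N (1 + r)^N <= 1] while
    [(1 + r)^N >= 1 + N r = 2]. *)
Lemma power_le_half m (x : R) : 0 <= x <= 1 - rr m -> x ^+ (2 ^ m) <= 2^-1.
Proof.
move=> /andP[x0 x1]; have r0 := rr_gt0 R m; have r1 := rr_le1 R m.
have N0 := rr_nat R m; rewrite mulrC -natrX in N0.
pose N := (2 ^ m)%N; rewrite -/N in N0 *.
have h1 : x ^+ N <= (1 - rr m) ^+ N by apply: lerXn2r => //; rewrite nnegrE; lra.
have h2 : 2 <= (1 + rr m) ^+ N.
  have : 1 + N%:R * rr m <= (1 + rr m) ^+ N; last by rewrite N0; lra.
  elim: (N) => [|M IH]; first by rewrite mul0r addr0 expr0.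
  rewrite exprS -natr1; have p1 : 0 <= 1 + rr m by lra.
  have := ler_wpM2l p1 IH; have : 0 <= M%:R * rr m * rr m by rewrite !mulr_ge0// ltW.
  by move: (M%:R) => w; lra.
have h3 : (1 - rr m) ^+ N * (1 + rr m) ^+ N <= 1.
  by rewrite -exprMn exprn_ile1//; nra.
have y0 : 0 <= (1 - rr m) ^+ N by apply: exprn_ge0; lra.
have := ler_wpM2l y0 h2; lra.
Qed.

Lemma level_sum_bound m a : modulus a <= 1 - rr m ->
  level_sum m a * (1 - modulus a) <= 4 * 2 ^+ m.
Proof.
move=> am; have r0 := rr_gt0 R m; have a0 := modulus_ge0 a.
have a1 : modulus a < 1 by lra.
have h := level_sum_le m a1.
have L0 : 0 <= level_sum m a by apply: sumr_ge0 => k _; rewrite invr_ge0 sqr_ge0.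
have u1 : 2^-1 <= modulus (1 - a ^+ (2 ^ m)).
  have : modulus (a ^+ (2 ^ m)) <= 2^-1 by rewrite modulusX; apply: power_le_half; rewrite a0.
  have := ler_modulusD (1 - a ^+ (2 ^ m)) (a ^+ (2 ^ m)); rewrite subrK modulus1; lra.
have u2 : 4^-1 <= modulus (1 - a ^+ (2 ^ m)) ^+ 2.
  have : 2^-1 * 2^-1 <= modulus (1 - a ^+ (2 ^ m)) * modulus (1 - a ^+ (2 ^ m)) by apply: ler_pM.
  by rewrite -expr2; lra.
have d0 : 0 <= 1 - modulus a ^+ 2 by rewrite subr_ge0 expr_le1// ltW.
have d1 : 1 - modulus a <= 1 - modulus a ^+ 2 by move: (modulus a) a0 a1 => x; nra.
have h2 := ler_wpM2l (mulr_ge0 L0 d0) u2; have h3 := ler_wpM2l L0 d1.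
lra.
Qed.

Definition boxang q : R := 2 * pi * q.2%:R * rr q.1.

(* [|1 - conj z_j z_q|] for the box centres [z_j], [z_q]. *)
Definition kdist j q : R := modulus (1 - ((1 - rr j.1) * (1 - rr q.1))%:C * expi (boxang q - boxang j)).

Lemma kdistC j q : kdist j q = kdist q j.
Proof.
rewrite /kdist (mulrC (1 - rr q.1)) -(opprB (boxang q)).
move: ((1 - rr j.1) * (1 - rr q.1)) (boxang q - boxang j) => x t.
apply/eqP; rewrite -(@eqrXn2 _ 2) ?modulus_ge0//; apply/eqP.
by rewrite /expi cosN sinN !sqr_modulus !creD !cimD !creN !cimN !creM !cimM /=; ring.
Qed.

Lemma kdist_ge j q : rr j.1 <= kdist j q.
Proof.
have r1 := rr_le1 R j.1; have r2 := rr_le1 R q.1; have r3 := rr_gt0 R j.1; have r4 := rr_gt0 R q.1.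
rewrite /kdist; set b := _ * expi _.
have mb : modulus b = (1 - rr j.1) * (1 - rr q.1).
  by rewrite modulusM modulus_expi mulr1 modulus_real ger0_norm// mulr_ge0// subr_ge0.
have := ler_modulusD (1 - b) b; rewrite subrK modulus1 mb; nra.
Qed.

Lemma kdist_gt0 j q : 0 < kdist j q.
Proof. exact: lt_le_trans (rr_gt0 R j.1) (kdist_ge j q). Qed.

(** [level_sum_bound] for [a] of modulus [(1 - rr j.1) (1 - rr m)], for which [1 - |a|] is at least
    both [rr j.1] and [rr m]. *)
Lemma kdist_level_sum m j :
  (\sum_(0 <= k < 2 ^ m) (kdist j (m, k) ^+ 2)^-1) * Num.max (rr j.1) (rr m) <= 4 * 2 ^+ m.
Proof.
pose a := ((1 - rr j.1) * (1 - rr m))%:C * expi (- boxang j).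
have r1 := rr_le1 R j.1; have r2 := rr_le1 R m; have r3 := rr_gt0 R j.1; have r4 := rr_gt0 R m.
have ma : modulus a = (1 - rr j.1) * (1 - rr m).
  by rewrite modulusM modulus_expi mulr1 modulus_real ger0_norm// mulr_ge0// subr_ge0.
have am : modulus a <= 1 - rr m by rewrite ma ler_piMl// ?subr_ge0//; lra.
have -> : \sum_(0 <= k < 2 ^ m) (kdist j (m, k) ^+ 2)^-1 = level_sum m a.
  apply: eq_bigr => k _; rewrite /kdist /a; congr (modulus (1 - _) ^+ 2)^-1.
  by rewrite -mulrA -expiD; congr (_ * expi _); rewrite addrC.
apply: le_trans (level_sum_bound am); apply: ler_wpM2l.
  by apply: sumr_ge0 => k _; rewrite invr_ge0 sqr_ge0.
by rewrite ma ge_max; apply/andP; split; nra.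
Qed.

End kernel_sums.

(** * The kernel matrix and its Schur bound *)

Section kernel_matrix.
Variable R : realType.
Implicit Types (a w z : R[i]) (m n k : nat) (q j : nat * nat) (s : seq (nat * nat)) (x y : R).
Local Notation rr := (rr R).
Local Notation kdist := (@kdist R).

Lemma rr_powR n x : rr n `^ x = 2 `^ (- (n%:R * x)).
Proof. by rewrite -mulNr powRrM powR_invn. Qed.

(** With truncated subtraction the exponent is [|m - n|]. The induction carries the exact partial
    sums, except for a dropped term [- t ^ (n + 1)]. *)
Lemma sum_geometric_dist (t : R) (n M : nat) : 0 < t < 1 ->
  (1 - t) * \sum_(0 <= m < M) t ^+ ((m - n) + (n - m)) <= 2.
Proof.
move=> t01; have t0 : 0 < t by lra.
have tp i : 0 < t ^+ i by rewrite exprn_gt0.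
have t1 i : t ^+ i <= 1 by rewrite exprn_ile1//; lra.
suff : (1 - t) * \sum_(0 <= m < M) t ^+ ((m - n) + (n - m)) <=
    if (M <= n)%N then t ^+ (n - M).+1 else t + 1 - t ^+ (M - n).
  by case: ifP => _ h; apply: le_trans h _; [have := t1 (n - M).+1|have := tp (M - n)%N]; lra.
elim: M => [|M IH]; first by rewrite big_geq// mulr0 ltW.
rewrite big_nat_recr//= mulrDr; apply: le_trans (lerD IH (lexx _)) _.
have [Mn|Mn] := ltnP M n.
  have -> : (M - n = 0)%N by lia.
  have -> : (n - M = (n - M.+1).+1)%N by lia.
  by rewrite (ltnW Mn) add0n !exprS; move: (t ^+ _) => u; lra.
have -> : (n - M = 0)%N by lia.
rewrite addn0 subSn// (exprS t (M - n)); case: (ltnP n M) => nM /=; first by move: (t ^+ (M - n)) => u; lra.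
have -> : (M - n = 0)%N by lia.
by rewrite expr1 expr0; lra.
Qed.

(** For [x = m - sigma] and [y = sigma] this bounds, up to a constant, [rr q.1 ^ sigma] times the
    normalised kernel of [j] on the box [q]. Other exponents arise by transposition and when a
    factor is split off for boxes that are far apart. *)
Definition kmx x y j q : R := rr j.1 `^ x * rr q.1 `^ y / kdist j q `^ (x + y).

Lemma kmx_ge0 x y j q : 0 <= kmx x y j q.
Proof. by rewrite /kmx !mulr_ge0 ?powR_ge0 ?invr_ge0 ?powR_ge0. Qed.

Lemma kmxC x y j q : kmx x y j q = kmx y x q j.
Proof. by rewrite /kmx (kdistC R q) (addrC y) (mulrC (rr q.1 `^ y)). Qed.

Lemma rr_max m n : Num.max (rr m) (rr n) = rr (minn m n).
Proof.
case: (leqP m n) => mn; first exact/max_idPl/rr_le.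
exact/max_idPr/rr_le/ltnW.
Qed.

(** Two powers of [kdist] are kept for [kdist_level_sum]; the others, of exponent [x + y - 2 >= 0],
    are bounded by the larger of the two radii. The powers of 2 then combine to
    [2 ^ (-(y - 1/2) (m - n))] for [m >= n], and to [2 ^ (-(x - 1/2) (n - m))] otherwise, relative
    to [rr n ^ (1/2)]. *)
Lemma kmx_level x y (d : R) m j : d <= x - 2^-1 -> d <= y - 2^-1 -> 2 <= x + y ->
  \sum_(0 <= k < 2 ^ m) kmx x y j (m, k) * rr m `^ (2^-1) <=
  4 * (rr j.1 `^ (2^-1) * (2 `^ (- d)) ^+ ((m - j.1) + (j.1 - m))).
Proof.
move=> dx dy xy; set n := j.1; pose Mx := rr (minn n m).
have M0 : 0 < Mx := rr_gt0 R _.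
have MK k : Mx <= kdist j (m, k).
  have := kdist_ge R j (m, k); have := kdist_ge R (m, k) j.
  by rewrite /Mx -rr_max ge_max kdistC => -> ->.
have K0 k : 0 < kdist j (m, k) := kdist_gt0 R j (m, k).
pose c := rr n `^ x * rr m `^ y * rr m `^ 2^-1 / Mx `^ (x + y - 2).
have c0 : 0 <= c by rewrite /c !mulr_ge0 ?invr_ge0 ?powR_ge0.
apply: (@le_trans _ _ (c * \sum_(0 <= k < 2 ^ m) (kdist j (m, k) ^+ 2)^-1)).
  rewrite mulr_sumr; apply: ler_sum => k _; rewrite /kmx /= -/n.
  have -> : kdist j (m, k) `^ (x + y) = kdist j (m, k) ^+ 2 * kdist j (m, k) `^ (x + y - 2).
    have K1 : kdist j (m, k) != 0 by rewrite gt_eqF.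
    rewrite -powR_mulrn ?(ltW (K0 k))// -powRD; last by rewrite K1 implybT.
    by congr (_ `^ _); ring.
  have h : (kdist j (m, k) `^ (x + y - 2))^-1 <= (Mx `^ (x + y - 2))^-1.
    rewrite lef_pV2 ?posrE ?powR_gt0//; apply: ge0_ler_powR; rewrite ?nnegrE ?(ltW (K0 k)) ?(ltW M0)//; lra.
  have B0 : 0 <= rr n `^ x * rr m `^ y * rr m `^ 2^-1 / kdist j (m, k) ^+ 2.
    by rewrite !mulr_ge0 ?powR_ge0 ?invr_ge0 ?sqr_ge0.
  have := ler_wpM2l B0 h; rewrite /c (invfM (kdist j (m, k) ^+ 2)).
  move: (kdist j (m, k) ^- 2) ((kdist j (m, k) `^ _)^-1) ((Mx `^ _)^-1) => p q r.
  move: (rr n `^ x) (rr m `^ y) (rr m `^ 2^-1) => u v w.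
  by congr (_ <= _); ring.
have := kdist_level_sum R m j; rewrite -/n rr_max -/Mx.
set L := \sum_(_ <= _ < _) _ => hL.
have {hL} : L <= 4 * 2 ^+ m / Mx by rewrite ler_pdivlMr.
move=> /(ler_wpM2l c0)/le_trans; apply.
have -> : c * (4 * 2 ^+ m / Mx) = 4 * (rr n `^ x * rr m `^ (y - 2^-1) * Mx `^ (- (x + y - 1))).
  have r0 : rr m != 0 by rewrite gt_eqF ?rr_gt0.
  have M1 : Mx != 0 by rewrite gt_eqF.
  have -> : 2 ^+ m = (rr m)^-1 by rewrite /rr invrK.
  have -> : y - 2^-1 = y + 2^-1 + -1 by lra.
  have -> : - (x + y - 1) = - (x + y - 2) + -1 by lra.
  rewrite (@powRD _ (rr m) (y + 2^-1)); last by rewrite r0 implybT.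
  rewrite (@powRD _ (rr m) y); last by rewrite r0 implybT.
  rewrite (@powRD _ Mx); last by rewrite M1 implybT.
  rewrite !powR_inv1 ?(ltW M0) ?rr_ge0// /c (powRN Mx).
  move: (rr n `^ x) (rr m `^ y) (rr m `^ 2^-1) ((Mx `^ _)^-1) ((rr m)^-1) (Mx^-1) => u v w p q r.
  by ring.
rewrite ler_pM2l// /Mx !rr_powR -powR_mulrn ?powR_ge0// -!powRrM -!powRD ?pnatr_eq0 ?implybT//.
apply: ler_powR; first by rewrite ler1n.
have [mn|mn] := leqP n m.
  have -> : ((m - n) + (n - m))%:R = m%:R - n%:R :> R.
    have -> : (n - m = 0)%N by lia.
    by rewrite addn0 natrB.
  have h : 0 <= m%:R - n%:R :> R by rewrite subr_ge0 ler_nat.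
  have := ler_wpM2l h dy; move: (m%:R) (n%:R) => u v; lra.
have -> : ((m - n) + (n - m))%:R = n%:R - m%:R :> R.
  have -> : (m - n = 0)%N by lia.
  by rewrite add0n natrB// ltnW.
have h : 0 <= n%:R - m%:R :> R by rewrite subr_ge0 ler_nat ltnW.
have := ler_wpM2l h dx; move: (m%:R) (n%:R) => u v; lra.
Qed.

(** The level sums decay geometrically away from the level of [j], as both exponents exceed 1/2. *)
Lemma kmx_row x y : 2^-1 < x -> 2^-1 < y -> 2 <= x + y -> exists2 c : R, 0 < c &
  forall s j, uniq s -> all valid s ->
    \sum_(q <- s) kmx x y j q * rr q.1 `^ (2^-1) <= c * rr j.1 `^ (2^-1).
Proof.
move=> hx hy xy; pose d := Num.min (x - 2^-1) (y - 2^-1).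
have d0 : 0 < d by rewrite lt_min; apply/andP; split; lra.
have dx : d <= x - 2^-1 by rewrite ge_min lexx.
have dy : d <= y - 2^-1 by rewrite ge_min lexx orbT.
pose t : R := 2 `^ (- d); have t0 : 0 < t by rewrite powR_gt0.
have t1 : t < 1 by apply: two_powR_lt1; rewrite oppr_lt0.
exists (8 / (1 - t)); first by rewrite divr_gt0// subr_gt0.
move=> s j us vs.
have F0 q : 0 <= kmx x y j q * rr q.1 `^ (2^-1) by rewrite mulr_ge0 ?kmx_ge0 ?powR_ge0.
have [M hM] := sum_levels_le us vs F0; apply: (le_trans hM).
apply: (@le_trans _ _ (\sum_(0 <= m < M) 4 * (rr j.1 `^ (2^-1) * t ^+ ((m - j.1) + (j.1 - m))))).
  by apply: ler_sum => m _; exact: kmx_level.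
rewrite -mulr_sumr -mulr_sumr; have t01 : 0 < t < 1 by rewrite t0.
have := sum_geometric_dist j.1 M t01; set S := \sum_(_ <= _ < _) _ => hS.
have {hS} : S <= 2 / (1 - t) by rewrite ler_pdivlMr ?subr_gt0// mulrC.
have r0 : 0 <= 4 * rr j.1 `^ 2^-1 by rewrite mulr_ge0 ?powR_ge0.
move=> /(ler_wpM2l r0); move: (_^-1) (S) (_ `^ _) => u v w; lra.
Qed.

Lemma kmx_schur x y : 2^-1 < x -> 2^-1 < y -> 2 <= x + y -> exists2 c : R, 0 < c &
  forall s t (v : nat * nat -> R), uniq s -> all valid s -> uniq t -> all valid t ->
    \sum_(q <- s) (\sum_(j <- t) kmx x y j q * v j) ^+ 2 <= c * \sum_(j <- t) v j ^+ 2.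
Proof.
move=> hx hy xy; have [c1 c10 H1] := kmx_row hx hy xy.
have yx : 2 <= y + x by rewrite addrC.
have [c2 c20 H2] := kmx_row hy hx yx.
exists ((c1 + c2) ^+ 2); first by rewrite exprn_gt0 ?addr_gt0.
move=> s t v us vs ut vt.
apply: (schur_test (a := fun q j => kmx x y j q) (w := fun j => rr j.1 `^ (2^-1))).
- by rewrite addr_gt0.
- by move=> q j; exact: kmx_ge0.
- by move=> j; rewrite powR_gt0 ?rr_gt0.
- move=> q _; under eq_bigr do rewrite kmxC.
  by apply: le_trans (H2 t q ut vt) _; rewrite ler_wpM2r ?powR_ge0// lerDr ltW.
move=> j _; apply: le_trans (H1 s j us vs) _.
by rewrite ler_wpM2r ?powR_ge0// lerDl ltW.
Qed.

End kernel_matrix.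

(** Greedy selection: keeping one element discards it and at most [P] others, so [n (P + 1)]
    elements allow [n] choices. *)
Lemma separated_subseq (T : eqType) (close : rel T) (P n : nat) (s : seq T) :
  uniq s -> (n * P.+1 <= size s)%N -> (forall j, j \in s -> (count (close j) s <= P)%N) ->
  symmetric close ->
  exists t, [/\ uniq t, size t = n, {subset t <= s} &
    forall i j, i \in t -> j \in t -> i != j -> ~~ close i j].
Proof.
move=> + + + sym; elim: n s => [|n IH] s us ns cs; first by exists [::].
case: s us ns cs => [|x s] us ns cs; first by rewrite mulSn addSn in ns.
pose s' := [seq y <- s | ~~ close x y].
have /= /andP[xs us0] := us.
have us' : uniq s' by rewrite filter_uniq.
have ns' : (n * P.+1 <= size s')%N.
  have := cs x; rewrite mem_head => /(_ isT) /= h.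
  have e : (count (close x) s + size s' = size s)%N by rewrite size_filter count_predC.
  move: ns; rewrite mulSn /= => ns; lia.
have cs' j : j \in s' -> (count (close j) s' <= P)%N.
  rewrite mem_filter => /andP[_ js]; have := cs j; rewrite inE js orbT => /(_ isT) /=.
  have h : (count (close j) s' <= count (close j) s)%N.
    by rewrite count_filter; apply: sub_count => y /andP[].
  by move=> h'; apply: leq_trans h (leq_trans (leq_addl _ _) h').
have [t [ut st ts sept]] := IH s' us' ns' cs'.
have ts0 y : y \in t -> y \in s /\ ~~ close x y.
  by move=> /ts; rewrite mem_filter => /andP[-> ->].
exists (x :: t); split => /=.
- by rewrite ut andbT; apply: contra xs => /ts0[].
- by rewrite st.
- by move=> y; rewrite !inE => /orP[->//|/ts0[-> _]]; rewrite orbT.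
move=> i j; rewrite !inE => /orP[/eqP->|it] /orP[/eqP->|jt]; first by rewrite eqxx.
- by move=> _; case: (ts0 j jt).
- by move=> _; rewrite sym; case: (ts0 i it).
exact: sept.
Qed.

(** * Kernel functions attached to boxes *)

Section kernels.
Variable R : realType.
Implicit Types (w z : R[i]) (q j : nat * nat) (s t : seq (nat * nat)) (x y b : R).
Local Notation rr := (rr R).
Local Notation kdist := (@kdist R).
Local Notation kmx := (@kmx R).
Local Notation D := (@unit_disc R).

Lemma powRD_gt0 (u a b : R) : 0 < u -> u `^ (a + b) = u `^ a * u `^ b.
Proof. by move=> u0; rewrite powRD//; apply/implyP => _; rewrite gt_eqF. Qed.

(** The conjugate of the reference point [boxc], so that [1 - boxcc j * z] is the denominator of the
    kernel at that point. *)
Definition boxcc j : R[i] := (1 - rr j.1)%:C * expi (- boxang R j).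

Lemma modulus_boxcc j : modulus (boxcc j) = 1 - rr j.1.
Proof. by rewrite modulusM modulus_real modulus_expi mulr1 ger0_norm// subr_ge0 rr_le1. Qed.

Lemma kden_disc j z : D z -> rr j.1 <= modulus (1 - boxcc j * z) /\ 1 - modulus z <= modulus (1 - boxcc j * z).
Proof.
move=> z1; have r0 := rr_gt0 R j.1; have r1 := rr_le1 R j.1; have z0 := modulus_ge0 z.
have := ler_modulusD (1 - boxcc j * z) (boxcc j * z).
rewrite subrK modulus1 modulusM modulus_boxcc.
by move: z1; rewrite /unit_disc/= => z1 h; split; nra.
Qed.

Lemma kdist_center j q : modulus (1 - boxcc j * boxc R q.1 q.2) = kdist j q.
Proof.
rewrite /kdist /boxcc /boxc -/(boxang R q) rmorphM expiB; congr (modulus (1 - _)).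
have -> : expi (- boxang R j) = (expi (boxang R j))^-1 by rewrite -[- _]add0r expiB expi0 div1r.
by rewrite -!mulrA; congr (_ * _); rewrite mulrC -mulrA.
Qed.

Lemma kdist_self j : kdist j j <= 2 * rr j.1.
Proof.
rewrite /kdist subrr expi0 mulr1 -[1 - _%:C]/(1%:C - _%:C) -rmorphB modulus_real.
by have := rr_gt0 R j.1; have := rr_le1 R j.1; rewrite ler_norml; nra.
Qed.

Lemma kden_center j q z : box q.1 q.2 z ->
  `|modulus (1 - boxcc j * z) - kdist j q| <= 9 * rr q.1.
Proof.
move=> bz; rewrite -(kdist_center j q); apply: le_trans (modulus_lip _ _) _.
have -> : 1 - boxcc j * z - (1 - boxcc j * boxc R q.1 q.2) = boxcc j * (boxc R q.1 q.2 - z) by ring.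
rewrite modulusM modulus_boxcc modulusB; have := box_dist bz.
have r0 := rr_gt0 R j.1; have r1 := rr_le1 R j.1; have := modulus_ge0 (z - boxc R q.1 q.2).
by move: (modulus _) => u u0 hu; nra.
Qed.

(** Replacing [z] by the reference point of its box changes the denominator by at most
    [9 rr q.1 <= 18 (1 - |z|)], and [1 - |z|] is itself at most the denominator. *)
Lemma kden_ge j q z : box q.1 q.2 z -> kdist j q <= 19 * modulus (1 - boxcc j * z).
Proof.
move=> bz; have [_ h] := kden_disc j (box_disc bz); have := kden_center j bz.
have : rr q.1 / 2 < 1 - modulus z by case: bz; have := rrS R q.1; lra.
by rewrite ler_norml; lra.
Qed.

Lemma kden_le j z : box j.1 j.2 z -> modulus (1 - boxcc j * z) <= 20 * rr j.1.
Proof.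
move=> bz; have := kden_center j bz; have := kdist_self j; have := rr_gt0 R j.1.
by rewrite ler_norml; lra.
Qed.

(** The kernel of the overview with an integer exponent [m] for [gamma], and [b = m - sigma]; thus
    no complex power is involved. *)
Definition kfun (m : nat) b j z : R[i] := (rr j.1 `^ b)%:C * (1 - boxcc j * z)^-1 ^+ m.

Lemma kden_neq0 j z : D z -> 1 - boxcc j * z != 0.
Proof.
move=> z1; have [h _] := kden_disc j z1; rewrite -modulus_gt0.
exact: lt_le_trans (rr_gt0 R j.1) h.
Qed.

Lemma kfun_analytic m b j : analytic_on_disc (kfun m b j).
Proof.
have A : analytic_on_disc (fun z => (1 - boxcc j * z)^-1).
  move=> z z1; have d : cderiv (fun w => 1 - boxcc j * w) z (0 - (0 * z + boxcc j * 1)).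
    by apply: cderivB; [exact: cderiv_cst|apply: cderivM; [exact: cderiv_cst|exact: cderiv_id]].
  have h := @cderivV R (fun w => 1 - boxcc j * w) z _ (kden_neq0 j z1) d.
  exact: cderiv_derivable h.
exact: (@analyticM R _ _ (@analytic_cst R _) (@analyticX R _ m A)).
Qed.

Lemma modulus_kfun m b j z : modulus (kfun m b j z) = rr j.1 `^ b * (modulus (1 - boxcc j * z))^-1 ^+ m.
Proof. by rewrite modulusM modulus_real ger0_norm ?powR_ge0// modulusX modulusV. Qed.

Lemma kmx_nat (m : nat) x j q :
  kmx (m%:R - x) x j q = rr j.1 `^ (m%:R - x) * rr q.1 `^ x * (kdist j q)^-1 ^+ m.
Proof. by rewrite /kmx subrK powR_mulrn ?(ltW (kdist_gt0 R j q))// exprVn. Qed.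

Lemma kfun_le (m : nat) x j q z : box q.1 q.2 z ->
  modulus (kfun m (m%:R - x) j z) <= rr q.1 `^ (- x) * (19 ^+ m * kmx (m%:R - x) x j q).
Proof.
move=> bz; rewrite modulus_kfun kmx_nat; have k0 := kdist_gt0 R j q; have h := kden_ge j bz.
have rx : rr q.1 `^ (- x) * rr q.1 `^ x = 1.
  by rewrite powRN mulVf// gt_eqF// powR_gt0 ?rr_gt0.
have -> : rr q.1 `^ (- x) * (19 ^+ m * (rr j.1 `^ (m%:R - x) * rr q.1 `^ x * (kdist j q)^-1 ^+ m)) =
    rr j.1 `^ (m%:R - x) * (19 / kdist j q) ^+ m.
  rewrite exprMn -[rr j.1 `^ (m%:R - x) in RHS]mul1r -rx.
  by move: (rr q.1 `^ _) (rr q.1 `^ _) (rr j.1 `^ _) (_ ^+ m) (_ ^+ m) => a b c d e; ring.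
apply: ler_wpM2l; first exact: powR_ge0.
have d0 : 0 < modulus (1 - boxcc j * z) by move: k0 h; move: (modulus _) (kdist _ _) => u v; lra.
apply: lerXn2r; rewrite ?nnegrE ?invr_ge0 ?modulus_ge0 ?divr_ge0 ?(ltW k0)//.
by rewrite ler_pdivlMr// mulrC ler_pdivrMr.
Qed.

Lemma kfun_ge (m : nat) x j z : box j.1 j.2 z ->
  rr j.1 `^ (- x) * (20^-1) ^+ m <= modulus (kfun m (m%:R - x) j z).
Proof.
move=> bz; rewrite modulus_kfun; have h := kden_le bz; have r0 := rr_gt0 R j.1.
have [d0 _] := kden_disc j (box_disc bz).
have -> : rr j.1 `^ (- x) * 20^-1 ^+ m = rr j.1 `^ (m%:R - x) * (20 * rr j.1)^-1 ^+ m.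
  rewrite invfM exprMn (powRD_gt0 _ _ r0) powR_mulrn ?(ltW r0)//.
  have rm : rr j.1 ^+ m * (rr j.1)^-1 ^+ m = 1 by rewrite -exprMn divff ?expr1n// gt_eqF.
  move: (20^-1 ^+ m) => u.
  transitivity ((rr j.1 ^+ m * (rr j.1)^-1 ^+ m) * (rr j.1 `^ (- x) * u)); first by rewrite rm mul1r.
  by move: (rr j.1 ^+ m) ((rr j.1)^-1 ^+ m) (rr j.1 `^ (- x)) => a b c; ring.
apply: ler_wpM2l; first exact: powR_ge0.
have d1 : 0 < modulus (1 - boxcc j * z) by exact: lt_le_trans d0.
apply: lerXn2r; rewrite ?nnegrE ?invr_ge0 ?modulus_ge0 ?mulr_ge0 ?(ltW r0)//.
by rewrite lef_pV2 ?posrE ?mulr_gt0.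
Qed.

(** Up to constants, [rr j.1 * rr q.1 / kdist ^ 2] is [1] minus the square of the pseudo-hyperbolic
    distance of the two reference points; the smaller [d], the larger the hyperbolic
    neighbourhood. *)
Definition close (d : R) : rel (nat * nat) := fun j q => d * kdist j q ^+ 2 < rr j.1 * rr q.1.

Lemma close_sym d : symmetric (close d).
Proof. by move=> j q; rewrite /close kdistC mulrC [in RHS]mulrC (mulrC (rr q.1)) [d * _]mulrC. Qed.

(** For boxes far apart, [(rr j.1 * rr q.1) ^ e <= d ^ e * kdist ^ (2 e)]: lowering both exponents
    by [e] gains the small factor [d ^ e]. *)
Lemma kmx_far d x y e j q : 0 < d -> 0 <= e -> ~~ close d j q ->
  kmx x y j q <= d `^ e * kmx (x - e) (y - e) j q.
Proof.
move=> d0 e0; rewrite /close -leNgt => h.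
have k0 := kdist_gt0 R j q; have r0 := rr_gt0 R j.1; have s0 := rr_gt0 R q.1.
have pe (u a : R) : 0 < u -> u `^ a = u `^ e * u `^ (a - e).
  by move=> u0; rewrite -(powRD_gt0 _ _ u0) addrC subrK.
rewrite /kmx (pe _ x r0) (pe _ y s0).
have -> : kdist j q `^ (x + y) = (kdist j q ^+ 2) `^ e * kdist j q `^ (x - e + (y - e)).
  rewrite -powR_mulrn ?(ltW k0)// -powRrM -(powRD_gt0 _ _ k0).
  by congr (_ `^ _); ring.
have K0 : 0 < (kdist j q ^+ 2) `^ e by rewrite powR_gt0 ?exprn_gt0.
have h1 : (rr j.1 * rr q.1) `^ e <= d `^ e * (kdist j q ^+ 2) `^ e.
  rewrite -(powRM _ (ltW d0) (sqr_ge0 _)); apply: ge0_ler_powR => //.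
  - by rewrite nnegrE; apply: mulr_ge0; exact: ltW.
  - by rewrite nnegrE; apply: mulr_ge0; [exact: ltW|exact: sqr_ge0].
rewrite (powRM _ (ltW r0) (ltW s0)) in h1.
rewrite invfM; have B0 : 0 <= rr j.1 `^ (x - e) * rr q.1 `^ (y - e) / kdist j q `^ (x - e + (y - e)).
  by rewrite !mulr_ge0 ?invr_ge0 ?powR_ge0.
have := ler_wpM2r B0 h1; move: K0.
move: (rr j.1 `^ e) (rr q.1 `^ e) (rr j.1 `^ (x - e)) (rr q.1 `^ (y - e)) ((kdist j q `^ _)^-1) ((kdist j q ^+ 2) `^ e) (d `^ e).
move=> a b c f p K g K0 H.
have -> : a * c * (b * f) * (K^-1 * p) = (a * b * (c * f * p)) / K by ring.
by rewrite ler_pdivrMr// (le_trans H)//; apply: eqW; ring.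
Qed.

(** Every close box contributes at least [d ^ (3/2) * rr j.1 ^ (1/2)] to the row sum of [kmx 2 1],
    which is at most [c * rr j.1 ^ (1/2)]. *)
Lemma close_count d : 0 < d -> exists P : nat, forall s j, uniq s -> all valid s ->
  (count (close d j) s <= P)%N.
Proof.
move=> d0; have [||| c c0 H] := @kmx_row R 2 1; [lra|lra|lra|].
pose e : R := 3 / 2.
exists (Num.truncn (c / d `^ e)) => s j us vs.
have de : 0 < d `^ e by rewrite powR_gt0.
rewrite truncn_ge_nat; last by rewrite divr_ge0 ?(ltW c0) ?(ltW de).
rewrite ler_pdivlMr//.
have r0 := rr_gt0 R j.1; have R0 : 0 < rr j.1 `^ 2^-1 by rewrite powR_gt0.
rewrite -(ler_pM2r R0); apply: le_trans (H s j us vs).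
rewrite -sum1_count natr_sum big_mkcond/= mulr_suml mulr_suml; apply: ler_sum => q _.
case: ifP => [cq|_]; last by rewrite !mul0r mulr_ge0 ?kmx_ge0 ?powR_ge0.
rewrite mul1r /kmx; have k0 := kdist_gt0 R j q; have s0 := rr_gt0 R q.1.
have -> : rr j.1 `^ 2 = rr j.1 `^ 2^-1 * rr j.1 `^ e by rewrite -(powRD_gt0 _ _ r0); congr (_ `^ _); rewrite /e; lra.
have -> : kdist j q `^ (2 + 1) = (kdist j q ^+ 2) `^ e.
  by rewrite -powR_mulrn ?(ltW k0)// -powRrM; congr (_ `^ _); rewrite /e; lra.
have qe : rr q.1 `^ 1 * rr q.1 `^ 2^-1 = rr q.1 `^ e by rewrite -(powRD_gt0 _ _ s0); congr (_ `^ _); rewrite /e; lra.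
have K0 : 0 < (kdist j q ^+ 2) `^ e by rewrite powR_gt0 ?exprn_gt0.
have h1 : d `^ e * (kdist j q ^+ 2) `^ e <= rr j.1 `^ e * rr q.1 `^ e.
  rewrite -!powRM ?sqr_ge0 ?(ltW d0) ?(ltW r0) ?(ltW s0)//; apply: ge0_ler_powR; first by rewrite /e; lra.
  - by rewrite nnegrE mulr_ge0 ?sqr_ge0// ltW.
  - by rewrite nnegrE mulr_ge0// ltW.
  exact: ltW cq.
have -> : rr j.1 `^ 2^-1 * rr j.1 `^ e * rr q.1 `^ 1 / (kdist j q ^+ 2) `^ e * rr q.1 `^ 2^-1 =
    rr j.1 `^ e * rr q.1 `^ e * rr j.1 `^ 2^-1 / (kdist j q ^+ 2) `^ e.
  rewrite -qe; move: (rr j.1 `^ 2^-1) (rr j.1 `^ e) (rr q.1 `^ 1) (rr q.1 `^ 2^-1) => u v w y.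
  by move: (_^-1) => p; ring.
by rewrite ler_pdivlMr// mulrAC ler_wpM2r// ltW.
Qed.

End kernels.

(** * Lower bound *)


Section lower_bound.
Variables (R : realType) (alpha : R).
Hypothesis alpha1 : 0 < alpha + 1.
Implicit Types (z : R[i]) (q j : nat * nat) (s t : seq (nat * nat)) (f g h F : R[i] -> R[i])
  (c : nat * nat -> R[i]) (m : nat).
Local Notation D := (@unit_disc R).
Local Notation rr := (rr R).
Local Notation space := (bergman_space alpha).
Local Notation sq := (sq alpha).
Local Notation Ig := integration_operator.
Local Notation kmx := (@kmx R).
(** The exponent for which a function of size [rr ^ (- sigma)] on a box has weighted square integral
    of order 1 there. *)
Let sigma := (alpha + 2) / 2.

Lemma wint_growth_le F (v : nat * nat -> R) (V : R) : analytic_on_disc F ->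
  (forall q, 0 <= v q) ->
  (forall q z, valid q -> box q.1 q.2 z -> modulus (F z) <= rr q.1 `^ (- sigma) * v q) ->
  (forall s, uniq s -> all valid s -> \sum_(q <- s) v q ^+ 2 <= V) ->
  (wint alpha D F <= (4 `^ `|alpha| * 162 * V)%:E)%E.
Proof.
move=> AF v0 hF hV; apply: area_integral_disc_le.
- by apply: cmeasurable_wint; [exact: cmeasurable_disc|exact: subset_refl|exact: AF].
- by move=> z _; exact: wint_fun_ge0.
move=> s us vs; have c0 : 0 <= 4 `^ `|alpha| * 162 by rewrite mulr_ge0 ?powR_ge0.
apply: (@le_trans _ _ (\sum_(q <- s) (4 `^ `|alpha| * 162 * v q ^+ 2)%:E)%E); last first.
  by rewrite sumEFin -mulr_sumr lee_fin ler_wpM2l// hV.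
rewrite big_seq [leRHS]big_seq; apply: lee_sum => q qs; have vq := allP vs q qs.
have r0 := rr_gt0 R q.1; pose B := (rr q.1 `^ (- sigma) * v q) ^+ 2.
have B0 : 0 <= B by exact: sqr_ge0.
have hB z : box q.1 q.2 z -> modulus (F z) ^+ 2 <= B.
  move=> /(hF q z vq) h; apply: lerXn2r h; rewrite nnegrE ?modulus_ge0//.
  by rewrite mulr_ge0 ?powR_ge0.
apply: le_trans (wint_box_le alpha AF B0 hB) _; rewrite lee_fin; apply: eqW; congr (_ * _).
have E : rr q.1 `^ alpha * rr q.1 ^+ 2 * (rr q.1 `^ (- sigma)) ^+ 2 = 1.
  rewrite -!powR_mulrn ?powR_ge0 ?(ltW r0)// -powRrM -!(powRD_gt0 _ _ r0).
  by rewrite (_ : _ + _ = 0) ?powRr0// /sigma; field.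
by rewrite /B exprMn mulrA E mul1r.
Qed.

Definition kcomb m t c : R[i] -> R[i] := fun z => \sum_(j <- t) c j * kfun m (m%:R - sigma) j z.

Lemma kcomb_analytic m t c : analytic_on_disc (kcomb m t c).
Proof.
elim: t => [|j t IH].
  by apply: (@eq_analytic R (fun=> 0)); [move=> z _; rewrite /kcomb big_nil|exact: analytic_cst].
apply: (@eq_analytic R (fun z => c j * kfun m (m%:R - sigma) j z + kcomb m t c z)).
  by move=> z _; rewrite /kcomb big_cons.
exact: (@analytic_comb R _ _ _ (@kfun_analytic R m _ j) IH).
Qed.

(** The Schur bound with exponents [m - sigma] and [sigma]; here [sigma > 1/2] is [alpha > -1]. *)
Lemma kcomb_le m : 2^-1 < m%:R - sigma -> 2 <= m%:R :> R -> exists2 C : R, 0 < C &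
  forall t c, uniq t -> all valid t ->
    space (kcomb m t c) /\ sq (kcomb m t c) <= C * \sum_(j <- t) modulus (c j) ^+ 2.
Proof.
move=> hm m2; have hs : 2^-1 < sigma by have a1 := alpha1; rewrite /sigma; lra.
have hxy : 2 <= m%:R - sigma + sigma by rewrite subrK.
have [C0 C00 HC] := kmx_schur hm hs hxy.
exists (4 `^ `|alpha| * 162 * ((19 ^+ m) ^+ 2 * C0)).
  by rewrite !mulr_gt0 ?powR_gt0 ?exprn_gt0.
move=> t c ut vt.
have A := @kcomb_analytic m t c.
pose v q := 19 ^+ m * \sum_(j <- t) kmx (m%:R - sigma) sigma j q * modulus (c j).
have v0 q : 0 <= v q.
  by rewrite mulr_ge0 ?exprn_ge0//; apply: sumr_ge0 => j _; rewrite mulr_ge0 ?kmx_ge0 ?modulus_ge0.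
have hF q z : valid q -> box q.1 q.2 z -> modulus (kcomb m t c z) <= rr q.1 `^ (- sigma) * v q.
  move=> _ bz; apply: le_trans (ler_modulus_sum _ _ _) _; rewrite /v mulrA mulr_sumr; apply: ler_sum => j _.
  rewrite modulusM mulrC mulrA; apply: ler_wpM2r; first exact: modulus_ge0.
  by rewrite -mulrA; exact: kfun_le.
have hV s : uniq s -> all valid s -> \sum_(q <- s) v q ^+ 2 <= (19 ^+ m) ^+ 2 * C0 * \sum_(j <- t) modulus (c j) ^+ 2.
  move=> us vs; under eq_bigr do rewrite /v exprMn.
  by rewrite -mulr_sumr -mulrA ler_wpM2l ?sqr_ge0//; exact: HC.
have W := wint_growth_le A v0 hF hV.
have Bk : space (kcomb m t c).
  by apply/(bergman_spaceP alpha1); split => //; exact: le_lt_trans W (ltry _).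
by split => //; rewrite -lee_fin -(wintE alpha1 Bk) -[in leRHS]mulrA.
Qed.

(** The converse of Hardy's inequality, box by box: [f g'] is the derivative of [I_g f], which
    [box_deriv] bounds by the local mass of [I_g f]. *)
Lemma local_derivative_le : exists2 C : R, 0 < C & forall g f s, little_bloch g -> space f ->
  uniq s -> all valid s ->
  (\sum_(q <- s) wint (alpha + 2) (box q.1 q.2) (fun z => f z * complex_derive g z)%R
    <= (C * sq (Ig g f))%:E)%E.
Proof.
pose b := alpha + 2; pose K : R := 4 `^ `|b| * 162 * 2 ^+ 33.
have K0 : 0 < K by rewrite /K !mulr_gt0 ?powR_gt0 ?exprn_gt0.
exists (K * (4 `^ `|alpha| * overlap R)).
  by rewrite mulr_gt0// mulr_gt0 ?powR_gt0// /overlap exprn_gt0.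
move=> g f s Bg Bf us vs; have BG := operator_space alpha1 Bg Bf.
have AG := operator_analytic Bg Bf; have AF := product_analytic Bg Bf.
have := sum_locI_le alpha AG us vs; rewrite (wintE alpha1 BG) -EFinM lee_fin => hS.
apply: (@le_trans _ _ (\sum_(q <- s) (K * (rr q.1 `^ alpha * locI (Ig g f) q))%:E)%E); last first.
  by rewrite sumEFin lee_fin -mulr_sumr -[leRHS]mulrA ler_pM2l.
apply: lee_sum => q _; have r0 := rr_gt0 R q.1.
pose B := 2 ^+ 33 * locI (Ig g f) q / rr q.1 ^+ 4.
have B0 : 0 <= B by rewrite !mulr_ge0 ?exprn_ge0 ?locI_ge0 ?invr_ge0 ?exprn_ge0 ?(ltW r0).
have hB z : box q.1 q.2 z -> modulus (f z * complex_derive g z) ^+ 2 <= B.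
  move=> bz; rewrite -(operator_derive Bg Bf (box_disc bz)) ler_pdivlMr ?exprn_gt0//.
  by apply: (box_deriv AG bz); rewrite subrr modulus0; lra.
apply: le_trans (wint_box_le b AF B0 hB) _; rewrite lee_fin; apply: eqW.
rewrite /B (weight_split alpha r0) -[X in _ `^ alpha * _ `^ X]/(2%:R) powR_mulrn ?(ltW r0)// /K.
move: (4 `^ _) (_ `^ alpha) (2 ^+ 33) (locI _ _) => u v w I.
by field; rewrite gt_eqF.
Qed.

Lemma box_symbol_ge f g q (m : R) : little_bloch g -> space f -> valid q -> 0 <= m ->
  (forall z, box q.1 q.2 z -> rr q.1 `^ (- sigma) * m <= modulus (f z)) ->
  (((4 `^ `|alpha|)^-1 / 256 * m ^+ 2 * box_mean g q)%:E <=
    wint (alpha + 2) (box q.1 q.2) (fun z => f z * complex_derive g z)%R)%E.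
Proof.
move=> Bg Bf vq m0 hf; have [A /andP[hA _] AE] := box_mean_mul Bg vq.
have r0 := rr_gt0 R q.1; have Ag := bloch_derive_analytic Bg.
have mE : cmeasurable (box q.1 q.2 : set R[i]) by exact: cmeasurable_box.
have ED := @box_disc R q.1 q.2; have f4 : 0 < 4 `^ `|alpha| :> R by rewrite powR_gt0.
pose c := (rr q.1 `^ (- sigma) * m) ^+ 2 * ((4 `^ `|alpha|)^-1 * rr q.1 `^ alpha).
have c0 : 0 <= c by rewrite mulr_ge0 ?sqr_ge0// mulr_ge0 ?powR_ge0// invr_ge0 ltW.
have cE : c = (4 `^ `|alpha|)^-1 * m ^+ 2 / rr q.1 ^+ 2.
  have E : (rr q.1 `^ (- sigma)) ^+ 2 * rr q.1 `^ alpha = (rr q.1 ^+ 2)^-1.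
    rewrite -!powR_mulrn ?powR_ge0 ?(ltW r0)// -powRrM -(powRD_gt0 _ _ r0) -powRN.
    by congr (_ `^ _); rewrite /sigma; field.
  by rewrite /c exprMn -E; move: (_^-1) (_ ^+ 2) (_ `^ alpha) => u v w; ring.
apply: (@le_trans _ _ (c%:E * wint 2 (box q.1 q.2) (complex_derive g))%E).
  rewrite AE -EFinM lee_fin; have bm := box_mean_ge0 g q.
  have := ler_wpM2l (mulr_ge0 c0 bm) hA; rewrite -[leRHS]mulrA; apply: le_trans; apply: eqW.
  by rewrite cE; move: (_^-1) (m ^+ 2) (box_mean _ _) => u v w; field; rewrite gt_eqF.
have m2 := cmeasurable_wint 2 mE ED Ag.
have p2 z : box q.1 q.2 z -> 0 <= modulus (complex_derive g z) ^+ 2 * (1 - modulus z ^+ 2) `^ 2.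
  by move=> _; exact: wint_fun_ge0.
rewrite -(area_integralZ mE m2 p2 c0).
have m1 := cmeasurable_wint (alpha + 2) mE ED (product_analytic Bg Bf).
have m3 : cmeasurable_fun (box q.1 q.2) (fun z => c * (modulus (complex_derive g z) ^+ 2 * (1 - modulus z ^+ 2) `^ 2)).
  by apply: cmeasurable_funM; [exact: cmeasurable_fun_cst|exact: m2].
apply: (le_area_integral mE m3 m1) => z bz; first by rewrite mulr_ge0 ?p2.
have w0 := weight_gt0 (ED z bz); rewrite (weight_split alpha w0) modulusM exprMn [leRHS]mulrACA.
apply: ler_wpM2r; first exact: p2.
apply: ler_pM; rewrite ?sqr_ge0//.
- by rewrite mulr_ge0 ?powR_ge0// invr_ge0 ltW.
- by apply: lerXn2r (hf z bz); rewrite nnegrE ?modulus_ge0// mulr_ge0 ?powR_ge0.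
have d0 : 0 < 4^-1 :> R by [].
have [_ h] := nbox_powR alpha (box_nbox d0 bz).
by rewrite mulrC ler_pdivrMr// mulrC.
Qed.

Lemma kernel_vector (K : fieldType) (n k : nat) (B : 'M[K]_(n, k)) : (k < n)%N ->
  exists2 x : 'rV_n, x != 0 & x *m B = 0.
Proof.
move=> kn; have : kermx B != 0.
  by rewrite -mxrank_eq0 mxrank_ker -lt0n subn_gt0 (leq_ltn_trans (rank_leq_col B)).
by case/rowV0Pn => x /sub_kermxP xB x0; exists x.
Qed.

Lemma sqr_max0_sub_ge (p q : R) : 0 <= p -> 0 <= q ->
  2^-1 * p ^+ 2 - q ^+ 2 <= Num.max 0 (p - q) ^+ 2.
Proof.
move=> p0 q0; have [h|h] := leP 0 (p - q); first by have := sqr_ge0 (p - 2 * q); lra.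
rewrite expr0n /=; have pq : p <= q by lra.
have := lerXn2r 2 _ _ pq; rewrite !nnegrE => /(_ p0 q0); have := sqr_ge0 p; lra.
Qed.

(** On the box [j] the own term of the combination is at least [c1 |c_j|] and the others sum to at
    most [M j], both in units of [rr ^ (- sigma)]. Separation puts the factor [d ^ e] in front of
    [M], and the Schur bound makes the sum of the [M j ^ 2] smaller than the diagonal part. What
    survives on each box is multiplied by a symbol mean of at least [A]. *)
Lemma separated_operator_ge m : 2 * sigma + 4 <= m%:R -> exists2 d : R, 0 < d & exists2 C : R, 0 < C &
  forall g t c (A : R), little_bloch g -> uniq t -> all valid t ->
    (forall i j, i \in t -> j \in t -> i != j -> ~~ close d i j) ->
    0 <= A -> (forall j, j \in t -> A <= box_mean g j) ->
    C * A * (\sum_(j <- t) modulus (c j) ^+ 2) <= sq (Ig g (kcomb m t c)).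
Proof.
move=> hm; have a1 := alpha1; have hs : 2^-1 < sigma by rewrite /sigma; lra.
(* Half of the excess of [sigma] over 1/2, so that the lowered exponents still satisfy the Schur
   condition. *)
pose e := (sigma - 2^-1) / 2; have e0 : 0 < e by rewrite /e; lra.
have h1 : 2^-1 < m%:R - sigma - e by rewrite /e; move: (m%:R) (sigma) hm hs => M si hm' hs'; lra.
have h2 : 2^-1 < sigma - e by rewrite /e; move: (sigma) hs => si; lra.
have h3 : 2 <= m%:R - sigma - e + (sigma - e) by rewrite /e; move: (m%:R) (sigma) hm hs => M si hm' hs'; lra.
have h4 : 2^-1 < m%:R - sigma by lra.
have h5 : 2 <= m%:R :> R by move: (m%:R) (sigma) hm hs => M si hm' hs'; lra.
have [Cs Cs0 HS] := kmx_schur h1 h2 h3; have [CL CL0 HL] := local_derivative_le.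
have [CF CF0 HF] := kcomb_le h4 h5.
(* [c1] and [u] are the constants of [kfun_ge] and [kfun_le]. With [d ^ (2 e) = tau] the
   off-diagonal sum is a quarter of [c1 ^ 2] times the sum of the [|c_j|^2], against a half for the
   diagonal. *)
pose c1 : R := 20^-1 ^+ m; pose u : R := 19 ^+ m; pose tau := c1 ^+ 2 / (4 * u ^+ 2 * Cs).
have c10 : 0 < c1 by rewrite exprn_gt0.
have u0 : 0 < u by rewrite exprn_gt0.
have tau0 : 0 < tau by rewrite divr_gt0 ?mulr_gt0 ?exprn_gt0.
pose d := tau `^ (2 * e)^-1; have d0 : 0 < d by rewrite powR_gt0.
have dE : (d `^ e) ^+ 2 = tau.
  rewrite -powR_mulrn ?powR_ge0// -!powRrM (_ : _ * _ = 1) ?powRr1 ?(ltW tau0)//.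
  by field; rewrite gt_eqF.
pose k1 : R := (4 `^ `|alpha|)^-1 / 256.
have k10 : 0 < k1 by rewrite divr_gt0 ?invr_gt0 ?powR_gt0.
exists d => //; exists (k1 * (c1 ^+ 2 / 4) / CL); first by rewrite !mulr_gt0 ?invr_gt0 ?exprn_gt0.
move=> g t c A Bg ut vt sep A0 hA; have [BF _] := HF t c ut vt.
set F := kcomb m t c in BF *; set Sc := \sum_(j <- t) _.
pose M j := u * d `^ e * \sum_(i <- t) kmx (m%:R - sigma - e) (sigma - e) i j * modulus (c i).
have M0 j : 0 <= M j.
  rewrite mulr_ge0 ?mulr_ge0 ?powR_ge0 ?(ltW u0)//.
  by apply: sumr_ge0 => i _; rewrite mulr_ge0 ?kmx_ge0 ?modulus_ge0.
(* On single boxes the off-diagonal part may dominate; only the sum over all boxes is controlled, so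
   the difference is truncated at 0. *)
pose v j := Num.max 0 (c1 * modulus (c j) - M j).
have v0 j : 0 <= v j by rewrite le_max lexx.
have hv j : j \in t -> forall z, box j.1 j.2 z -> rr j.1 `^ (- sigma) * v j <= modulus (F z).
  move=> jt z bz; rewrite /v; case: (leP 0 (c1 * modulus (c j) - M j)) => _; last by rewrite mulr0 modulus_ge0.
  rewrite /F /kcomb (big_rem j)//=; set T := \sum_(i <- rem j t) _.
  have hT : modulus T <= rr j.1 `^ (- sigma) * M j.
    apply: le_trans (ler_modulus_sum _ _ _) _.
    have -> : rr j.1 `^ (- sigma) * M j = \sum_(i <- t) rr j.1 `^ (- sigma) * (u * (d `^ e * kmx (m%:R - sigma - e) (sigma - e) i j) * modulus (c i)).
      by rewrite /M !mulr_sumr; apply: eq_bigr => i _; rewrite !mulrA.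
    rewrite [leRHS](big_rem j)//=; apply: ler_wpDl.
      by rewrite mulr_ge0 ?powR_ge0// mulr_ge0 ?modulus_ge0// mulr_ge0 ?(ltW u0)// mulr_ge0 ?powR_ge0 ?kmx_ge0.
    rewrite big_seq [leRHS]big_seq; apply: ler_sum => i; rewrite (mem_rem_uniq j ut) inE => /andP[ij it].
    have bz' := kfun_le m sigma i bz.
    rewrite modulusM mulrC mulrA; apply: ler_wpM2r; first exact: modulus_ge0.
    apply: (le_trans bz'); apply: ler_wpM2l; first exact: powR_ge0.
    rewrite ler_pM2l//; apply: kmx_far => //; first exact: ltW.
    exact: sep.
  have hj : rr j.1 `^ (- sigma) * (c1 * modulus (c j)) <= modulus (c j * kfun m (m%:R - sigma) j z).
    rewrite modulusM mulrA mulrC; apply: ler_wpM2l; first exact: modulus_ge0.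
    exact: kfun_ge.
  have := ler_modulusB (c j * kfun m (m%:R - sigma) j z + T) T; rewrite addrK.
  by rewrite mulrBr; lra.
have loc := HL g F t Bg BF ut vt.
have low : ((k1 * A * \sum_(j <- t) v j ^+ 2)%:E <= \sum_(q <- t) wint (alpha + 2) (box q.1 q.2) (fun z => F z * complex_derive g z)%R)%E.
  rewrite mulr_sumr -sumEFin big_seq [leRHS]big_seq; apply: lee_sum => j jt.
  have vj := allP vt j jt.
  apply: le_trans (box_symbol_ge Bg BF vj (v0 j) (hv j jt)); rewrite lee_fin -/k1.
  rewrite [leLHS]mulrAC; apply: ler_wpM2l; last exact: hA.
  by apply: mulr_ge0; [exact: ltW|exact: sqr_ge0].
have := le_trans low loc; rewrite lee_fin => {low loc} key.
have sumM : \sum_(j <- t) M j ^+ 2 <= c1 ^+ 2 / 4 * Sc.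
  under eq_bigr do rewrite /M exprMn; rewrite -mulr_sumr exprMn dE.
  apply: le_trans (ler_wpM2l _ (HS t t (fun i => modulus (c i)) ut vt ut vt)) _.
    by rewrite mulr_ge0 ?sqr_ge0// ltW.
  apply: eqW; rewrite /Sc mulrA; congr (_ * _); rewrite /tau.
  by field; rewrite !gt_eqF.
have sumv : c1 ^+ 2 / 4 * Sc <= \sum_(j <- t) v j ^+ 2.
  apply: (@le_trans _ _ (\sum_(j <- t) (2^-1 * (c1 * modulus (c j)) ^+ 2 - M j ^+ 2))).
    rewrite big_split/= sumrN -mulr_sumr; under [X in 2^-1 * X]eq_bigr do rewrite exprMn.
    rewrite -mulr_sumr -/Sc; move: (\sum_(j <- t) M j ^+ 2) sumM => X hX.
    by move: (c1 ^+ 2) (Sc) hX => p q hX; lra.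
  by apply: ler_sum => j _; apply: sqr_max0_sub_ge; rewrite ?M0// mulr_ge0 ?modulus_ge0// ltW.
have kA : 0 <= k1 * A by rewrite mulr_ge0// ltW.
have := le_trans (ler_wpM2l kA sumv) key => {}key.
have -> : k1 * (c1 ^+ 2 / 4) / CL * A * Sc = (k1 * A * (c1 ^+ 2 / 4 * Sc)) / CL.
  by move: (c1 ^+ 2) (CL^-1) => p q; ring.
by rewrite ler_pdivrMr// [leRHS]mulrC.
Qed.

End lower_bound.

(** * Test functions killed by operators of small rank *)

Section lower_theorem.
Variables (R : realType) (alpha : R).
Hypothesis alpha1 : 0 < alpha + 1.
Implicit Types (z : R[i]) (q j : nat * nat) (s t : seq (nat * nat)) (f g h F : R[i] -> R[i])
  (c : nat * nat -> R[i]).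
Local Notation D := (@unit_disc R).
Local Notation space := (bergman_space alpha).
Local Notation sq := (sq alpha).
Local Notation Ig := integration_operator.
Let sigma := (alpha + 2) / 2.

(** The images of the [size t] functions have coordinates in fewer spanning functions, so a nonzero
    row vector kills the coordinate matrix. The factor [b] leaves room to normalise the combination
    afterwards. *)
Lemma rank_kernel (T : (R[i] -> R[i]) -> R[i] -> R[i]) (t : seq (nat * nat)) (f : nat * nat -> R[i] -> R[i]) :
  bounded_operator alpha T -> rank_lt alpha T (size t) -> uniq t -> (forall j, space (f j)) ->
  exists c, 0 < \sum_(j <- t) modulus (c j) ^+ 2 /\
    forall (b : R[i]) z, D z -> T (fun w => \sum_(j <- t) (b * c j) * f j w) z = 0.
Proof.
move=> [_ LT _] [k kn [u Bu Hu]] ut Bf; pose q0 : nat * nat := (0, 0)%N.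
(* Coordinates chosen arbitrarily, for the given functions only; their combinations are handled by
   the linearity of [T]. *)
pose co (i : 'I_(size t)) : 'I_k -> R[i] := projT1 (cid (Hu _ (Bf (nth q0 t i)))).
have coP (i : 'I_(size t)) z : D z -> T (f (nth q0 t i)) z = \sum_(l < k) co i l * u l z.
  by rewrite /co; case: (cid _) => b /= hb; exact: hb.
have [x x0 xB] := kernel_vector (\matrix_(i, l) co i l) kn.
pose c j : R[i] := oapp (fun i : 'I_(size t) => x ord0 i) 0 (insub (index j t)).
have cE (i : 'I_(size t)) : c (nth q0 t i) = x ord0 i.
  by rewrite /c index_uniq// valK.
exists c; split.
  have [i xi] : exists i, x ord0 i != 0.
    apply: contrapT => none; move/eqP: x0; apply; apply/rowP => i; rewrite mxE.
    by apply/eqP; apply: contrapT => /negP xi; apply: none; exists i.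
  rewrite (big_rem (nth q0 t i)) ?mem_nth//= cE ltr_pwDl//; first by rewrite exprn_gt0// modulus_gt0.
  by apply: sumr_ge0 => j _; exact: sqr_ge0.
move=> b z z1.
have -> : (fun w => \sum_(j <- t) (b * c j) * f j w) =
    (fun w => \sum_(i < size t) (b * c (nth q0 t i)) * f (nth q0 t i) w).
  by apply/funext => w; rewrite (big_nth q0) big_mkord.
rewrite (linear_on_disc_sum alpha1 (size t) (fun i => b * c (nth q0 t i)) LT (fun i => Bf (nth q0 t i)) z1).
have -> : \sum_(i < size t) b * c (nth q0 t i) * T (f (nth q0 t i)) z =
    \sum_(i < size t) \sum_(l < k) b * (x ord0 i * co i l) * u l z.
  by apply: eq_bigr => i _; rewrite (coP i z z1) cE mulr_sumr; apply: eq_bigr => l _; ring.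
rewrite exchange_big big1//= => l _; rewrite -mulr_suml -mulr_sumr.
have /matrixP/(_ ord0 l) := xB; rewrite !mxE.
by under eq_bigr do rewrite mxE; move=> ->; rewrite mulr0 mul0r.
Qed.

(** Among the first [m >= n (P + 1)] boxes there are [n] separated ones. Any competitor [S] kills a
    normalised combination [F] of their kernels, so its error is at least the norm of [I_g F]. *)
Theorem singular_value_ge : exists2 p : nat, (1 <= p)%N & exists2 C : R, 0 < C &
  forall (g : R[i] -> R[i]) (a : nat -> R) (n m : nat), little_bloch g -> decreasing_rearrangement g a ->
    (1 <= n)%N -> (n * p <= m)%N ->
    ((C * Num.sqrt (a m))%:E <= singular_value alpha (integration_operator g) n)%E.
Proof.
have a1 := alpha1; have hs : 2^-1 < sigma by rewrite /sigma; lra.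
pose m0 := (Num.truncn (2 * sigma + 4)).+1.
have hm : 2 * sigma + 4 <= m0%:R by rewrite ltW// truncnS_gt.
have h4 : 2^-1 < m0%:R - sigma by move: (m0%:R) (sigma) hm hs => M si hm' hs'; lra.
have h5 : 2 <= m0%:R :> R by move: (m0%:R) (sigma) hm hs => M si hm' hs'; lra.
have [d d0 [C0 C00 HC]] := separated_operator_ge alpha1 hm.
have [CF CF0 HF] := kcomb_le alpha1 h4 h5.
have [P HP] := close_count d0.
exists P.+1 => //; exists (Num.sqrt (C0 / CF)); first by rewrite sqrtr_gt0 divr_gt0.
move=> g a n m Bg da n1 nm.
have am0 : 0 <= a m.
  have m1 : (1 <= m)%N by apply: leq_trans nm; rewrite muln_gt0 n1.
  by have [] := rearrangement_outside m1 da.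
have [s [us ss vs hs']] := rearrangement_inside m da.
have hcl j : j \in s -> (count (close d j) s <= P)%N by move=> _; exact: HP.
have ns : (n * P.+1 <= size s)%N by rewrite ss.
have [t [ut st ts sep]] := separated_subseq us ns hcl (@close_sym R d).
have vt : all valid t by apply/allP => q /ts; exact: (allP vs).
have hA j : j \in t -> a m <= box_mean g j by move=> /ts; exact: hs'.
apply: le_ereal_inf_tmp => _ [S [bS rS] <-].
subst n.
pose f j := kfun m0 (m0%:R - sigma) j.
have Bf j : valid j -> space (f j).
  move=> vj; have vv : all valid [:: j] by rewrite /= vj.
  have [B _] := HF [:: j] (fun=> 1) isT vv.
  apply: (bergman_space_eq alpha1 _ B) => z _.
  by rewrite /kcomb big_seq1 mul1r.
(* [rank_kernel] asks for a family in the space at all indices; on [t] it agrees with [f]. *)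
pose f' j := if valid j then f j else fun=> 0.
have Bf' j : space (f' j).
  by rewrite /f'; case: ifP => [/Bf//|_]; exact: bergman_space0.
have [c0 [s20 ker]] := rank_kernel bS rS ut Bf'.
set s2 := \sum_(j <- t) _ in s20.
(* Scales the coefficients so that the bound of [kcomb_le] gives [F] norm at most 1. *)
pose lam := Num.sqrt (((alpha + 1) * CF * s2)^-1).
have den0 : 0 < (alpha + 1) * CF * s2 by rewrite !mulr_gt0.
have lam2 : lam ^+ 2 = ((alpha + 1) * CF * s2)^-1 by rewrite sqr_sqrtr// invr_ge0 ltW.
pose c j := lam%:C * c0 j.
have cs : \sum_(j <- t) modulus (c j) ^+ 2 = ((alpha + 1) * CF)^-1.
  under eq_bigr do rewrite /c modulusM modulus_real exprMn real_normK ?num_real// lam2.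
  by rewrite -mulr_sumr -/s2 (invfM _ s2) -mulrA mulVf ?mulr1// gt_eqF.
have [BF nF] := HF t c ut vt; rewrite cs in nF.
have lo := HC g t c (a m) Bg ut vt sep am0 hA; rewrite cs in lo.
set F := kcomb alpha m0 t c in BF nF lo.
have SF z : D z -> S F z = 0.
  move=> z1; rewrite -(ker lam%:C z z1); congr (S _ z); apply/funext => w.
  rewrite /F /kcomb big_seq [RHS]big_seq; apply: eq_bigr => j jt.
  by rewrite /f' (allP vt j jt).
have unit : bergman_space alpha F /\ (bergman_norm alpha F <= 1)%E.
  split => //; have one : 0 <= 1 :> R by [].
  rewrite (bergman_norm_le alpha1 F one) (wintE alpha1 BF) -EFinM lee_fin expr1n.
  apply: le_trans (ler_wpM2l (ltW alpha1) nF) _; apply: eqW.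
  by field; rewrite !gt_eqF.
apply: (@le_trans _ _ (bergman_norm alpha (fun z => Ig g F z - S F z))); last first.
  by apply: ereal_sup_ubound; exists F.
have BI := operator_space alpha1 Bg BF.
have -> : bergman_norm alpha (fun z => Ig g F z - S F z) = bergman_norm alpha (Ig g F).
  by rewrite !bergman_normE (eq_wint alpha (f := fun z => Ig g F z - S F z) (h := Ig g F))// => z z1; rewrite SF// subr0.
rewrite bergman_normE (wintE alpha1 BI) -EFinM /= lee_fin -sqrtrM ?ler_wsqrtr//; last first.
  by rewrite divr_ge0// ltW.
have := ler_wpM2l (ltW alpha1) lo; apply: le_trans; apply: eqW.
by field; rewrite !gt_eqF.
Qed.

End lower_theorem.

Theorem theorem1p1 (R : realType) (alpha : R) (halpha : -1 < alpha) :
  exists2 p : nat, (1 <= p)%N &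
    forall g : R[i] -> R[i], little_bloch g ->
    forall a : nat -> R, decreasing_rearrangement g a ->
    exists c C : R,
      [/\ 0 < c, 0 < C,
          forall n : nat, (1 <= n)%N ->
            ((c * Num.sqrt (a (p * n)%N))%:E
               <= singular_value alpha (integration_operator g) n)%E
        & forall n : nat, (1 <= n)%N -> (1 <= n %/ p)%N ->
            (singular_value alpha (integration_operator g) n
               <= (C * Num.sqrt (a (n %/ p)%N))%:E)%E].
Proof.
have alpha1 : 0 < alpha + 1 by lra.
have [p1 p11 [c c0 lower]] := singular_value_ge alpha1.
have [p2 p21 [C C0 upper]] := singular_value_le alpha1.
(* Both bounds hold with slack in the index, for [n p1 <= m] and for [m p2 <= n], so the larger of
   the two integers serves both. The constants [c] and [C] do not depend on [g] either. *)
exists (maxn p1 p2); first by rewrite leq_max p11.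
move=> g Bg a da; exists c, C; split=> // n n1.
  by apply: lower => //; rewrite mulnC leq_mul2r leq_maxl orbT.
move=> m1; apply: upper => //.
by apply: leq_trans (leq_divM n (maxn p1 p2)); rewrite leq_mul2l leq_maxr orbT.
Qed.
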